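(* There is a polynomial-time algorithm that, given a graph $G$, decides whether $G$ admits a star NeS model.
   Context: An embedding tree $\mathcal{T}$ is a tree embedded in the Euclidean plane: each edge is a straight line segment of positive length, segments meet only at common endpoints, and $\mathcal{T}$ is regarded as the set of all points on its segments; $d_{\mathcal{T}}(x,y)$ is the length of the unique path in $\mathcal{T}$ between points $x,y$. A neighborhood subtree of $\mathcal{T}$ with center $c\in\mathcal{T}$ and non-negative rational radius $w$ is $\{p\in\mathcal{T}: d_{\mathcal{T}}(p,c)\le w\}$. A NeS model of a graph $G$ is a pair $(\mathcal{T},(T_v)_{v\in V(G)})$ where each $T_v$ is a neighborhood subtree of $\mathcal{T}$ and for all distinct $u,v$, $uv\in E(G)$ iff $T_u\cap T_v\neq\emptyset$. A star NeS model is a NeS model in which $\mathcal{T}$ is a union of line segments sharing one common endpoint (the center) and otherwise disjoint. *)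

(* Defs.v *)
From HB Require Import structures.
From mathcomp Require Import all_boot all_order all_algebra.
From mathcomp Require Import boolp reals Rstruct.
From Stdlib Require Import Rdefinitions.

Set Implicit Arguments.
Unset Strict Implicit.
Unset Printing Implicit Defensive.
Import Order.TTheory GRing.Theory Num.Theory.

Section Geometry.
Local Open Scope ring_scope.
Variable R : realType.

Definition point := (R * R)%type.

Definition edist (x y : point) : R :=
  Num.sqrt ((x.1 - y.1) ^+ 2 + (x.2 - y.2) ^+ 2).

Definition on_seg (a b x : point) : Prop :=
  exists t : R, 0 <= t <= 1 /\
    x = (a.1 + t * (b.1 - a.1), a.2 + t * (b.2 - a.2)).

Definition is_star (k : nat) (c : point) (p : 'I_k -> point) : Prop :=
  (forall i, p i <> c) /\
  (forall i j x, i <> j -> on_seg c (p i) x -> on_seg c (p j) x -> x = c).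

Definition in_star (k : nat) (c : point) (p : 'I_k -> point) (x : point) :=
  exists i, on_seg c (p i) x.

(* d_T(x,y): length of the unique path in the star tree between x and y:
   along the segment if x and y lie on a common segment, otherwise through
   the center. *)
Definition star_dist (k : nat) (c : point) (p : 'I_k -> point)
    (x y : point) : R :=
  if `[< exists i, on_seg c (p i) x /\ on_seg c (p i) y >]
  then edist x y
  else edist x c + edist c y.

Definition nbh_subtree (k : nat) (c : point) (p : 'I_k -> point)
    (cv : point) (w : R) (x : point) : Prop :=
  in_star c p x /\ star_dist c p x cv <= w.

Definition has_star_NeS_model (n : nat) (e : rel 'I_n) : Prop :=
  exists (k : nat) (c : point) (p : 'I_k -> point)
         (cv : 'I_n -> point) (wv : 'I_n -> rat),
    is_star c p /\
    (forall v, in_star c p (cv v)) /\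
    (forall v, 0 <= wv v) /\
    (forall u v, u <> v ->
       (e u v <-> exists x, nbh_subtree c p (cv u) (ratr (wv u)) x /\
                            nbh_subtree c p (cv v) (ratr (wv v)) x)).
End Geometry.

Inductive tm_dir := TLeft | TRight | TStay.

Record TM := {
  tm_state : finType;
  tm_sym : finType;
  tm_blank : tm_sym;
  tm_in : bool -> tm_sym;
  tm_in_inj : injective tm_in;
  tm_in_blank : forall b, tm_in b <> tm_blank;
  tm_start : tm_state;
  tm_accept : tm_state;
  tm_reject : tm_state;
  tm_acc_rej : tm_accept <> tm_reject;
  tm_delta : tm_state -> tm_sym -> tm_state * tm_sym * tm_dir }.

(* configuration: state, tape left of head (reversed), symbol under head,
   tape right of head; unlisted cells are blank *)
Definition tm_config (M : TM) :=
  (tm_state M * seq (tm_sym M) * tm_sym M * seq (tm_sym M))%type.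

Definition tm_init (M : TM) (w : seq bool) : tm_config M :=
  match w with
  | [::] => (tm_start M, [::], tm_blank M, [::])
  | b :: w' => (tm_start M, [::], tm_in M b, map (tm_in M) w')
  end.

Definition tm_halted (M : TM) (q : tm_state M) : bool :=
  (q == tm_accept M) || (q == tm_reject M).

Definition tm_step (M : TM) (cf : tm_config M) : tm_config M :=
  let: (q, l, h, r) := cf in
  if tm_halted q then cf else
  let: (q', s, d) := tm_delta q h in
  match d with
  | TStay => (q', l, s, r)
  | TLeft => match l with
             | [::] => (q', [::], tm_blank M, s :: r)
             | a :: l' => (q', l', a, s :: r)
             end
  | TRight => match r with
              | [::] => (q', s :: l, tm_blank M, [::])
              | a :: r' => (q', s :: l, a, r')
              end
  end.

Definition tm_run (M : TM) (t : nat) (w : seq bool) : tm_config M :=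
  iter t (@tm_step M) (tm_init M w).

Definition cfg_state (M : TM) (cf : tm_config M) : tm_state M :=
  let: (q, _, _, _) := cf in q.

Definition decides_in_poly_time (M : TM) (L : seq bool -> Prop) : Prop :=
  exists k : nat, forall w : seq bool,
    let q := cfg_state (tm_run M (k * (size w) ^ k + k) w) in
    tm_halted q /\ (q = tm_accept M <-> L w).

Definition graph_enc (n : nat) (e : rel 'I_n) : seq bool :=
  [seq e i j | i <- enum 'I_n, j <- enum 'I_n].

Definition STAR_NES (w : seq bool) : Prop :=
  exists (n : nat) (e : rel 'I_n),
    symmetric e /\ irreflexive e /\ w = graph_enc e /\
    @has_star_NeS_model Rdefinitions.R n e.

(* Main.v *)
(** In a star model of a graph, the balls containing the center form a clique
    [K], which may be chosen to be [N[v1] :&: N[v2]] for two vertices, so [K]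
    can be guessed.  Given a clique [K], the star models with central clique
    [K] are governed by the components of the complement of [K]:
    - each component [D] needs an interval model which all outside neighbours
      of [D] enter from the left.  It is found by peeling off a first clique
      [X], the closed neighbourhood in [D] of some vertex; every admissible
      [X] will do, since the part of a model left of that clique can be
      turned over;
    - on one arm the components form a chain for "every neighbour of [b] is
      complete to [a]" ([a] is nearer to the center than [b]);
    - a ball of [K] reaches equally far into all arms but its own.  Hence, when
      [K] is eliminated by increasing reach, the components in which an
      eliminated [x] has a neighbour that some remaining [y] misses all lie on
      one arm.  Greedily eliminating any [x] whose contested components still
      fit on one arm is correct, by an exchange argument.
    Both greedy procedures are programs that define relations on the vertices by
    first-order formulas and iterate over the vertices.  These compile to
    programs whose variables are positions in the input, then to sequences of
    sweeps of finite transducers over the tape, with each position stored as a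
    mark, and so to a one-tape machine; loop nesting bounds its running time by
    a polynomial. *)

(* Two obstacles shape the proof. In the geometry, arms and lengths are unknown, and a ball of [K]
   behaves differently on its own arm, which is unknown too. The way out is to remove all numbers:
   only the order of the ends of the balls matters, so ranks suffice in one direction and integer
   positions in the other, and the latter make the radii rational. Members [x], [y] of [K] are
   compared only through vertices that [x] meets and [y] misses: if [y] reaches at least as far into
   foreign arms as [x], then [x] must meet those vertices on its own arm. The unknown own arms thus
   become forced mergers of components, and the freedom left is the order of the reaches. In the
   computation, the machine is a bare one-tape machine. The algorithm is therefore limited to
   intermediate results that are binary relations on the vertices: they have the format of the
   input, an array of [n ^ 2] bits. Each greedy loop runs for [n] blind rounds over all candidates,
   which is enough because every successful move shrinks a set. *)
From mathcomp Require Import all_boot all_order all_algebra.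
From mathcomp Require Import boolp reals Rstruct ring lra.
Require Import Defs.

Set Implicit Arguments.
Unset Strict Implicit.
Unset Printing Implicit Defensive.

(** * Merging the arms of a star *)

Section ArmMerging.
Variables (T : finType) (U : {set T}) (cc : rel T).
Implicit Types (X Y A : {set T}) (B : rel T).
(** Abstract stand-ins: [n x u] for having a neighbour in the component of [u], [f x u] for being
    complete to it, and [nl x y u] for having a neighbour there that [y] misses. *)
Variables (n f : rel T) (nl : T -> T -> T -> bool).
Hypothesis ccR : reflexive cc.
Hypothesis ccS : symmetric cc.
Hypothesis ccT : transitive cc.
Hypothesis f_n : forall x u, f x u -> n x u.
Hypothesis nl_n : forall x y u, nl x y u -> n x u.
Hypothesis nl_f : forall x y u, nl x y u -> ~~ f y u.
Hypothesis n_nl : forall x y u, n x u -> ~~ n y u -> nl x y u.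
Hypothesis f_nl : forall x y u, f x u -> ~~ f y u -> nl x y u.
Hypothesis nl_tr : forall x y z u, nl x z u -> ~~ nl y z u -> nl x y u.
Hypothesis cc_n : forall x u v, cc u v -> n x u = n x v.
Hypothesis cc_f : forall x u v, cc u v -> f x u = f x v.
Hypothesis cc_nl : forall x y u v, cc u v -> nl x y u = nl x y v.

Definition precedes (a b : T) := [forall x, (x \notin U) ==> n x b ==> f x a].
Definition cmp (a b : T) := [|| cc a b, precedes a b | precedes b a].
(** A component to which all of [X] is complete can never be contested again; only the living ones
    still constrain the elimination. *)
Definition alive (X : {set T}) (c : T) := [exists y in X, ~~ f y c].
Definition contested (X : {set T}) (x : T) :=
  [set u in U | [exists y in X, nl x y u]].
Definition meets (B : rel T) (A : {set T}) (a : T) := [exists u in A, B a u].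
Definition merge (B : rel T) (A : {set T}) : rel T :=
  fun a b => B a b || (meets B A a && meets B A b).

(** [h] is the reach into foreign arms. A component that distinguishes [x] from some [y] of at least
    the same reach can only lie on the own arm of [x], hence the third clause. *)
Definition arm_solution (X : {set T}) (B : rel T) (arm h : T -> nat) : Prop :=
  [/\ forall a b, B a b -> arm a = arm b,
      forall a b, a \in U -> b \in U -> arm a = arm b -> cmp a b
    & forall x, x \in X -> forall u1 u2,
        u1 \in contested [set y in X | h x <= h y] x ->
        u2 \in contested [set y in X | h x <= h y] x -> arm u1 = arm u2].

(** [B] relates vertices already forced onto one arm. The exchange argument rests on [ai_down]: a
    class made of several components has swallowed every living component below any of its
    members. *)
Record arm_inv (X : {set T}) (B : rel T) : Prop := ArmInv {
  ai_X : forall x, x \in X -> x \notin U;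
  ai_U : forall a b, B a b -> (a \in U) && (b \in U);
  ai_sym : forall a b, B a b -> B b a;
  ai_tr : forall a b c, B a b -> B b c -> B a c;
  ai_cc : forall a b, a \in U -> b \in U -> cc a b -> B a b;
  ai_cmp : forall a b, B a b -> cmp a b;
  ai_down : forall a b c, B a b -> ~~ cc a b -> c \in U -> alive X c ->
     precedes c b -> B c b }.

Lemma precP a b : reflect (forall x, x \notin U -> n x b -> f x a) (precedes a b).
Proof.
apply: (iffP forallP) => H x; first by move=> h1 h2; move: (H x); rewrite h1 h2.
by apply/implyP => h1; apply/implyP => h2; apply: H.
Qed.

Lemma prec_tr b a c : precedes a b -> precedes b c -> precedes a c.
Proof. move=> /precP h1 /precP h2; apply/precP => x hx hn; exact/h1/f_n/h2. Qed.

Lemma prec_ccl a a' b : cc a a' -> precedes a b -> precedes a' b.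
Proof. by move=> h /precP h1; apply/precP => x hx /h1; rewrite (cc_f _ h); apply. Qed.

Lemma prec_ccr a b b' : cc b b' -> precedes a b -> precedes a b'.
Proof. by move=> h /precP h1; apply/precP => x hx; rewrite -(cc_n _ h); apply: h1. Qed.

Lemma cmpC a b : cmp a b -> cmp b a.
Proof. by rewrite /cmp ccS; case/or3P => ->; rewrite ?orbT. Qed.

Lemma alive_cc X a b : cc a b -> alive X a -> alive X b.
Proof. by move=> h /existsP[y hy]; apply/existsP; exists y; rewrite -(cc_f _ h). Qed.

Lemma contestedP X x u :
  reflect (u \in U /\ exists2 y, y \in X & nl x y u) (u \in contested X x).
Proof.
rewrite inE; apply: (iffP andP) => -[hu].
  by case/existsP => y /andP[h1 h2]; split=> //; exists y.
by case=> y h1 h2; split=> //; apply/existsP; exists y; rewrite h1.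
Qed.

Lemma contested_sub X Y x u : X \subset Y -> u \in contested X x -> u \in contested Y x.
Proof.
move=> /subsetP s /contestedP[hu [y hy hn]]; apply/contestedP; split=> //.
by exists y => //; apply: s.
Qed.

Lemma contested_alive X x u : u \in contested X x -> alive X u.
Proof.
by case/contestedP => _ [y hy /nl_f hn]; apply/existsP; exists y; rewrite hy.
Qed.

Lemma contested_cc X x u v : cc u v -> v \in U -> u \in contested X x -> v \in contested X x.
Proof.
move=> h hv /contestedP[hu [y hy hn]]; apply/contestedP; split=> //.
by exists y => //; rewrite -(cc_nl _ _ h).
Qed.

Lemma contested_n X x u : u \in contested X x -> n x u.
Proof. by case/contestedP => _ [y _ /nl_n]. Qed.

Lemma contested_down X x u c : x \notin U -> u \in contested X x -> c \in U ->
  alive X c -> precedes c u -> c \in contested X x.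
Proof.
move=> hx hu hc /existsP[y /andP[hy hf]] /precP hp; apply/contestedP; split=> //.
exists y => //; apply: f_nl => //; apply: hp => //; exact: contested_n hu.
Qed.

(** On a chain, [cc] or [precedes] is a total preorder, so an element with the most elements below
    it is outermost. *)
Lemma chain_max (A : {set T}) : A != set0 ->
  (forall a b, a \in A -> b \in A -> cmp a b) ->
  exists2 q, q \in A & forall c, c \in A -> cc c q \/ precedes c q.
Proof.
move=> /set0Pn[a0 ha0] hch.
pose lq a b := cc a b || precedes a b.
have lqT : transitive lq.
  move=> b a c /orP[h1|h1] /orP[h2|h2]; apply/orP.
  - by left; apply: ccT h2.
  - by right; apply: prec_ccl h2; rewrite ccS.
  - by right; apply: prec_ccr h1.
  - by right; apply: prec_tr h2.
have [q hq hmax] := @arg_maxnP _ a0 (mem A) (fun q => #|[set c in A | lq c q]|) ha0.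
exists q => // c hc; apply/orP; case E: (cc c q || precedes c q) => //.
have hqc : lq q c.
  move: (hch _ _ hc hq) E; rewrite /cmp /lq; case: (cc c q) => //=.
  by case: (precedes c q) => //= -> _; rewrite orbT.
have : #|[set c0 in A | lq c0 q]| < #|[set c0 in A | lq c0 c]|.
  apply: proper_card; apply/properP; split.
    apply/subsetP => z; rewrite !inE => /andP[-> hz] /=; exact: lqT hqc.
  by exists c; rewrite !inE hc /lq ?ccR //= E.
by have /= := hmax _ hc; rewrite /geq ltnNge => ->.
Qed.

(** The merged class is closed downwards for two reasons: what lies below a contested component is
    itself contested, and what lies below any other member was already in its class. *)
Lemma merge_inv X B x : arm_inv X B -> x \in X ->
  (forall a b, merge B (contested X x) a b -> cmp a b) ->
  arm_inv (X :\ x) (merge B (contested X x)).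
Proof.
move=> I hx hch; set L := meets B (contested X x).
have LU a : L a -> a \in U.
  by case/existsP => u /andP[_ /(ai_U I)/andP[]].
have LB a b : B a b -> L b -> L a.
  move=> hab /existsP[u /andP[hu hb]]; apply/existsP; exists u; rewrite hu /=.
  exact: (ai_tr I) hb.
have aliveS c : alive (X :\ x) c -> alive X c.
  case/existsP => y /andP[]; rewrite !inE => /andP[_ hy] hf; apply/existsP.
  by exists y; rewrite hy.
have Ldown b c : L b -> c \in U -> alive X c -> precedes c b -> L c.
  move=> hb hcU hal hp; case/existsP: (hb) => u /andP[hu hbu].
  have hbU := LU _ hb.
  case hc: (cc b u); last first.
    have : B c b by apply: (ai_down I) (ai_sym I hbu) _ hcU hal hp; rewrite ccS hc.
    by move/LB; apply.
  apply/existsP; exists c; apply/andP; split; last by apply: (ai_cc I).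
  apply: contested_down hu hcU hal _; first exact: (ai_X I).
  exact: prec_ccr hp.
split.
- by move=> y; rewrite !inE => /andP[_]; apply: (ai_X I).
- by move=> a b /orP[/(ai_U I)//|/andP[/LU -> /LU ->]].
- by move=> a b /orP[/(ai_sym I) h|/andP[h1 h2]]; apply/orP; [left|right; rewrite h2 h1].
- move=> a b c; rewrite /merge -/L => /orP[h1|/andP[h1 h1']] /orP[h2|/andP[h2 h2']].
  + by rewrite (ai_tr I h1 h2).
  + by rewrite (LB _ _ h1 h2) h2' orbT.
  + by rewrite h1 (LB _ _ (ai_sym I h2) h1') orbT.
  + by rewrite h1 h2' orbT.
- by move=> a b ha hb hc; apply/orP; left; apply: (ai_cc I).
- exact: hch.
- move=> a b c; rewrite /merge -/L => /orP[h1|/andP[h1 h1']] hn hc /aliveS hal hp.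
    by rewrite (ai_down I h1 hn hc hal hp).
  by rewrite h1' (Ldown _ _ h1' hc hal hp) orbT.
Qed.

(** [x] is reinserted with the least reach; the components it contests share an arm because they
    were merged. *)
Lemma sol_unmerge X B x arm h : arm_inv X B -> x \in X ->
  arm_solution (X :\ x) (merge B (contested X x)) arm h ->
  exists h', arm_solution X B arm h'.
Proof.
move=> I hx [s1 s2 s3]; exists (fun y => if y == x then 0 else (h y).+1); split=> //.
  by move=> a b hab; apply: s1; rewrite /merge hab.
move=> y hy u1 u2; case: (eqVneq y x) => [->|hyx] h1 h2.
  apply: s1; apply/orP; right.
  have sub : [set y0 in X | 0 <= (if y0 == x then 0 else (h y0).+1)] \subset X.
    by apply/subsetP => z; rewrite inE => /andP[].
  move: (contested_sub sub h1) (contested_sub sub h2) => {}h1 {}h2.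
  have R u : u \in contested X x -> meets B (contested X x) u.
    move=> hu; apply/existsP; exists u; rewrite hu /=.
    by case/contestedP: hu => hu _; apply: (ai_cc I).
  by rewrite !R.
have sub : [set y0 in X | h y < (if y0 == x then 0 else (h y0).+1)]
   \subset [set y0 in X :\ x | h y <= h y0].
  by apply/subsetP => z; rewrite !inE => /andP[->]; case: eqP.
have hyX : y \in X :\ x by rewrite !inE hyx.
by apply: (s3 y hyX); apply: (contested_sub sub).
Qed.

(** For the vertex of least reach all of [X] competes, so whatever it contests lies on a single arm
    of the solution, where everything is comparable. *)
Lemma sol_feasible X B arm h : arm_inv X B -> X != set0 -> arm_solution X B arm h ->
  exists2 x, x \in X & forall a b, merge B (contested X x) a b -> cmp a b.
Proof.
move=> I /set0Pn[x0 hx0] [s1 s2 s3].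
have [x hx hmin] := @arg_minnP _ x0 (mem X) h hx0.
exists x => // a b.
have E : [set y in X | h x <= h y] = X.
  by apply/setP => y; rewrite inE; case hy: (y \in X) => //=; apply: hmin.
have s3' := s3 x hx; rewrite E in s3'.
case/orP => [hab|/andP[/existsP[u /andP[hu hau]] /existsP[v /andP[hv hbv]]]].
  by case/andP: (ai_U I hab) => ha hb; apply: s2 => //; apply: s1.
case/andP: (ai_U I hau) => ha _; case/andP: (ai_U I hbv) => hb _.
by apply: s2 => //; rewrite (s1 _ _ hau) (s1 _ _ hbv); apply: s3'.
Qed.

(* If the components contested at [x] lie on several arms, they are all moved to
   the arm of the outermost one, [q].  A vertex [w] is harmed when this separates
   components contested at [w]; it is then delayed until no remaining vertex
   misses the moved ones, the rank breaking ties between delayed vertices. *)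
Lemma sol_merge X B x arm h : arm_inv X B -> x \in X ->
  (forall a b, merge B (contested X x) a b -> cmp a b) ->
  arm_solution X B arm h ->
  exists arm' h', arm_solution (X :\ x) (merge B (contested X x)) arm' h'.
Proof.
move=> I hx hch [s1 s2 s3].
set M := contested X x; set L := meets B M.
pose C w := contested [set z in X | h w <= h z] w.
have sX y : [set z in X | h y <= h z] \subset X by apply/subsetP => z; rewrite inE => /andP[].
have CX w u : u \in C w -> u \in contested X w by exact: contested_sub (sX w).
have CU w u : u \in C w -> u \in U by case/contestedP.
have MU u : u \in M -> u \in U by case/contestedP.
have ML u : u \in M -> L u.
  move=> hu; apply/existsP; exists u; rewrite hu /=.
  by apply: (ai_cc I) (ccR u); apply: MU.
have LU a : L a -> a \in U by case/existsP => u /andP[_ /(ai_U I)/andP[]].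
have Lch a b : L a -> L b -> cmp a b by move=> ha hb; apply: hch; rewrite /merge -/L ha hb orbT.
have armcc a b : a \in U -> b \in U -> cc a b -> arm a = arm b.
  by move=> ha hb hc; apply: s1; apply: (ai_cc I).
have xU : x \notin U := ai_X I hx.
have Mdown c u : u \in M -> c \in U -> alive X c -> precedes c u -> c \in M.
  exact: contested_down.
have Mcc u v : cc u v -> v \in U -> u \in M -> v \in M by apply: contested_cc.
have Malive u : u \in M -> alive X u by apply: contested_alive.
have LB a b : B a b -> L b -> L a.
  move=> hab /existsP[u /andP[hu hb]]; apply/existsP; exists u; rewrite hu /=.
  exact: (ai_tr I) hb.
have [one|] := boolP [forall m1 in M, forall m2 in M, arm m1 == arm m2].
  have one' m1 m2 : m1 \in M -> m2 \in M -> arm m1 = arm m2.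
    by move=> h1 h2; move/forall_inP/(_ m1 h1)/forall_inP/(_ m2 h2)/eqP: one.
  exists arm, h; split=> //.
    move=> a b /orP[/s1//|/andP[/existsP[u /andP[hu /s1->]] /existsP[v /andP[hv /s1->]]]].
    exact: one'.
  move=> y; rewrite inE => /andP[_ hy] u1 u2 h1 h2; apply: (s3 y hy).
    by apply: contested_sub h1; apply/subsetP => z; rewrite !inE -andbA => /andP[].
  by apply: contested_sub h2; apply/subsetP => z; rewrite !inE -andbA => /andP[].
rewrite negb_forall_in => /existsP[m1 /andP[hm1]]; rewrite negb_forall_in => /existsP[m2 /andP[hm2 hm12]].
have [||q hq qmax] := @chain_max M.
- by apply/set0Pn; exists m1.
- by move=> a b ha hb; apply: Lch; apply: ML.
have qU := MU _ hq; have qal := Malive _ hq.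
have Mq c : c \in M -> arm c <> arm q -> precedes c q.
  by move=> hc ha; case: (qmax c hc) => // /(armcc c q (MU _ hc) qU).
(* A living member of [L] off the arm of [q] is contested itself: if it lay beyond [q], [ai_down]
   would have tied it to [q]. *)
have LM a : L a -> alive X a -> arm a <> arm q -> a \in M.
  move=> hL hal har; have aU := LU _ hL.
  have [|hqa|haq] := or3P (Lch _ _ hL (ML _ hq)).
  - by move/(armcc _ _ aU qU).
  - exact: Mdown hqa.
  case/existsP: (hL) => m /andP[hm hB].
  case hcc: (cc a m); first by apply: Mcc hm => //; rewrite ccS.
  have : B q a by apply: (ai_down I) (ai_sym I hB) _ qU qal haq; rewrite ccS hcc.
  by move/s1/esym.
(* The outermost member of [M] on arm [a]; the default [x] occurs only for arms without members of
   [M]. *)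
pose em a := odflt x [pick E in M | (arm E == a) &&
   [forall c in M, (arm c == a) ==> (cc c E || precedes c E)]].
have emP c : c \in M -> [/\ em (arm c) \in M, arm (em (arm c)) = arm c
   & forall c', c' \in M -> arm c' = arm c -> cc c' (em (arm c)) \/ precedes c' (em (arm c))].
  move=> hc; rewrite /em; case: pickP => [E /and3P[h1 /eqP h2 /forall_inP h3]|hno] /=.
    by split=> // c' hc' /eqP ha; apply/orP; move: (h3 _ hc'); rewrite ha.
  have [||E hE Emax] := @chain_max [set u in M | arm u == arm c].
  - by apply/set0Pn; exists c; rewrite inE hc eqxx.
  - by move=> a b /setIdP[ha _] /setIdP[hb _]; apply: Lch; apply: ML.
  case/setIdP: hE => hE haE; move: (hno E).
  rewrite /= hE haE /= => /negP[]; apply/forall_inP => c' hc'; apply/implyP => ha.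
  by apply/orP/Emax; rewrite inE hc' ha.
(* Every remaining vertex of reach above [Ta a] is complete to [em a]. *)
pose Ta a := \max_(y in X | ~~ f y (em a)) h y.
have TaP a y : y \in X -> ~~ f y (em a) -> h y <= Ta a.
  by move=> hy hf; rewrite /Ta; apply: (@leq_bigmax_cond _ _ h); rewrite hy.
have TaE a : em a \in M -> exists y, [/\ y \in X, ~~ f y (em a) & h y = Ta a].
  move/Malive/existsP => [y0 /andP[hy0 hf0]]; rewrite /Ta.
  have [|y /andP[hy hf] ->] := @eq_bigmax_cond _ [pred y | (y \in X) && ~~ f y (em a)] h.
    by apply/card_gt0P; exists y0; rewrite inE hy0.
  by exists y.
(* Otherwise a competitor of [x] would make both [em a] and [q] contested at [x], forcing them onto
   one arm. *)
have xT a : em a \in M -> arm (em a) <> arm q -> Ta a < h x.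
  move=> hE haE; rewrite ltnNge; apply/negP => hle; have [y [hy hf hyT]] := TaE a hE.
  have hp := Mq _ hE haE.
  have yS : y \in [set z in X | h x <= h z] by rewrite inE hy hyT.
  have nyq : ~~ n y q.
    by apply: contra hf => hn; move/precP: hp; apply=> //; apply: (ai_X I).
  have nxq := contested_n hq.
  have fxE : f x (em a) by move/precP: hp; apply.
  apply: haE; apply: (s3 x hx).
    by apply/contestedP; split; [apply: MU|exists y => //; apply: f_nl].
  by apply/contestedP; split=> //; exists y => //; apply: n_nl.
pose aw w := if [pick E in C w] is Some E then arm E else 0.
have awP w E : w \in X -> E \in C w -> aw w = arm E.
  move=> hw hE; rewrite /aw; case: pickP => [E' hE'|/(_ E)]; last by rewrite hE.
  exact: (s3 w hw).
pose harmed w := [exists E in C w, exists F in C w, [&& L E, ~~ L F & arm E != arm q]].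
have harmedP w : w \in X -> harmed w -> let a := aw w in
  [/\ em a \in M, arm (em a) = a, a <> arm q, h w <= Ta a
    & f w (em a) /\ exists F, [/\ F \in C w, arm F = a, alive X F, ~~ L F & precedes (em a) F]].
  move=> hw /exists_inP[E hE /exists_inP[F hF /and3P[hLE hLF /eqP haq]]] a.
  have aE : a = arm E by apply: awP.
  have aF : a = arm F by apply: awP.
  have EM : E \in M by apply: LM => //; apply: contested_alive (CX _ _ hE).
  have [h1 h2 h3] := emP _ EM; rewrite -aE in h1 h2 h3.
  have Fal : alive X F by apply: contested_alive (CX _ _ hF).
  have FU := CU _ _ hF.
  have hEF : precedes (em a) F.
    have [hc|//|hp] := or3P (s2 _ _ (MU _ h1) FU (etrans h2 aF)).
      by case/negP: hLF; apply: ML; apply: Mcc h1.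
    by case/negP: hLF; apply: ML; apply: Mdown hp.
  split=> //; [by rewrite aE| |split; [|by exists F]].
    case/contestedP: (hE) => _ [y]; rewrite inE => /andP[hy hwy] /nl_f hf.
    apply: leq_trans hwy _; apply: TaP => //; apply: contra hf => hf.
    case: (h3 _ EM (esym aE)) => [hc|/precP hp]; first by rewrite (cc_f _ hc).
    by apply: hp; [apply: (ai_X I)|apply: f_n].
  by move/precP: hEF; apply; [apply: (ai_X I)|exact: contested_n hF].
(* Old reaches are spread by the factor [N], so that a delayed vertex, placed at [N * Ta + rk + 1],
   falls strictly between two consecutive old values. *)
pose N := #|T| + 2.
pose rk a := #|[set y in X | ~~ f y (em a)]|.
have N0 : 0 < N by rewrite /N addn2.
have rkN a : rk a + 1 < N by rewrite /N addn1 addn2 !ltnS; apply: max_card.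
pose h' w := if harmed w then N * Ta (aw w) + (rk (aw w) + 1) else N * h w.
have h'lo w : w \in X -> N * h w <= h' w.
  move=> hw; rewrite /h'; case: ifP => // /(harmedP w hw)[_ _ _ hT _].
  by apply: leq_trans (leq_addr _ _); rewrite leq_mul2l hT orbT.
have Nlt a b c : N * a <= N * b + c -> c < N -> a <= b.
  move=> h1 h2; rewrite -ltnS -(ltn_pmul2l N0) mulnS addnC.
  by apply: leq_ltn_trans h1 _; rewrite ltn_add2l.
have univ_em c : c \in U -> c \in M -> forall y, y \in X -> f y (em (arm c)) -> f y c.
  move=> cU cM y hy hf; have [_ _ h3] := emP _ cM.
  case: (h3 _ cM erefl) => [hc|/precP hp]; first by rewrite (cc_f _ hc).
  by apply: hp; [apply: (ai_X I)|apply: f_n].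
pose C' w := contested [set z in X :\ x | h' w <= h' z] w.
(* The delays create no new contest: when [w2] becomes a competitor of [w] only by its delay, the
   vertex attaining [Ta] or [x] itself replaces it as a witness. *)
have CC w G : w \in X :\ x -> G \in C' w -> G \in C w.
  rewrite in_setD1 => /andP[wx hw] /contestedP[GU [w2]].
  rewrite inE in_setD1 -andbA => /and3P[w2x hw2 hle] hnl.
  apply/contestedP; split=> //.
  have [hlt|hlt] := leqP (h w) (h w2); first by exists w2; rewrite ?inE ?hw2.
  have w2h : harmed w2.
    case hh: (harmed w2) => //; move: hle; rewrite {2}/h' hh => hle.
    have := leq_trans (h'lo w hw) hle; by rewrite (leq_pmul2l N0) leqNgt hlt.
  have [E1 E2 E3 E4 [E5 [F [hF aF Fal LF EF]]]] := harmedP _ hw2 w2h.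
  set a := aw w2 in E1 E2 E3 E4 E5 aF EF.
  have wT : h w <= Ta a.
    apply: Nlt (rkN a); apply: leq_trans (h'lo w hw) _.
    by move: hle; rewrite {2}/h' w2h.
  have [y [hy hfy hyT]] := TaE a E1.
  have hwy : y \in [set z in X | h w <= h z] by rewrite inE hy hyT.
  have yU := ai_X I hy.
  have byN : n w G -> ~~ n y G -> exists2 y, y \in [set z in X | h w <= h z] & nl w y G.
    by move=> h1 h2; exists y => //; apply: n_nl.
  have nwG := nl_n hnl.
  have nyF : ~~ n y F by apply: contra hfy => hn; move/precP: EF; apply.
  have FU := CU _ _ hF.
  have [aG|aG] := eqVneq (arm G) a.
    have [hc|hp|/precP hp] := or3P (s2 _ _ GU FU (etrans aG (esym aF))).
    - by apply: byN => //; rewrite (cc_n _ hc).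
    - case/negP: (nl_f hnl); move/precP: hp; apply; first exact: (ai_X I).
      exact: contested_n hF.
    - apply: byN => //; apply: contra nyF => hn; apply: f_n; exact: hp.
  have w2G : ~~ nl w2 x G.
    apply/negP => hG; move/eqP: aG; apply.
    rewrite -aF; apply: (s3 w2 hw2) => //; apply/contestedP; split=> //.
    exists x => //; rewrite inE hx /=; apply: ltnW.
    by apply: leq_ltn_trans E4 _; apply: xT => //; rewrite E2.
  have [GM|GM] := boolP (G \in M).
    have [hc|hp|hp] := or3P (Lch _ _ (ML _ GM) (ML _ E1)).
    - by case/eqP: aG; rewrite (armcc _ _ GU (MU _ E1) hc).
    - by case/negP: (nl_f hnl); move/precP: hp; apply; [apply: (ai_X I)|apply: f_n].
    - apply: byN => //; apply: contra hfy => hn; by move/precP: hp; apply.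
  exists x.
    by rewrite inE hx /=; apply: ltnW; apply: leq_ltn_trans wT _; apply: xT => //; rewrite E2.
  have xw2 : ~~ nl x w2 G.
    by apply: contra GM => hh; apply/contestedP; split=> //; exists w2.
  exact: nl_tr hnl xw2.
(* Only living components of the arm of [q] join [L]. Its dead ones outside [L] stay behind, as they
   need not be comparable with the newcomers. *)
pose L' u := L u || (arm u == arm q) && alive X u.
exists (fun u => if L' u then 0 else (arm u).+1), h'.
have qF b : b \in U -> arm b = arm q -> alive X b -> ~~ L b -> precedes q b.
  move=> bU ab bal bL.
  have [hc|hp|//] := or3P (s2 _ _ bU qU ab).
    by case/negP: bL; apply: ML; apply: Mcc hq => //; rewrite ccS.
  by case/negP: bL; apply: ML; apply: Mdown hp.
have L'B a b : B a b -> L' a -> L' b.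
  move=> hab; rewrite /L'; case/orP => [ha|/andP[/eqP ha hal]].
    by rewrite (LB _ _ (ai_sym I hab) ha).
  have [aU bU] := andP (ai_U I hab).
  have [La|La] := boolP (L a); first by rewrite (LB _ _ (ai_sym I hab) La).
  have hp := qF _ aU ha hal La.
  case hc: (cc a b); first by rewrite -(s1 _ _ hab) ha eqxx (alive_cc hc hal) orbT.
  have hB : B q a by apply: (ai_down I) (ai_sym I hab) _ qU qal hp; rewrite ccS hc.
  by case/negP: La; apply: (LB _ _ (ai_sym I hB)); apply: ML.
have LF E F : L E -> F \in U -> arm F = arm q -> alive X F -> ~~ L F -> cmp E F.
  move=> hE FU aF Fal LF; have hqF := qF _ FU aF Fal LF; have EU := LU _ hE.
  have [hc|hp|hp] := or3P (Lch _ _ hE (ML _ hq)).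
  - by apply/or3P; apply: Or32; apply: prec_ccl hqF; rewrite ccS.
  - by apply/or3P; apply: Or32; apply: prec_tr hqF.
  have [EM|EM] := boolP (E \in M).
    case: (qmax _ EM) => hh; apply/or3P; apply: Or32; last exact: prec_tr hqF.
    by apply: prec_ccl hqF; rewrite ccS.
  case/existsP: (hE) => m /andP[hm hB].
  case hcc: (cc E m); first by case/negP: EM; apply: Mcc hm => //; rewrite ccS.
  have /s1 aqE : B q E by apply: (ai_down I) (ai_sym I hB) _ qU qal hp; rewrite ccS hcc.
  by apply: s2 => //; rewrite aF.
split.
- move=> a b /orP[hab|/andP[ha hb]]; last by rewrite /L' /L ha hb.
  have -> : L' b = L' a by apply/idP/idP; apply: L'B => //; apply: (ai_sym I).
  by rewrite (s1 _ _ hab).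
- move=> a b aU bU; case: ifP => ha; case: ifP => hb //; last by case=> /s2; apply.
  move=> _; move: ha hb; rewrite /L'.
  have [La|La] := boolP (L a); have [Lb|Lb] := boolP (L b) => /=.
  + by move=> _ _; apply: Lch.
  + by move=> _ /andP[/eqP h1 h2]; apply: LF.
  + by move=> /andP[/eqP h1 h2] _; apply: cmpC; apply: LF.
  + by move=> /andP[/eqP h1 _] /andP[/eqP h2 _]; apply: s2; rewrite // h1 h2.
(* If only some of the components contested at [w] moved, [w] would be harmed. After its delay a
   competitor would have to be harmed as well, but then its smaller rank puts it before [w]. *)
have half w u1 u2 : w \in X :\ x -> u1 \in C' w -> u2 \in C' w -> L' u1 -> L' u2.
  move=> hw h1 h2; have h1' := CC _ _ hw h1; have h2' := CC _ _ hw h2.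
  have wX : w \in X by move: hw; rewrite in_setD1 => /andP[].
  have aa : arm u1 = arm u2 by apply: (s3 w wX).
  have al2 : alive X u2 by apply: contested_alive (CX _ _ h2').
  rewrite /L' => hL; case: (eqVneq (arm u2) (arm q)) => [|aq]; first by rewrite al2 orbT.
  rewrite orbF; rewrite aa (negPf aq) orbF in hL.
  have [//|nL] := boolP (L u2); exfalso.
  have wh : harmed w.
    by apply/exists_inP; exists u1 => //; apply/exists_inP; exists u2; rewrite // hL nL aa.
  have [E1 E2 E3 E4 [E5 [F [hF aF Fal LF' EF]]]] := harmedP _ wX wh.
  have aw1 : aw w = arm u1 by apply: awP.
  have u1M : u1 \in M.
    by apply: LM => //; [apply: contested_alive (CX _ _ h1')|rewrite aa; apply/eqP].
  case/contestedP: h1 => u1U [y]; rewrite inE in_setD1 -andbA => /and3P[yx hy hle] hnl.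
  have nfy : ~~ f y (em (aw w)).
    by apply: contra (nl_f hnl) => hf; apply: univ_em => //; rewrite -aw1.
  have hyT := TaP _ _ hy nfy.
  have yh : harmed y.
    case yh: (harmed y) => //; move: hle; rewrite /h' wh yh => hle.
    have : N * Ta (aw w) < N * Ta (aw w).
      apply: leq_trans (leq_trans hle _); first by rewrite addn1 addnS ltnS leq_addr.
      by rewrite leq_mul2l hyT orbT.
    by rewrite ltnn.
  have [G1 G2 G3 G4 [G5 _]] := harmedP _ hy yh.
  have lt : rk (aw y) < rk (aw w) /\ Ta (aw y) <= Ta (aw w).
    have sub z : z \notin U -> ~~ f z (em (aw y)) -> ~~ f z (em (aw w)).
      move=> hz; apply: contra => hf.
      have [hc|hp|/precP hp] := or3P (Lch _ _ (ML _ G1) (ML _ E1)).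
      - by move: nfy; rewrite -(cc_f _ hc) G5.
      - by move/precP: hp; apply => //; apply: f_n.
      - by case/negP: nfy; apply: hp; [apply: (ai_X I)|apply: f_n].
    split; last first.
      have [z [hz hfz <-]] := TaE _ G1; apply: TaP => //; apply: sub => //; exact: (ai_X I).
    apply: proper_card; apply/properP; split.
      by apply/subsetP => z; rewrite !inE => /andP[hz /sub -> //]; rewrite ?hz //; apply: (ai_X I).
    by exists y; rewrite !inE hy // G5.
  case: lt => lt1 lt2; move: hle; rewrite /h' wh yh leqNgt => /negP[].
  rewrite -addnS; apply: leq_add; [by rewrite leq_mul2l lt2 orbT|by rewrite ltn_add2r].
move=> w hw u1 u2 h1 h2.
have -> : L' u2 = L' u1 by apply/idP/idP; apply: (half w).
case: ifP => // _; congr _.+1; have wX : w \in X by move: hw; rewrite in_setD1 => /andP[].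
by apply: (s3 w wX); apply: CC.
Qed.
End ArmMerging.

(** * Interval keys of components *)

Section Graph.
Variables (T : finType) (e : rel T).
Hypothesis eS : symmetric e.
Hypothesis eI : irreflexive e.
Implicit Types (R S D X K Q : {set T}).

Definition induced R : rel T := fun a b => [&& a \in R, b \in R & e a b].
Definition conn R : rel T := connect (induced R).
Definition component R d := [set x | conn R d x].
Definition touches R : rel T := fun x u => [exists c, conn R u c && e x c].
Definition dominates R : rel T := fun x u => [forall c, conn R u c ==> e x c].
Definition separates R (x y u : T) := [exists c, [&& conn R u c, e x c & ~~ e y c]].

Lemma connS R : symmetric (conn R).
Proof.
by apply: sym_connect_sym => a b; rewrite /induced eS andbCA.
Qed.
Lemma conn_refl R : reflexive (conn R). Proof. exact: connect0. Qed.
Lemma conn_tr R : transitive (conn R). Proof. exact: connect_trans. Qed.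

Lemma conn_in R a b : conn R a b -> a \in R -> b \in R.
Proof.
case/connectP => p; elim: p a => [|c p IH] a /=; first by move=> _ ->.
by case/andP => /and3P[_ hc _] hp hb _; apply: (IH c).
Qed.

Lemma conn_edge R a b : a \in R -> b \in R -> e a b -> conn R a b.
Proof. by move=> h1 h2 h3; apply: connect1; rewrite /induced h1 h2. Qed.

Lemma dom_touch R x u : dominates R x u -> touches R x u.
Proof.
by move=> /forallP/(_ u); rewrite conn_refl /= => h; apply/existsP; exists u; rewrite conn_refl.
Qed.
Lemma sep_touch R x y u : separates R x y u -> touches R x u.
Proof. by case/existsP => c /and3P[h1 h2 _]; apply/existsP; exists c; rewrite h1. Qed.
Lemma sep_dom R x y u : separates R x y u -> ~~ dominates R y u.
Proof.
case/existsP => c /and3P[h1 _ h2]; apply: contra h2 => /forallP/(_ c); by rewrite h1.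
Qed.
Lemma touch_sep R x y u : touches R x u -> ~~ touches R y u -> separates R x y u.
Proof.
case/existsP => c /andP[h1 h2] h; apply/existsP; exists c; rewrite h1 h2 /=.
by apply: contra h => h; apply/existsP; exists c; rewrite h1.
Qed.
Lemma dom_sep R x y u : dominates R x u -> ~~ dominates R y u -> separates R x y u.
Proof.
move=> /forallP hd; rewrite negb_forall => /existsP[c]; rewrite negb_imply => /andP[h1 h2].
by apply/existsP; exists c; rewrite h1 h2 andbT; move: (hd c); rewrite h1.
Qed.
Lemma sep_tr R x y z u : separates R x z u -> ~~ separates R y z u -> separates R x y u.
Proof.
case/existsP => c /and3P[h1 h2 h3] h; apply/existsP; exists c; rewrite h1 h2 /=.
by apply: contra h => h; apply/existsP; exists c; rewrite h1 h h3.
Qed.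
Lemma conn_eq R u v : conn R u v -> conn R u =1 conn R v.
Proof. by move=> h; apply: same_connect => //; apply: connS. Qed.
Lemma touch_conn R x u v : conn R u v -> touches R x u = touches R x v.
Proof. by move=> h; apply: eq_existsb => c; rewrite (conn_eq h). Qed.
Lemma dom_conn R x u v : conn R u v -> dominates R x u = dominates R x v.
Proof. by move=> h; apply: eq_forallb => c; rewrite (conn_eq h). Qed.
Lemma sep_conn R x y u v : conn R u v -> separates R x y u = separates R x y v.
Proof. by move=> h; apply: eq_existsb => c; rewrite (conn_eq h). Qed.

Definition prec R := precedes R (touches R) (dominates R).
Definition comparable R := cmp R (conn R) (touches R) (dominates R).

Lemma precE R a b : reflect
  (forall x a' b', x \notin R -> conn R a a' -> conn R b b' -> e x b' -> e x a')
  (prec R a b).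
Proof.
apply: (iffP (precP _ _ _ _ _)) => [H x a' b' hx ha hb hxb|H x hx /existsP[b' /andP[hb hxb]]].
  move: (H x hx); rewrite /dominates /touches => H'.
  have /H' : [exists c, conn R b c && e x c] by apply/existsP; exists b'; rewrite hb.
  by move=> /forallP/(_ a')/implyP; apply.
by apply/forallP => a'; apply/implyP => ha; apply: H hb hxb.
Qed.

(* [f] plays the role of the left endpoints of an interval model of [S] in
   which every outside neighbour of [S] enters from the far left. *)
Definition left_key S (f : T -> nat) : Prop :=
  (forall j k, j \in S -> k \in S -> j != k -> f j = f k -> e j k) /\
  (forall i j k, j \in S -> k \in S -> i != j -> (i \in S -> f i <= f j) ->
     f j <= f k -> e i k -> e i j).
Definition good S : Prop := exists f, left_key S f.

Definition boundary D := [set v | (v \notin D) && [exists d in D, e v d]].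
Definition clique (Q : {set T}) := [forall a in Q, forall b in Q, (a != b) ==> e a b].

Lemma cliqueP Q : reflect (forall a b, a \in Q -> b \in Q -> a != b -> e a b) (clique Q).
Proof.
apply: (iffP forall_inP) => H a; first by move=> b /H/forall_inP h /h/implyP; apply.
by move=> ha; apply/forall_inP => b hb; apply/implyP; apply: H.
Qed.

Lemma clique_sub Q (Q' : {set T}) : Q \subset Q' -> clique Q' -> clique Q.
Proof. by move=> /subsetP s /cliqueP h; apply/cliqueP => a b /s ha /s; apply: h. Qed.

Lemma boundaryP D v : reflect (v \notin D /\ exists2 d, d \in D & e v d) (v \in boundary D).
Proof.
rewrite inE; apply: (iffP andP) => -[-> h]; split=> //; first by case/exists_inP: h => d; exists d.
by apply/exists_inP.
Qed.

(** The keys of the outermost component are shifted beyond all others. An outside vertex entering it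
    is complete to the earlier components by [prec], exactly as if it arrived from the far left. *)
Lemma good_append R S q : S \subset R -> q \in S ->
  (forall a b, a \in S -> conn R a b -> b \in S) ->
  good (S :\: component R q) -> good (component R q) ->
  (forall c, c \in S -> conn R c q \/ prec R c q) -> good S.
Proof.
move=> /subsetP SR qS Scl [f1 [t1 m1]] [f2 [t2 m2]] hp; set E := component R q.
pose f w := if w \in E then f2 w + (\max_(z : T) f1 z).+1 else f1 w.
have f1m w : f1 w <= \max_(z : T) f1 z by apply: leq_bigmax.
have ES w : w \in E -> w \in S by rewrite inE; apply: Scl.
have Dif w : w \in S -> w \notin E -> w \in S :\: E by move=> h1 h2; rewrite in_setD h1 h2.
have Eadj a b : a \in E -> b \in R -> e a b -> b \in E.
  by rewrite !inE => h hb he; apply: (conn_tr h); apply: conn_edge => //; apply: SR; apply: ES; rewrite inE.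
exists f; split.
  move=> j k hj hk jk; rewrite /f; case: ifPn => jE; case: ifPn => kE.
  - by move/addIn; apply: t2.
  - by move=> h; move: (f1m k); rewrite -h addnS ltnNge leq_addl.
  - by move=> h; move: (f1m j); rewrite h addnS ltnNge leq_addl.
  - by apply: t1 => //; apply: Dif.
move=> i j k hj hk ij; rewrite /f; case: (boolP (j \in E)) => jE; case: (boolP (k \in E)) => kE.
- move=> hi; rewrite leq_add2r => hjk; apply: m2 => // iE; move: (hi (ES _ iE)).
  by rewrite iE leq_add2r.
- by move=> _ h; move: (leq_trans h (f1m k)); rewrite addnS ltnNge leq_addl.
- move=> hi _ ik; have [iR|iR] := boolP (i \in R).
    have iE : i \in E by apply: Eadj kE iR _; rewrite eS.
    by move: (leq_trans (hi (ES _ iE)) (f1m j)); rewrite iE addnS ltnNge leq_addl.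
  case: (hp j hj) => [hc|/precE h]; first by case/negP: jE; rewrite inE connS.
  by apply: h ik; rewrite ?conn_refl //; move: kE; rewrite inE.
- move=> hi hjk; apply: m1 => //; try exact: Dif.
  by rewrite inE => /andP[/negPf iE /hi]; rewrite iE.
Qed.

Lemma good_union R S : S \subset R ->
  (forall a b, a \in S -> conn R a b -> b \in S) ->
  (forall d, d \in S -> good (component R d)) ->
  (forall a b, a \in S -> b \in S -> comparable R a b) -> good S.
Proof.
elim: {S}_.+1 {-2}S (ltnSn #|S|) => // m IH S hm SR Scl Sg Sch.
case: (set_0Vmem S) => [->|[q0 hq0]].
  by exists (fun=> 0); split=> [j k|i j k]; rewrite inE.
have [q hq qmax] : exists2 q, q \in S & forall c, c \in S -> conn R c q \/ prec R c q.
  apply: (@chain_max T R (conn R) (touches R) (dominates R)); last exact: Sch;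
  first [exact: conn_refl|exact: connS|exact: conn_tr|exact: dom_touch|exact: touch_conn
        |exact: dom_conn|by apply/set0Pn; exists q0].
apply: (good_append SR hq Scl) => //; last exact: Sg.
apply: IH.
- rewrite ltnS in hm; apply: leq_trans hm; apply: proper_card; apply/properP.
  by split; [apply: subsetDl|exists q => //; rewrite !inE conn_refl].
- by apply: subset_trans SR; apply: subsetDl.
- move=> a b; rewrite !inE => /andP[h1 h2] hab; rewrite (Scl a b h2 hab) andbT.
  by apply: contra h1 => h; apply: (conn_tr h); rewrite connS.
- by move=> d; rewrite inE => /andP[_]; apply: Sg.
- by move=> a b; rewrite !inE => /andP[_ ha] /andP[_ hb]; apply: Sch.
Qed.

(** All of [X] gets key 0: it becomes the first clique that anything entering from the left
    meets. *)
Lemma good_prepend D X : X \subset D -> clique (X :|: boundary D) -> good (D :\: X) -> good D.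
Proof.
move=> /subsetP XD /cliqueP cl [f [t m]].
have Dif w : w \in D -> w \notin X -> w \in D :\: X by move=> h1 h2; rewrite in_setD h1 h2.
exists (fun w => if w \in X then 0 else (f w).+1); split.
  move=> j k hj hk jk; case: ifPn => jX; case: ifPn => kX //.
    by move=> _; apply: cl; rewrite // inE ?jX ?kX.
  by case; apply: t => //; apply: Dif.
move=> i j k hj hk ij; case: (boolP (j \in X)) => jX.
  move=> hi _ ik; apply: cl; rewrite // inE ?jX //.
  case: (boolP (i \in X)) => //= iX.
  have [iD|iD] := boolP (i \in D); first by move: (hi iD); rewrite (negPf iX).
  by apply/boundaryP; split=> //; exists k.
case: (boolP (k \in X)) => kX // hi; rewrite ltnS => hjk ik.
apply: (m i j k) => //; [exact: Dif|exact: Dif|].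
by rewrite inE => /andP[/negPf iX /hi]; rewrite iX ltnS.
Qed.

Lemma conn_ind S (P : T -> Prop) a b :
  (forall x y, x \in S -> y \in S -> e x y -> P x -> P y) -> conn S a b -> P a -> P b.
Proof.
move=> H /connectP[p]; elim: p a => [|c p IH] a /=; first by move=> _ ->.
by case/andP => /and3P[ha hc hac] hp hb Pa; apply: (IH c hp hb); apply: H Pa.
Qed.

Lemma conn_sub S R a b : S \subset R -> conn S a b -> conn R a b.
Proof.
move=> /subsetP s; apply: connect_sub => x y /and3P[hx hy he].
by apply: conn_edge => //; apply: s.
Qed.

(** The right end of the interval whose left end is [f j]. *)
Definition reach D (f : T -> nat) j := \max_(w in D | (w == j) || e j w) f w.

Lemma reach_ge D f j w : w \in D -> (w == j) || e j w -> f w <= reach D f j.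
Proof. by move=> h1 h2; rewrite /reach; apply: (@leq_bigmax_cond _ _ f); rewrite h1. Qed.

Lemma reach_self D f j : j \in D -> f j <= reach D f j.
Proof. by move=> h; apply: reach_ge; rewrite ?eqxx. Qed.

Lemma reach_ex D f j w : w \in D -> (w == j) || e j w ->
  exists2 v, v \in D & ((v == j) || e j v) /\ f v = reach D f j.
Proof.
move=> h1 h2; rewrite /reach.
have [|y /andP[hy hf] ->] := @eq_bigmax_cond _ [pred w | (w \in D) && ((w == j) || e j w)] f.
  by apply/card_gt0P; exists w; rewrite inE h1.
by exists y.
Qed.

(** With [f] and [reach] as endpoints this is the intersection rule of an interval model. *)
Lemma key_cross D f i j : left_key D f -> i \in D -> j \in D -> i != j ->
  f i <= reach D f j -> f j <= reach D f i -> e i j.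
Proof.
move=> [t m]; wlog hij : i j / f i <= f j => [H hi hj ij h1 h2|hi hj ij h1 h2].
  have [h|h] := leqP (f i) (f j); first exact: H.
  by rewrite eS; apply: H => //; [apply: ltnW|rewrite eq_sym].
have [|w hw [/orP[/eqP wi|iw] hwr]] := @reach_ex D f i i hi; first by rewrite eqxx.
  by apply: t => //; apply/eqP; rewrite eqn_leq hij -{1}wi hwr.
by apply: (m i j w) => //; rewrite hwr.
Qed.

Definition closed_nbhd D u := [set x in D | (x == u) || e u x].

Lemma comp_adj R d a b : a \in component R d -> a \in R -> b \in R -> e a b -> b \in component R d.
Proof. by rewrite !inE => h ha hb he; apply: (conn_tr h); apply: conn_edge. Qed.

Lemma boundary_out R d v : d \in R -> v \in boundary (component R d) -> v \notin R.
Proof.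
move=> hd /boundaryP[h [c hc hvc]]; apply: contra h => hv.
have hcR : c \in R by move: hc; rewrite inE => /conn_in; apply.
by apply: comp_adj hc hcR hv _; rewrite eS.
Qed.

(** No component of the rest straddles the clique [X]. One on its right keeps its keys. One on its
    left is turned over; the outside vertices are then complete to it, and those of [X] enter it
    from the new left. *)
Lemma good_split R d u e0 : d \in R -> closed_nbhd (component R d) u != set0 ->
  clique (closed_nbhd (component R d) u :|: boundary (component R d)) -> good (component R d) ->
  e0 \in R :\: closed_nbhd (component R d) u -> conn R d e0 ->
  good (component (R :\: closed_nbhd (component R d) u) e0).
Proof.
set D := component R d; set X := closed_nbhd D u; set R' := R :\: X.
move=> hd /set0Pn[x1 hx1] /cliqueP cl [f key] he0 hde0.
have [t m] := key.
have XD x : x \in X -> x \in D by case/setIdP.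
have DR x : x \in D -> x \in R by rewrite inE => /conn_in; apply.
have R'R : R' \subset R by apply: subsetDl.
set E := component R' e0.
have ER' x : x \in E -> x \in R' by rewrite inE => /conn_in; apply.
have ED x : x \in E -> x \in D.
  by rewrite !inE => /(conn_sub R'R); apply: conn_tr.
have EX x : x \in E -> x \notin X by move/ER'; rewrite in_setD => /andP[].
have D'R' x : x \in D -> x \notin X -> x \in R' by move=> h1 h2; rewrite in_setD h2 DR.
have Eadj x y : x \in E -> y \in D -> y \notin X -> e x y -> y \in E.
  by move=> hx hy hyX; apply: comp_adj; [|apply: ER'|apply: D'R'].
have clX x y : x \in X -> y \in X -> x != y -> e x y by move=> hx hy; apply: cl; rewrite in_setU ?hx ?hy.
have clB x y : x \in X -> y \in boundary D -> e y x.
  move=> hx hy; apply: cl; rewrite ?in_setU ?hx ?hy ?orbT //.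
  by apply: contraTneq hy => ->; apply/negP => /boundaryP[/negP]; case; apply: XD.
(* The last left end in [X] is a point common to all intervals of the clique. *)
have [x0 hx0 xmax] := @arg_maxnP _ x1 (mem X) f hx1.
have {}xmax x : x \in X -> f x <= f x0 by move=> hx; apply: xmax.
have x0D := XD _ hx0.
have nuX x : x \in D -> x \notin X -> (x != u) && ~~ e u x.
  by move=> hx; apply: contraR; rewrite negb_and !negbK => h; apply/setIdP.
(* A vertex outside [X] that starts before [x0] must also end before it, since otherwise it would be
   adjacent to [u]. *)
have leftP j w : j \in D -> j \notin X -> f j <= f x0 -> w \in D -> (w == j) || e j w -> f w < f x0.
  move=> hj hjX hjx hw hjw; rewrite ltnNge; apply/negP => hxw.
  have [ju nuj] := andP (nuX _ hj hjX).
  have [uD|uD] := boolP (u \in D).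
    have uX : u \in X by rewrite inE uD eqxx.
    case/negP: nuj; rewrite eS; apply: (key_cross key) => //.
      apply: leq_trans hjx _; apply: reach_ge => //.
      by case/setIdP: hx0.
    by apply: leq_trans (xmax _ uX) _; apply: leq_trans hxw _; apply: reach_ge.
  case/setIdP: hx0 => _ /orP[/eqP xu|ux]; first by rewrite -xu x0D in uD.
  case/negP: nuj; apply: (m u j x0) => //; first by rewrite eq_sym.
  by move=> h; rewrite h in uD.
have [he|he] := leqP (f e0) (f x0); last first.
  have Eright x : x \in E -> f x0 < f x.
    move=> hx; rewrite ltnNge; apply/negP => hle; move: he; rewrite ltnNge => /negP; apply.
    move: (hx); rewrite inE connS => /(@conn_ind _ (fun x => x \in D /\ f x <= f x0)) H.
    suff [] : e0 \in D /\ f e0 <= f x0 by [].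
    apply: H; last by split=> //; apply: ED.
    move=> a b aR bR hab [aD ha].
    have bD : b \in D by apply: comp_adj aD (DR _ aD) _ hab; apply: (subsetP R'R).
    split=> //; apply: ltnW; apply: (leftP a b) => //; last by rewrite hab orbT.
    by move: aR; rewrite in_setD => /andP[].
  exists f; split=> [j k hj hk|i j k hj hk ij hi hjk ik].
    by apply: t; apply: ED.
  apply: (m i j k) => //; try exact: ED.
  move=> iD; have [iE|iE] := boolP (i \in E); first exact: hi.
  have [iX|iX] := boolP (i \in X); first by apply: ltnW; apply: leq_ltn_trans (xmax _ iX) _; apply: Eright.
  by case/negP: iE; apply: (Eadj k) => //; rewrite eS.
have Eleft x : x \in E -> f x <= f x0.
  move=> hx; move: (hx); rewrite inE => /(@conn_ind _ (fun x => x \in D /\ f x <= f x0)) H.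
  suff [] : x \in D /\ f x <= f x0 by [].
  apply: H; last by split=> //; rewrite inE.
  move=> a b aR bR hab [aD ha].
  have bD : b \in D by apply: comp_adj aD (DR _ aD) _ hab; apply: (subsetP R'R).
  split=> //; apply: ltnW; apply: (leftP a b) => //; last by rewrite hab orbT.
  by move: aR; rewrite in_setD => /andP[].
pose b := reach D f.
have blt x : x \in E -> b x < f x0.
  move=> hx; have xD := ED _ hx.
  have [|w hw [hxw hwr]] := @reach_ex D f x x xD; first by rewrite eqxx.
  by rewrite /b -hwr; apply: (leftP x w) => //; [apply: EX|apply: Eleft].
have gE x y : y \in E -> (f x0 - b x <= f x0 - b y) -> b y <= b x.
  by move=> hy; rewrite leq_sub2lE //; apply: ltnW; apply: blt.
(* The mirror image: right ends, counted backwards from [x0]. By [blt] the subtraction never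
   truncates. *)
exists (fun x => f x0 - b x); split=> [j k hj hk jk hb|i j k hj hk ij hi hjk ik].
  have jD := ED _ hj; have kD := ED _ hk.
  have h1 : b k <= b j by apply: gE => //; rewrite hb.
  have h2 : b j <= b k by apply: gE => //; rewrite hb.
  apply: (key_cross key) => //.
    by apply: leq_trans h2; apply: reach_self.
  by apply: leq_trans h1; apply: reach_self.
have jD := ED _ hj; have kD := ED _ hk.
have hbk : b k <= b j by apply: gE.
have [iD|iD] := boolP (i \in D); last first.
  apply: (m i j x0) => //; [by move=> h; rewrite h in iD|exact: Eleft|].
  by apply: clB => //; apply/boundaryP; split=> //; exists k.
have fib : f i <= b j by apply: leq_trans hbk; apply: reach_ge => //; rewrite eS ik orbT.
apply: (key_cross key) => //.
have [iE|iE] := boolP (i \in E).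
  by apply: leq_trans (reach_self _ jD) (gE i j hj (hi iE)).
have [iX|iX] := boolP (i \in X); last first.
  by case/negP: iE; apply: (Eadj k) => //; rewrite eS.
apply: leq_trans (Eleft _ hj) _; apply: reach_ge => //.
by case: eqVneq => //= h; apply: clX => //; rewrite eq_sym.
Qed.

(** Exactly what makes a peel sound: [X] can be put first by [good_prepend], and the components
    behind it form a chain for [good_union]. *)
Definition eligible R u d :=
  let X := closed_nbhd (component R d) u in
  [&& d \in R, X != set0, clique (X :|: boundary (component R d))
    & [forall a in component R d :\: X, forall b in component R d :\: X, comparable (R :\: X) a b]].

(** A discrete intermediate value property along a path. *)
Lemma conn_cross S f a b w : conn S a b -> f a <= f w -> f w <= f b ->
  (exists2 z, conn S a z & f z = f w) \/
  (exists p q, [/\ conn S a p, conn S a q, e p q, f p <= f w & f w <= f q]).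
Proof.
case/connectP => p; elim: p a => [|c p IH] a /=.
  move=> _ -> h1 h2; left; exists a; first exact: conn_refl.
  by apply/eqP; rewrite eqn_leq h1.
case/andP => /and3P[ha hc hac] hp hb h1 h2; have hac' := conn_edge ha hc hac.
have [h|h] := leqP (f w) (f c).
  by right; exists a, c; split=> //; exact: conn_refl.
have [[z hz hzw]|[x [y [h3 h4 h5 h6 h7]]]] := IH c hp hb (ltnW h) h2.
  by left; exists z => //; apply: conn_tr hz.
by right; exists x, y; split=> //; apply: conn_tr; eauto.
Qed.

(** Each failure of [prec] produces a vertex of one component with a larger key than some vertex of
    the other. Failures in both directions interleave the keys, so one component passes over a
    vertex of the other and an edge would join them. *)
Lemma key_comparable R S f a b : S \subset R ->
  (forall a b, a \in S -> conn R a b -> b \in S) -> left_key S f ->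
  a \in S -> b \in S -> comparable R a b.
Proof.
move=> /subsetP SR Scl [t m] ha hb.
case hc: (conn R a b); first by rewrite /comparable /cmp hc.
have nadj x y : x \in S -> y \in S -> e x y -> conn R x y.
  by move=> hx hy; apply: conn_edge; apply: SR.
have noBetween x y z w : x \in S -> w \in S -> ~~ conn R x w ->
    conn R x y -> conn R x z -> f y <= f w -> f w <= f z -> False.
  move=> hx hw nxw hxy hxz h1 h2.
  have hyz : conn R y z by apply: (conn_tr _ hxz); rewrite connS.
  have [[v hv hvw]|[p [q [hp hq hpq h3 h4]]]] := conn_cross hyz h1 h2.
    have hxv := conn_tr hxy hv; have hvS := Scl _ _ hx hxv.
    case/negP: (nxw); apply: (conn_tr hxv); apply: nadj => //.
    by apply: t => //; apply: contraNneq nxw => <-.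
  have hxp := conn_tr hxy hp; have hxq := conn_tr hxy hq.
  have hpS := Scl _ _ hx hxp; have hqS := Scl _ _ hx hxq.
  case/negP: (nxw); apply: (conn_tr hxp); apply: nadj => //.
  by apply: (m p w q) => //; apply: contraNneq nxw => <-.
have violation x y : x \in S -> y \in S -> ~~ prec R x y ->
    exists x' y', [/\ conn R x x', conn R y y' & f y' < f x'].
  move=> hx hy nle.
  rewrite negb_forall in nle; case/existsP: nle => v.
  rewrite !negb_imply => /and3P[hv /existsP[y' /andP[hy' hvy]]].
  rewrite negb_forall => /existsP[x']; rewrite negb_imply => /andP[hx' hvx].
  exists x', y'; split=> //; rewrite ltnNge; apply: contra hvx => hle.
  have x'S := Scl _ _ hx hx'; have y'S := Scl _ _ hy hy'.
  apply: (m v x' y') => //; first by apply: contraNneq hv => ->; apply: SR.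
  by move=> /SR h; rewrite h in hv.
rewrite /comparable /cmp hc /= -/(prec R a b) -/(prec R b a).
case hp1: (prec R a b) => //=; apply/negPn/negP => hp2.
have [a1 [b1 [ha1 hb1 lt1]]] := violation a b ha hb (negbT hp1).
have nba : ~~ conn R b a by rewrite connS hc.
have [b2 [a2 [hb2 ha2 lt2]]] := violation b a hb ha hp2.
have [h|h] := leqP (f a2) (f b1).
  apply: (@noBetween a a2 a1 b1) => //; [exact: Scl hb1| |exact: ltnW].
  by apply/negP => h'; move: hc; rewrite (conn_tr h') // connS.
apply: (@noBetween b b1 b2 a2) => //; [exact: Scl ha2| |exact: ltnW|exact: ltnW].
by apply/negP => h'; move: nba; rewrite (conn_tr h') // connS.
Qed.

Lemma left_key_comp R S f d : S \subset R ->
  (forall a b, a \in S -> conn R a b -> b \in S) -> left_key S f ->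
  d \in S -> left_key (component R d) f.
Proof.
move=> /subsetP SR Scl [t m] hd.
have ES x : x \in component R d -> x \in S by rewrite inE; apply: Scl.
split=> [j k hj hk|i j k hj hk ij hi hjk ik]; first by apply: t; apply: ES.
apply: (m i j k) => //; try exact: ES.
move=> iS; apply: hi; apply: (comp_adj hk); last by rewrite eS.
  by apply: SR; apply: ES.
exact: SR.
Qed.

(** [u] is the vertex, possibly outside the component, whose interval ends first. Its end [beta]
    lies in the intervals of all outside neighbours and of all vertices that start by then, and the
    latter are [X]; the later starts inherit the key, hence form a chain. *)
Lemma eligible_exists R d : d \in R -> good (component R d) -> clique (boundary (component R d)) ->
  exists u, eligible R u d.
Proof.
set D := component R d => hd [f key] /cliqueP cB; have [t m] := key.
have DR x : x \in D -> x \in R by rewrite inE => /conn_in; apply.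
have dD : d \in D by rewrite inE conn_refl.
have [u hu umin] := @arg_minnP _ d [pred u | (u \in D) || (u \in boundary D)] (reach D f)
  (introT orP (or_introl dD)).
have {}umin v : (v \in D) || (v \in boundary D) -> reach D f u <= reach D f v by apply: umin.
exists u; rewrite /eligible -/D; set X := closed_nbhd D u.
have XD x : x \in X -> x \in D by case/setIdP.
set beta := reach D f u.
have Xle x : x \in X -> f x <= beta by case/setIdP => hx h; apply: reach_ge => //; rewrite eq_sym in h *; rewrite eq_sym.
have bB v x : v \in boundary D -> x \in D -> f x <= beta -> e v x.
  move=> hv hx hxb; have := umin v; rewrite hv orbT => /(_ isT) hvb.
  have /boundaryP[vD [w hw hvw]] := hv.
  have [|k hk [/orP[/eqP kv|vk] hkr]] := @reach_ex D f v w hw; first by rewrite hvw orbT.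
    by rewrite -kv hk in vD.
  apply: (m v x k) => //; first by apply: contraNneq vD => ->.
    by move=> h; rewrite h in vD.
  by rewrite hkr; apply: leq_trans hvb.
have gtb x : x \in D -> x \notin X -> beta < f x.
  move=> hx hxX; rewrite ltnNge; apply/negP => hle; case/negP: hxX; apply/setIdP; split=> //.
  case/orP: hu => hu; last by rewrite (bB u x) ?orbT.
  case: eqVneq => //= xu; apply: (key_cross key) => //; first by rewrite eq_sym.
  by apply: leq_trans (reach_self f hu) _; apply: umin; rewrite hx.
apply/and4P; split=> //.
- case/orP: hu => hu; first by apply/set0Pn; exists u; rewrite inE hu eqxx.
  by case/boundaryP: hu => _ [w hw he]; apply/set0Pn; exists w; rewrite inE hw he orbT.
- have cX a b : a \in X -> b \in boundary D -> e a b.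
    by move=> ha hb; rewrite eS; apply: bB => //; [exact: XD|exact: Xle].
  apply/cliqueP => a b /setUP[ha|ha] /setUP[hb|hb] ab.
  + have [aD bD] := (XD _ ha, XD _ hb).
    apply: (key_cross key) => //.
      by apply: leq_trans (Xle _ ha) _; apply: umin; rewrite bD.
    by apply: leq_trans (Xle _ hb) _; apply: umin; rewrite aD.
  + exact: cX.
  + by rewrite eS; apply: cX.
  + exact: cB.
set R' := R :\: X; have R'R : R' \subset R by apply: subsetDl.
apply/forall_inP => a ha; apply/forall_inP => b hb; apply: (key_comparable (f := f) _ _ _ ha hb).
- exact/setSD/subsetP.
- move=> x y /setDP[xD xX] hxy; have xR' : x \in R' by rewrite in_setD xX DR.
  have := conn_in hxy xR'; rewrite !in_setD => /andP[-> _] /=.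
  by move: xD; rewrite !inE => h; apply: (conn_tr h); apply: conn_sub hxy.
split=> [x y /setDP[hx _] /setDP[hy _]|x y z /setDP[hy hyX] /setDP[hz _] hxy hi]; first exact: t.
apply: m => // hx; have [xX|xX] := boolP (x \in X); last by apply: hi; rewrite in_setD xX.
by apply: ltnW; apply: leq_ltn_trans (Xle _ xX) _; apply: gtb.
Qed.

Definition allgood R := forall d, d \in R -> good (component R d).
(** True at the start, when outside neighbours lie in the clique [K]; it lets [eligible_exists]
    apply after every peel. *)
Definition clique_bounded R := forall d, d \in R -> clique (boundary (component R d)).

Lemma comp_eq R a b : conn R a b -> component R a = component R b.
Proof. by move=> h; apply/setP => x; rewrite !inE (conn_eq h). Qed.

Lemma comp_other R d X x : X \subset component R d -> x \in R -> x \notin component R d ->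
  component (R :\: X) x = component R x.
Proof.
move=> /subsetP XD hx hxD; apply/setP => y; rewrite !inE; apply/idP/idP.
  by apply: conn_sub; apply: subsetDl.
move=> h; apply: (@conn_ind R (conn (R :\: X) x) x y) (conn_refl _ x) => // a b ha hb hab hxa.
have hxa' : conn R x a by apply: conn_sub hxa; apply: subsetDl.
have aD : a \notin component R d.
  by apply: contra hxD; rewrite !inE => hda; apply: (conn_tr hda); rewrite connS.
have bD : b \notin component R d.
  by apply: contra aD => bD; apply: comp_adj bD hb ha _; rewrite eS.
apply: (conn_tr hxa); apply: conn_edge => //; rewrite in_setD ?ha ?hb andbT.
  by apply: contra aD; apply: XD.
by apply: contra bD; apply: XD.
Qed.

Lemma closed_nbhd_sub D u : closed_nbhd D u \subset D.
Proof. by apply/subsetP => x /setIdP[]. Qed.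

Lemma eligible_sound R u d : eligible R u d ->
  allgood (R :\: closed_nbhd (component R d) u) -> allgood R.
Proof.
case/and4P; set D := component R d; set X := closed_nbhd D u.
move=> hd X0 cl /forall_inP ch ag x hx.
have XD := closed_nbhd_sub D u.
have DR y : y \in D -> y \in R by rewrite inE => /conn_in; apply.
have [xD|xD] := boolP (x \in D); last first.
  rewrite -(@comp_other R d X) //; apply: ag; rewrite in_setD hx andbT.
  by apply: contra xD; apply: (subsetP XD).
have <- : component R d = component R x by apply: comp_eq; move: xD; rewrite inE.
apply: good_prepend XD cl _; apply: (@good_union (R :\: X)).
- by apply: setSD; apply/subsetP.
- move=> a b /setDP[aD aX] hab; have aR' : a \in R :\: X by rewrite in_setD aX DR.
  have := conn_in hab aR'; rewrite !in_setD => /andP[-> _] /=.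
  move: aD; rewrite !inE => h; apply: (conn_tr h); apply: conn_sub hab; exact: subsetDl.
- by move=> y /setDP[yD yX]; apply: ag; rewrite in_setD yX DR.
- by move=> a b ha hb; move/forall_inP: (ch a ha); apply.
Qed.

Lemma eligible_complete R u d : eligible R u d -> allgood R -> clique_bounded R ->
  allgood (R :\: closed_nbhd (component R d) u) /\
  clique_bounded (R :\: closed_nbhd (component R d) u).
Proof.
case/and4P; set D := component R d; set X := closed_nbhd D u.
move=> hd X0 cl _ ag cb; have XD := closed_nbhd_sub D u.
have DR y : y \in D -> y \in R by rewrite inE => /conn_in; apply.
have R'R : R :\: X \subset R by apply: subsetDl.
split=> x hx; have xR : x \in R by apply: (subsetP R'R).
  have [xD|xD] := boolP (x \in D); last by rewrite (@comp_other R d X) //; apply: ag.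
  by apply: good_split => //; [exact: ag|move: xD; rewrite inE].
have [xD|xD] := boolP (x \in D); last by rewrite (@comp_other R d X) //; apply: cb.
apply: clique_sub cl; apply/subsetP => v /boundaryP[vE [w wE hvw]].
have wR' : w \in R :\: X by move: wE; rewrite inE => /conn_in; apply.
have /andP[wX wD] : (w \notin X) && (w \in D).
  move: (wR'); rewrite in_setD => /andP[-> _] /=; rewrite inE.
  move: xD wE; rewrite !inE => h1 h2; apply: (conn_tr h1); exact: conn_sub h2.
rewrite in_setU; case: (boolP (v \in X)) => //= vX.
have vR : v \notin R.
  apply: contra vE => vR; apply: comp_adj wE wR' _ _; first by rewrite in_setD vX.
  by rewrite eS.
by apply/boundaryP; split; [apply: contra vR; apply: DR|exists w].
Qed.

Lemma eligible_card R u d : eligible R u d -> #|R :\: closed_nbhd (component R d) u| < #|R|.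
Proof.
case/and4P=> hd /set0Pn[x hx] _ _; apply: proper_card; apply/properP.
split; first exact: subsetDl; exists x; last by rewrite in_setD hx.
by case/setIdP: hx; rewrite inE => /conn_in; move/(_ hd).
Qed.

(** * The merging problem for a fixed central clique *)

Section Center.
Variable K : {set T}.

Definition arms_solvable X (B : rel T) := exists arm h, arm_solution (~: K)
  (conn (~: K)) (touches (~: K)) (dominates (~: K)) (separates (~: K)) X B arm h.
Definition arms_inv X (B : rel T) := arm_inv (~: K)
  (conn (~: K)) (touches (~: K)) (dominates (~: K)) X B.
Definition contest := contested (~: K) (separates (~: K)).
Definition same_comp : rel T := fun a b => [&& a \notin K, b \notin K & conn (~: K) a b].

Local Ltac struct := first [exact: conn_refl|exact: connS|exact: conn_tr|exact: dom_touch
  |exact: sep_touch|exact: sep_dom|exact: touch_sep|exact: dom_sep|exact: sep_tr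
  |exact: touch_conn|exact: dom_conn|exact: sep_conn].

Lemma arms_inv_init : arms_inv K same_comp.
Proof.
split=> //.
- by move=> x hx; rewrite inE hx.
- by move=> a b /and3P[ha hb _]; rewrite !inE ha.
- by move=> a b /and3P[ha hb hc]; rewrite /same_comp ha hb connS.
- by move=> a b c /and3P[ha hb hc] /and3P[_ h1 h2]; rewrite /same_comp ha h1 (conn_tr hc).
- by move=> a b; rewrite !inE /same_comp => -> ->.
- by move=> a b /and3P[_ _ hc]; rewrite /cmp hc.
- by move=> a b c /and3P[_ _ ->].
Qed.

Lemma arms_inv_merge X B x : arms_inv X B -> x \in X ->
  (forall a b, merge B (contest X x) a b -> comparable (~: K) a b) ->
  arms_inv (X :\ x) (merge B (contest X x)).
Proof. by move=> h1 h2 h3; apply: merge_inv => //; struct. Qed.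

Lemma arms_solvable_merge X B x : arms_inv X B -> x \in X ->
  (forall a b, merge B (contest X x) a b -> comparable (~: K) a b) ->
  arms_solvable X B <-> arms_solvable (X :\ x) (merge B (contest X x)).
Proof.
move=> h1 h2 h3; split=> -[arm [h H]].
  by apply: sol_merge h1 h2 h3 H; struct.
by exists arm; apply: sol_unmerge h1 h2 H; struct.
Qed.

Lemma arms_feasible X B : arms_inv X B -> X != set0 -> arms_solvable X B ->
  exists2 x, x \in X & forall a b, merge B (contest X x) a b -> comparable (~: K) a b.
Proof. by move=> h1 h2 [arm [h H]]; apply: sol_feasible h1 h2 H; struct. Qed.

(** With nobody left to eliminate, the classes of [B] serve as arms, numbered by a canonical
    representative. *)
Lemma arms_solvable0 B : arms_inv set0 B -> arms_solvable set0 B.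
Proof.
move=> I; exists (fun a => val (enum_rank (odflt a [pick c | B a c]))), (fun=> 0).
have BE a b : B a b -> B a =1 B b.
  by move=> h c; apply/idP/idP; [apply: (ai_tr I); exact: (ai_sym I)|apply: (ai_tr I)].
split=> [a b hab|a b ha hb|x]; last by rewrite inE.
  rewrite (eq_pick (BE _ _ hab)); case: pickP => // /(_ b); rewrite -(BE _ _ hab) hab.
  by [].
have Br x : x \in ~: K -> B x x by move=> hx; apply: (ai_cc I) => //; exact: conn_refl.
move/val_inj/enum_rank_inj; case: pickP => [c hc|/(_ a)]; last by rewrite Br.
case: pickP => [c' hc'|/(_ b)] /=; last by rewrite Br.
by move=> cc'; apply: (ai_cmp I); apply: (ai_tr I) hc _; rewrite cc'; apply: (ai_sym I).
Qed.

End Center.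

(** The combinatorial certificate that replaces the geometry; [polar_star_center] and
    [star_center_model] are its two directions. *)
Definition star_center (K : {set T}) :=
  [/\ clique K, allgood (~: K) & arms_solvable K K (same_comp K)].
End Graph.

(** * Stars in the plane *)

Section Star.
Import Order.TTheory GRing.Theory Num.Theory.
Local Open Scope ring_scope.
Variable R : realType.
Implicit Types (a b : R).

(** Distance in polar form, a point being given by its arm and its distance from the center; [same]
    tells whether the arms agree. *)
Definition polar_dist (same : bool) a b : R := if same then `|a - b| else a + b.

Lemma edistC (x y : point R) : edist x y = edist y x.
Proof. by rewrite /edist; congr Num.sqrt; ring. Qed.

Lemma edist_ge0 (x y : point R) : 0 <= edist x y. Proof. exact: sqrtr_ge0. Qed.

Lemma edist_seg (c p : point R) (s t : R) :
  edist (c.1 + s * (p.1 - c.1), c.2 + s * (p.2 - c.2))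
        (c.1 + t * (p.1 - c.1), c.2 + t * (p.2 - c.2)) = `|s - t| * edist p c.
Proof.
rewrite /edist /= -sqrtr_sqr -sqrtrM ?sqr_ge0 //; congr Num.sqrt; ring.
Qed.

Lemma edist_seg0 (c p : point R) (t : R) : 0 <= t ->
  edist (c.1 + t * (p.1 - c.1), c.2 + t * (p.2 - c.2)) c = t * edist p c.
Proof.
move=> ht; have := edist_seg c p t 0; rewrite !mul0r !addr0 subr0 ger0_norm // => <-.
Qed.

Lemma edist_gt0 (c p : point R) : p <> c -> 0 < edist p c.
Proof.
move=> h; rewrite sqrtr_gt0 lt_neqAle addr_ge0 ?sqr_ge0 // andbT eq_sym.
rewrite paddr_eq0 ?sqr_ge0 // !sqrf_eq0 !subr_eq0; apply/negP => /andP[/eqP h1 /eqP h2].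
by apply: h; case: p c h1 h2 => p1 p2 [c1 c2] /= -> ->.
Qed.

Lemma on_seg_edist (c p x y : point R) : on_seg c p x -> on_seg c p y ->
  edist x y = `|edist x c - edist y c|.
Proof.
move=> [s [/andP[hs _] ->]] [t [/andP[ht _] ->]].
by rewrite edist_seg !edist_seg0 // -mulrBl normrM (ger0_norm (edist_ge0 p c)).
Qed.

Lemma on_seg_at (c p : point R) a : p <> c -> 0 <= a <= edist p c ->
  exists2 x, on_seg c p x & edist x c = a.
Proof.
move=> /edist_gt0 h /andP[h0 h1].
exists (c.1 + a / edist p c * (p.1 - c.1), c.2 + a / edist p c * (p.2 - c.2)).
  exists (a / edist p c); split=> //; rewrite divr_ge0 ?edist_ge0 //=.
  by rewrite ler_pdivrMr // mul1r.
by rewrite edist_seg0 ?divr_ge0 ?edist_ge0 // divfK // gt_eqF.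
Qed.

Lemma on_seg_le (c p x : point R) : on_seg c p x -> edist x c <= edist p c.
Proof.
by move=> [t [/andP[h0 h1] ->]]; rewrite edist_seg0 // ler_piMl // edist_ge0.
Qed.

Lemma edistxx (x : point R) : edist x x = 0.
Proof. by rewrite /edist !subrr expr0n addr0 sqrtr0. Qed.

Section Model.
Variables (k : nat) (c : point R) (p : 'I_k -> point R).
Hypothesis star : is_star c p.

(** The delicate point is the center, which lies on every arm: points taken on different arms share
    a segment only if one of them is the center, and there both formulas agree. *)
Lemma star_distE i j x y : on_seg c (p i) x -> on_seg c (p j) y ->
  star_dist c p x y = polar_dist (i == j) (edist x c) (edist y c).
Proof.
case: star => _ disj hx hy; rewrite /star_dist /polar_dist.
case: asboolP => [[m [hmx hmy]]|hno].
  rewrite (on_seg_edist hmx hmy); case: eqVneq => // ij.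
  have [im|im] := eqVneq i m.
    have -> : y = c by apply: (disj j m) => //; rewrite -im; apply/eqP; rewrite eq_sym.
    by rewrite edistxx subr0 addr0 ger0_norm ?edist_ge0.
  have -> : x = c by apply: (disj i m) => //; apply/eqP.
  by rewrite edistxx sub0r add0r normrN ger0_norm ?edist_ge0.
case: eqVneq => [ij|_]; last by rewrite (edistC c).
by case: hno; exists i; split=> //; rewrite ij.
Qed.

(** The common point is [cv], or the end of a walk of length [wu] from [cu] towards [cv], or, if
    that walk reaches the center, the innermost point of the other ball or the center itself. *)
Lemma nbh_meet i j cu cv wu wv : on_seg c (p i) cu -> on_seg c (p j) cv -> 0 <= wu -> 0 <= wv ->
  (exists x, nbh_subtree c p cu wu x /\ nbh_subtree c p cv wv x) <->
  polar_dist (i == j) (edist cu c) (edist cv c) <= wu + wv.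
Proof.
move=> hu hv hwu hwv; set a := edist cu c; set b := edist cv c.
have a0 : 0 <= a := edist_ge0 _ _; have b0 : 0 <= b := edist_ge0 _ _.
have pne := star.1.
split.
  move=> [x [[_ h1] [[m hm] h2]]].
  move: h1 h2; rewrite (star_distE hm hu) (star_distE hm hv) -/a -/b.
  have := edist_ge0 x c; move: (edist x c) => s s0; rewrite /polar_dist.
  have n1 := ler_norm (s - a); have n1' := ler_norm (- (s - a)).
  have n2 := ler_norm (s - b); have n2' := ler_norm (- (s - b)).
  rewrite !normrN in n1' n2'.
  case: (eqVneq m i) => [mi|mi]; case: (eqVneq m j) => [mj|mj]; case: (eqVneq i j) => [ij|ij];
   rewrite ?ler_norml; try lra.
  by move: ij; rewrite -mi mj eqxx.
have wit x m : on_seg c (p m) x -> polar_dist (m == i) (edist x c) a <= wu ->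
    polar_dist (m == j) (edist x c) b <= wv ->
    exists x, nbh_subtree c p cu wu x /\ nbh_subtree c p cv wv x.
  move=> hm h1 h2; exists x; split; split; try by exists m.
    by rewrite (star_distE hm hu).
  by rewrite (star_distE hm hv).
have ale := on_seg_le hu; have ble := on_seg_le hv; rewrite -/a in ale; rewrite -/b in ble.
rewrite {1}/polar_dist; case: eqVneq => [ij|ij] hle.
  have [h|h] := lerP `|a - b| wu.
    apply: (wit cv j) => //; rewrite /polar_dist ?eqxx ?subrr ?normr0 // eq_sym ij eqxx.
    by rewrite distrC.
  have [hab|hab] := lerP a b.
    have hn : `|a - b| = b - a by rewrite ler0_norm ?opprB ?subr_le0.
    rewrite hn in h hle.
    have [|x hx hxe] := @on_seg_at c (p i) (a + wu) (pne i).
      by apply/andP; split; [lra|rewrite ij; lra].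
    apply: (wit x i) => //; rewrite /polar_dist ?ij ?eqxx hxe ler_norml; lra.
  have hn : `|a - b| = a - b by rewrite gtr0_norm ?subr_gt0.
  rewrite hn in h hle.
  have [|x hx hxe] := @on_seg_at c (p i) (a - wu) (pne i).
    by apply/andP; split; lra.
  apply: (wit x i) => //; rewrite /polar_dist ?ij ?eqxx hxe ler_norml; lra.
have [h|h] := ltrP wu a.
  have [|x hx hxe] := @on_seg_at c (p i) (a - wu) (pne i); first by apply/andP; split; lra.
  apply: (wit x i) => //; rewrite /polar_dist ?eqxx ?(negPf ij) hxe ?ler_norml; lra.
have [h'|h'] := ltrP wv b.
  have [|x hx hxe] := @on_seg_at c (p j) (b - wv) (pne j); first by apply/andP; split; lra.
  apply: (wit x j) => //; rewrite /polar_dist ?eqxx 1?eq_sym ?(negPf ij) hxe ?ler_norml; lra.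
have [|x hx hxe] := @on_seg_at c (p i) 0 (pne i); first by rewrite lexx edist_ge0.
apply: (wit x i) => //; rewrite /polar_dist ?eqxx ?(negPf ij) hxe ?ler_norml; lra.
Qed.

End Model.

Definition polar_model (n : nat) (e : rel 'I_n) (arm : 'I_n -> nat) (r w : 'I_n -> R) : Prop :=
  [/\ forall v, 0 <= r v, forall v, 0 <= w v
    & forall u v, u <> v -> (e u v <-> polar_dist (arm u == arm v) (r u) (r v) <= w u + w v)].

Lemma star_polar n (e : rel 'I_n) : has_star_NeS_model R e ->
  exists arm r w, polar_model e arm r w.
Proof.
move=> [k [c [p [cv [wv [st [hin [hw he]]]]]]]].
have [a ha] := choice hin.
exists (fun v => val (a v)), (fun v => edist (cv v) c), (fun v => ratr (wv v)); split.
- by move=> v; apply: edist_ge0.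
- by move=> v; rewrite ler0q.
- by move=> u v uv; rewrite he // (inj_eq val_inj) (nbh_meet st (ha u) (ha v)) ?ler0q.
Qed.

Lemma polar_star n (e : rel 'I_n) arm r (q : 'I_n -> rat) :
  polar_model e arm r (fun v => ratr (q v)) -> has_star_NeS_model R e.
Proof.
move=> [r0 w0 he].
pose k := (\max_v arm v).+1; pose L := 1 + \sum_v r v.
have L1 : 1 <= L by rewrite lerDl sumr_ge0.
have rL v : r v <= L.
  rewrite /L (bigD1 v) //= addrCA lerDl addr_ge0 // sumr_ge0 //.
(* The arms have different slopes and end on one vertical line, so equal points have equal
   parameters and, off the center, equal arms. Each arm is at least as long as every [r v]. *)
pose c : point R := (0, 0); pose p (i : 'I_k) : point R := (L, L * i%:R).
have pc i : p i <> c by case=> h _; move: L1; rewrite h ler10.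
have pL i : L <= edist (p i) c.
  have L0 : 0 <= L by lra.
  rewrite /edist /= !subr0 -{1}(ger0_norm L0) -sqrtr_sqr ler_sqrt ?lerDl ?sqr_ge0 //.
  by rewrite addr_ge0 ?sqr_ge0.
have st : is_star c p.
  split=> // i j x ij [s [_ ->]] [t [_]] /=; rewrite !subr0 !add0r => -[h1 h2].
  have Ln : L != 0 by rewrite gt_eqF //; lra.
  have {}h1 : s = t by apply: (mulIf Ln).
  subst t; have [->|s0] := eqVneq s 0; first by rewrite !mul0r.
  case: ij; apply: val_inj; apply/eqP; rewrite -(eqr_nat R); apply/eqP.
  by apply: (mulfI Ln); apply: (mulfI s0).
have ak v : (arm v < k)%N by rewrite ltnS; apply: leq_bigmax.
have /choice[cv hcv] : forall v, exists x, on_seg c (p (Ordinal (ak v))) x /\ edist x c = r v.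
  move=> v; have [|x h1 h2] := @on_seg_at c (p (Ordinal (ak v))) (r v) (pc _).
    by rewrite r0 (le_trans (rL v) (pL _)).
  by exists x.
exists k, c, p, cv, q; split=> //; split; first by move=> v; exists (Ordinal (ak v)); case: (hcv v).
split; first by move=> v; have := w0 v; rewrite ler0q.
move=> u v uv; have [hu eu] := hcv u; have [hv ev] := hcv v.
by rewrite (nbh_meet st hu hv) // eu ev he.
Qed.

End Star.

(** * Making the central clique maximal *)

Section Comb.
Import Order.TTheory GRing.Theory Num.Theory.
Local Open Scope ring_scope.
Variable R : realType.
Variables (n : nat) (e : rel 'I_n).
Hypothesis eS : symmetric e.
Hypothesis eI : irreflexive e.
Local Notation T := 'I_n.
Implicit Types (r w : T -> R) (arm : T -> nat).

Lemma real_argmin (P : pred T) (F : T -> R) i0 : P i0 ->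
  exists2 i, P i & forall j, P j -> F i <= F j.
Proof. by move=> h; case: (arg_minP F h) => i hi hm; exists i. Qed.

Lemma polar_same a b c d : polar_dist true a b <= c + d <->
  (a - c <= b + d :> R) /\ (b - d <= a + c).
Proof. by rewrite /polar_dist ler_norml; split=> [/andP[]|[]]; intros; [split|apply/andP; split]; lra. Qed.

Lemma polar_diff a b c d : polar_dist false a b <= c + d <-> (a - c) + (b - d) <= 0 :> R.
Proof. by rewrite /polar_dist; split; intros; lra. Qed.

Lemma polar_distC b x y : polar_dist b x y = polar_dist b y x :> R.
Proof. by case: b; [apply: distrC|apply: addrC]. Qed.

Definition central r w := [set v | r v <= w v].

(** A ball off the center that meets all central balls can be inflated inwards up to the center.
    Taking the one whose inner end is nearest to the center keeps the graph unchanged, and the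
    number of noncentral balls drops. *)
Lemma polar_maximal arm r w : polar_model e arm r w ->
  exists r' w', polar_model e arm r' w' /\
    forall z, z \notin central r' w' -> exists2 x, x \in central r' w' & ~~ e x z.
Proof.
elim: {r w}_.+1 {-2}r {-2}w (ltnSn #|~: central r w|) => // m IH r w hm pm.
have [r0 w0 he] := pm.
have [none|] := boolP [forall z in ~: central r w, exists x in central r w, ~~ e x z].
  exists r, w; split=> // z hz; move/forall_inP/(_ z): none; rewrite inE hz => /(_ isT) /exists_inP[x h1 h2].
  by exists x.
rewrite negb_forall_in => /exists_inP[z1 hz1 hn1].
pose Z z := (z \notin central r w) && [forall x in central r w, e x z].
have Z1 : Z z1.
  rewrite /Z; rewrite inE in hz1; rewrite hz1 /=; apply/forall_inP => x hx.
  by apply: contraNT hn1 => h; apply/exists_inP; exists x.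
have [z /andP[zK /forall_inP zadj] zmin] := @real_argmin Z (fun z => r z - w z) z1 Z1.
have zw : w z < r z by move: zK; rewrite inE -ltNge.
have r0z := r0 z; have w0z := w0 z.
(* The outer end [r z + w z] stays, and the inner end [r z - w z] moves to 0. *)
pose r' v := if v == z then (r z + w z) / 2 else r v.
pose w' v := if v == z then (r z + w z) / 2 else w v.
have key u : u != z -> e u z <-> polar_dist (arm u == arm z) (r u) ((r z + w z) / 2) <= w u + (r z + w z) / 2.
  move=> uz; have := he u z (elimN eqP uz); have r0u := r0 u; have w0u := w0 u.
  have [uK|uK] := boolP (u \in central r w).
    rewrite (zadj _ uK); rewrite inE in uK; case: eqP => _ _; split=> // _.
      by apply/polar_same; split; lra.
    by apply/polar_diff; lra.
  move: (uK); rewrite inE -ltNge => uw ->; case: eqP => [au|_].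
    rewrite !polar_same; split=> -[h1 h2]; split; try lra.
    (* A ball [u] lying entirely between the center and the old ball of [z] would meet all central
       balls too, against the choice of [z]. *)
    rewrite leNgt; apply/negP => h3.
    have Zu : Z u.
      rewrite /Z uK /=; apply/forall_inP => x hx.
      have xu : x <> u by move=> h; rewrite -h hx in uK.
      have xz : x <> z by move=> h; rewrite -h hx in zK.
      have := zadj x hx; rewrite (he x z xz) => hxz; apply/(he x u xu).
      have := r0 x; have := w0 x; move: hx hxz; rewrite inE au => hx.
      by case: eqP => _; rewrite ?polar_same ?polar_diff; [move=> [h4 h5]|]; intros; [split|]; lra.
    by have /= := zmin _ Zu; lra.
  by rewrite !polar_diff; split; intros; lra.
have [] := IH r' w'.
- rewrite ltnS in hm; apply: leq_trans hm; apply: proper_card; apply/properP; split.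
    apply/subsetP => v; rewrite !inE /r' /w'; case: eqVneq => [_|//]; by rewrite lexx.
  by exists z; rewrite ?inE /r' /w' ?eqxx ?lexx // -ltNge.
- split=> [v|v|u v uv]; rewrite /r' /w'.
  + by case: eqP => // _; lra.
  + by case: eqP => // _; lra.
  case: (eqVneq u z) => [uz|uz]; case: (eqVneq v z) => [vz|vz].
  + by case: uv; rewrite uz.
  + by rewrite uz eS key // polar_distC eq_sym [w v + _]addrC.
  + by rewrite vz key.
  + exact: he.
by move=> r2 [w2 h]; exists r2, w2.
Qed.

End Comb.

(** * From a star model to the combinatorial certificate *)

Section Fwd.
Import Order.TTheory GRing.Theory Num.Theory.
Local Open Scope ring_scope.
Variable R : realType.
Variables (n : nat) (e : rel 'I_n).
Hypothesis eS : symmetric e.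
Hypothesis eI : irreflexive e.
Local Notation T := 'I_n.
Implicit Types (r w : T -> R) (arm : T -> nat).

(** Counting smaller values turns real endpoints into natural numbers in the same order. *)
Lemma rank_le (F : T -> R) u v :
  (#|[set x | (F x < F u)%R]| <= #|[set x | (F x < F v)%R]|)%N = (F u <= F v).
Proof.
apply/idP/idP => h; last first.
  by apply: subset_leq_card; apply/subsetP => x; rewrite !inE => /lt_le_trans; apply.
rewrite leNgt; apply/negP => hlt; move: h; rewrite leqNgt => /negP; apply.
apply: proper_card; apply/properP; split; last by exists v; rewrite !inE ?ltxx.
by apply/subsetP => x; rewrite !inE => /lt_trans; apply.
Qed.

(** [v1] reaches least into foreign arms, and [v2] reaches least into the arm of [v1]. A noncentral
    ball meeting both would meet every central ball, whichever arm it lies on, and maximality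
    excludes this. *)
Lemma polar_center arm r w : (0 < n)%N -> polar_model e arm r w ->
  (forall z, z \notin central r w -> exists2 x, x \in central r w & ~~ e x z) ->
  exists v1 v2, central r w = closed_nbhd e setT v1 :&: closed_nbhd e setT v2.
Proof.
move=> n0 [r0 w0 he] hmax; set K := central r w.
have Kcl x y : x \in K -> y \in K -> x <> y -> e x y.
  move=> hx hy xy; apply/(he x y xy); move: hx hy; rewrite !inE => hx hy.
  have := r0 x; have := r0 y; case: eqP => _; rewrite ?polar_same ?polar_diff; intros; [split|]; lra.
have [x0 hx0] : exists x, x \in K.
  have [h|h] := boolP (Ordinal n0 \in K); first by exists (Ordinal n0).
  by have [x hx _] := hmax _ h; exists x.
have [v1 hv1 min1] := @real_argmin R n (mem K) (fun x => w x - r x) x0 hx0.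
pose reach x := if arm x == arm v1 then r x + w x else w x - r x.
have [v2 hv2 min2] := @real_argmin R n (mem K) reach x0 hx0.
have {}hv1 : v1 \in K := hv1; have {}hv2 : v2 \in K := hv2.
exists v1, v2; apply/setP => u; rewrite in_setI.
have sub v : v \in K -> u \in K -> u \in closed_nbhd e setT v.
  move=> hv hu; apply/setIdP; split; first by rewrite inE.
  by case: eqVneq => //= uv; apply: Kcl => //; apply/eqP; rewrite eq_sym.
apply/idP/andP => [hu|[/setIdP[_ h1] /setIdP[_ h2]]]; first by split; apply: sub.
have [//|uK] := boolP (u \in K); exfalso.
have nuv v : v \in K -> u <> v by move=> hv h; rewrite h hv in uK.
case/orP: h1 => [/eqP h|h1]; first by rewrite h hv1 in uK.
case/orP: h2 => [/eqP h|h2]; first by rewrite h hv2 in uK.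
have [x hx /negP] := hmax u uK; apply.
apply/(he x u); first by move=> h; apply: (nuv x).
have rx := r0 x; have wx := w0 x; have ru := r0 u; have wu := w0 u.
have /= m1 := min1 x hx; have /= m2 := min2 x hx.
have xK := hx; rewrite inE in xK.
have v1u : v1 <> u by move=> h; apply: (nuv v1).
have v2u : v2 <> u by move=> h; apply: (nuv v2).
have [au|au] := eqVneq (arm u) (arm v1).
  move/(he v2 u v2u): h2; move: m2; rewrite /reach -au.
  by do 2 case: eqP => _; rewrite ?polar_same ?polar_diff => m2 h2;
    try case: h2 => h2 h2'; try split; lra.
move/(he v1 u v1u): h1; rewrite eq_sym (negPf au) polar_diff => h1.
by case: eqP => _; rewrite ?polar_same ?polar_diff; try split; lra.
Qed.

(** The signed inner end [a = r - w] supplies all data: ranks of [a] are the keys on every arm,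
    ranks of [- a] the reaches of the central vertices. *)
Lemma polar_star_center arm r w : polar_model e arm r w -> star_center e (central r w).
Proof.
move=> [r0 w0 he]; set K := central r w.
pose a v := r v - w v.
have Kpos v : (v \in K) = (a v <= 0) by rewrite inE /a subr_le0.
have npos v : v \notin K -> 0 < a v by rewrite Kpos -ltNge.
have adj0 x y : x <> y -> a x + a y <= 0 -> e x y.
  rewrite /a => xy h; apply/(he x y xy).
  have := r0 x; have := r0 y; case: eqP => _; rewrite ?polar_same ?polar_diff; intros; [split|]; lra.
have adjA x y : x <> y -> e x y -> 0 < a x + a y -> arm x = arm y.
  move=> xy /(he x y xy); case: eqP => // _; rewrite polar_diff /a => h1 h2.
  by move: (lt_le_trans h2 h1); rewrite ltxx.
have adjS x y : x <> y -> arm x = arm y -> e x y <-> a x <= r y + w y /\ a y <= r x + w x.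
  by move=> xy hxy; rewrite (he x y xy) hxy eqxx polar_same.
pose f v := #|[set x | a x < a v]|.
have fle u v : (f u <= f v)%N = (a u <= a v)%R by apply: rank_le.
have arm_conn u v : u \in ~: K -> conn e (~: K) u v -> arm v = arm u.
  move=> _ h; apply: (@conn_ind _ e (~: K) (fun v => arm v = arm u) u v) h erefl.
  move=> x y; rewrite !in_setC => hx hy hxy <-; apply/esym; apply: adjA => //.
    by move=> h; rewrite h eI in hxy.
  by rewrite addr_gt0 ?npos.
pose S u := [set v in ~: K | arm v == arm u].
have SK u : S u \subset ~: K by apply/subsetP => x /setIdP[].
have Scl u x y : x \in S u -> conn e (~: K) x y -> y \in S u.
  case/setIdP => hx /eqP hxu hxy; apply/setIdP; split; last by rewrite (arm_conn _ _ hx hxy) hxu.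
  exact: conn_in hxy hx.
have key u : left_key e (S u) f.
  split=> [j k /setIdP[hj /eqP aj] /setIdP[hk /eqP ak] /eqP jk hf|i j k].
    have h1 : a j <= a k by rewrite -fle hf.
    have h2 : a k <= a j by rewrite -fle hf.
    apply/adjS => //; first by rewrite aj ak.
    have wj := w0 j; have wk := w0 k; rewrite /a in h1 h2 *; split; lra.
  case/setIdP => [hj /eqP aj] /setIdP[hk /eqP ak] /eqP ij hi; rewrite fle => hjk ik.
  rewrite inE in hj; rewrite inE in hk; have aj0 := npos _ hj; have ak0 := npos _ hk.
  have ik' : i <> k by move=> h; move: ik; rewrite h eI.
  have wj := w0 j.
  have [iK|iK] := boolP (i \in K).
    have ai := iK; rewrite Kpos in ai.
    have [hs|hs] := eqVneq (arm i) (arm k); last first.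
      apply: adj0 => //; have [h|h] := lerP (a i + a k) 0; last by case/eqP: hs; apply: adjA.
      by apply: le_trans h; rewrite lerD2l.
    apply/adjS => //; first by rewrite hs ak aj.
    case/adjS: ik => // _ h2; split; last exact: le_trans hjk h2.
    by apply: le_trans ai _; rewrite addr_ge0.
  have ai := npos _ iK.
  have hs : arm i = arm k by apply: adjA => //; rewrite addr_gt0.
  have iS : i \in S u by apply/setIdP; rewrite inE iK hs ak.
  have := hi iS; rewrite fle => aij.
  apply/adjS => //; first by rewrite hs ak aj.
  case/adjS: ik => // _ h2; split; last exact: le_trans hjk h2.
  by apply: le_trans aij _; rewrite /a; lra.
have uS u : u \in ~: K -> u \in S u by move=> h; apply/setIdP; rewrite h eqxx.
split.
- apply/cliqueP => x y; rewrite !Kpos => hx hy /eqP xy; apply: adj0 => //; lra.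
- by move=> d hd; exists f; apply: (left_key_comp eS (SK d) (Scl d) (key d)); apply: uS.
exists arm, (fun x => #|[set y | - a y < - a x]|); split.
- by move=> u v /and3P[hu _ /arm_conn-> //]; rewrite inE.
- move=> u v hu hv huv; apply: (key_comparable eS (SK u) (Scl u) (key u)); first exact: uS.
  by apply/setIdP; rewrite hv huv.
move=> x hx.
(* [x] has a neighbour [c] in the contested component that is missed by some [y] reaching at least
   as far into foreign arms, so [x] and [c] share an arm. *)
suff home u : u \in contested (~: K) (separates e (~: K))
    [set y in K | (#|[set z | (- a z < - a x)%R]| <= #|[set z | (- a z < - a y)%R]|)%N] x -> arm u = arm x.
  by move=> u1 u2 /home -> /home ->.
case/contestedP => hu [y]; rewrite inE rank_le lerN2 => /andP[hy hxy] /existsP[c /and3P[huc hxc hyc]].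
have hc := conn_in huc hu; rewrite -(arm_conn _ _ hu huc); rewrite inE in hc.
have xc : x <> c by move=> h; rewrite h (negPf hc) in hx.
have yc : y <> c by move=> h; rewrite h (negPf hc) in hy.
apply/esym/adjA => //; rewrite ltNge; apply: contra hyc => h; apply: adj0 => //.
by apply: le_trans h; rewrite lerD2r.
Qed.

End Fwd.

(** * From the certificate back to a star model *)

Section Bwd.
Import Order.TTheory GRing.Theory Num.Theory.
Variable R : realType.
Variables (n : nat) (e : rel 'I_n).
Hypothesis eS : symmetric e.
Hypothesis eI : irreflexive e.
Local Notation T := 'I_n.

(* [lo] and [hi] are the distances from the star center of the two ends of a
   ball, where [lo] counts negatively on the far side for the members of [K]. *)
Lemma nat_polar (K : {set T}) (arm lo hi : T -> nat) :
  (forall v, lo v <= hi v) ->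
  (forall u v, u <> v -> e u v =
     if arm u == arm v
     then ((u \in K) || (lo u <= hi v)) && ((v \in K) || (lo v <= hi u))
     else if u \in K then (v \in K) || (lo v <= lo u) else (v \in K) && (lo u <= lo v)) ->
  (forall v, v \notin K -> 0 < lo v) ->
  has_star_NeS_model R e.
Proof.
move=> lohi he lo0.
pose a v : rat := if v \in K then (- (lo v)%:R)%R else ((lo v)%:R)%R.
pose q v : rat := (((hi v)%:R - a v) / 2)%R.
pose r v : R := (((hi v)%:R + ratr (a v)) / 2)%R.
have qE v : ratr (q v) = (((hi v)%:R - ratr (a v)) / 2)%R :> R.
  by rewrite /q fmorph_div rmorphB /= !ratr_nat.
have aE v : ratr (a v) = (if v \in K then (- (lo v)%:R)%R else ((lo v)%:R)%R) :> R.
  by rewrite /a; case: ifP => _; rewrite ?rmorphN /= ratr_nat.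
have lh v : ((lo v)%:R <= (hi v)%:R :> R)%R by rewrite ler_nat.
have l0 v : (0 <= (lo v)%:R :> R)%R by [].
apply: (@polar_star R n e arm r q); split.
- by move=> v; rewrite /r aE; have := lh v; have := l0 v; case: ifP => _; lra.
- by move=> v; rewrite qE aE; have := lh v; have := l0 v; case: ifP => _; lra.
move=> u v uv; rewrite he //.
have pE : (polar_dist (arm u == arm v) (r u) (r v) <= ratr (q u) + ratr (q v))%R <->
    (if arm u == arm v then ratr (a u) <= (hi v)%:R :> R /\ ratr (a v) <= (hi u)%:R :> R
     else ratr (a u) + ratr (a v) <= 0 :> R)%R.
  rewrite !qE /r; case: (arm u == arm v).
    by split=> [/polar_same[h1 h2]|[h1 h2]]; [split|apply/polar_same; split]; lra.
  by split=> [/polar_diff h|h]; [|apply/polar_diff]; lra.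
have hu : (ratr (a u) <= (hi v)%:R :> R)%R <-> (u \in K) || (lo u <= hi v).
  rewrite aE; case: ifP => /= _; last by rewrite ler_nat.
  by split=> // _; have := l0 u; have := l0 v; have := lh v; lra.
have hv : (ratr (a v) <= (hi u)%:R :> R)%R <-> (v \in K) || (lo v <= hi u).
  rewrite aE; case: ifP => /= _; last by rewrite ler_nat.
  by split=> // _; have := l0 u; have := l0 v; have := lh u; lra.
apply: iff_trans (iff_sym pE); case: (arm u == arm v).
  by split=> [/andP[/hu h1 /hv h2]|[/hu h1 /hv h2]] //; apply/andP.
rewrite !aE; case: ifPn => uK; case: ifPn => vK /=.
- by split=> // _; have := l0 u; have := l0 v; lra.
- by rewrite addrC subr_le0 ler_nat.
- by rewrite subr_le0 ler_nat.
split=> // h; move: (lo0 u uK) (lo0 v vK); rewrite -!(ltr_nat R); lra.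
Qed.

Lemma star_center_model (K : {set T}) : star_center e K -> has_star_NeS_model R e.
Proof.
case=> /cliqueP cl ag [arm [h [s1 s2 s3]]].
pose S j := [set u in ~: K | arm u == j].
have SK j : S j \subset ~: K by apply/subsetP => x /setIdP[].
have /boolp.choice[F hF] : forall j, exists f, left_key e (S j) f.
  move=> j; apply: (@good_union T e eS (~: K) (S j)) => //.
  - move=> x y /setIdP[hx /eqP hj] hxy; have hy := conn_in hxy hx.
    apply/setIdP; split=> //; rewrite -hj eq_sym; apply/eqP; apply: s1.
    by move: hx hy; rewrite !inE => hx hy; rewrite /same_comp hx hy.
  - by move=> d /setIdP[hd _]; apply: ag.
  - by move=> a b /setIdP[ha /eqP aj] /setIdP[hb /eqP bj]; apply: s2; rewrite ?aj.
pose f u := F (arm u) u.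
(* [Bg] exceeds every [(f u).+1], so that [A] orders by [level] first and by key second. *)
pose Bg := (\max_u f u) + 2.
have fB u : (f u).+1 < Bg by rewrite /Bg addn2 ltnS ltnS; apply: leq_bigmax.
(* The least reach above those of all members of [K] that miss [u]. A neighbour of smaller reach has
   to meet [u] on its own arm, as [homeP] confirms. *)
pose level u := \max_(y in K | ~~ e y u) (h y).+1.
pose A u := level u * Bg + (f u).+1.
pose H x := (h x).+1 * Bg.
have levelP u y : y \in K -> ~~ e y u -> h y < level u.
  by move=> hy hn; rewrite /level; apply: (@leq_bigmax_cond _ _ (fun y => (h y).+1)); rewrite hy.
have levelE u m : m < level u -> exists y, [/\ y \in K, ~~ e y u & m <= h y].
  move=> hm; have [none|] := boolP [forall y in K, e y u || (h y < m)].
    suff : level u <= m by rewrite leqNgt hm.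
    apply/bigmax_leqP => y /andP[hy hn]; move/forall_inP/(_ y hy): none.
    by rewrite (negPf hn).
  rewrite negb_forall_in => /exists_inP[y hy]; rewrite negb_or -leqNgt => /andP[h1 h2].
  by exists y.
have AH u x : (A u <= H x) = (level u <= h x).
  have [hl|hl] := leqP (level u) (h x).
    apply: leq_trans (_ : (h x) * Bg + Bg <= _); last by rewrite /H mulSn addnC.
    by apply: leq_add; [rewrite leq_mul2r hl orbT|apply: ltnW].
  apply/negbTE; rewrite -ltnNge /A /H.
  by apply: leq_ltn_trans (_ : level u * Bg < _); rewrite ?leq_mul2r ?hl ?orbT // addnS ltnS leq_addr.
(* A vertex that contests nothing may live on any arm; 0 is an arbitrary choice. *)
pose home x := if [pick u in contest e K [set y in K | h x <= h y] x] is Some u then arm u else 0.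
have homeP x u : x \in K -> u \notin K -> e x u -> h x < level u -> arm u = home x.
  move=> hx hu hxu /levelE[y [hy nyu hxy]].
  have uC : u \in contest e K [set y in K | h x <= h y] x.
    apply/contestedP; split; first by rewrite inE.
    exists y; first by rewrite inE hy.
    by apply/existsP; exists u; rewrite conn_refl hxu.
  by rewrite /home; case: pickP => [u' hu'|/(_ u)]; [apply: (s3 x)|rewrite uC].
(* A member of [K] meeting the vertex with the larger key meets the other one too, so on each arm
   [A] follows the key order. *)
have Fmono u v : u \notin K -> v \notin K -> arm u = arm v -> f u <= f v -> level u <= level v.
  move=> hu hv auv huv; apply/bigmax_leqP => y /andP[hy nyu]; apply: levelP => //.
  apply: contra nyu => hyv; have [_ m] := hF (arm v).
  apply: (m y u v) => //; try by rewrite !inE ?hu ?hv ?auv eqxx.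
  - by apply: contraNneq hu => <-.
  - by rewrite !inE hy.
  - by move: huv; rewrite /f auv.
have AF u v : u \notin K -> v \notin K -> arm u = arm v -> (A u <= A v) = (f u <= f v).
  move=> hu hv auv; have [hl|hl] := leqP (f u) (f v).
    by apply: leq_add => //; rewrite leq_mul2r (Fmono u v) ?orbT.
  apply/negbTE; rewrite -ltnNge /A -[X in X <= _]addnS.
  apply: leq_add; last by rewrite ltnS.
  by rewrite leq_mul2r (Fmono v u) ?orbT // ltnW.
pose lo v := if v \in K then H v else A v.
pose arm' v := if v \in K then home v else arm v.
pose hi v := if v \in K then maxn (H v) (\max_(u in ~: K | (arm u == home v) && e v u) A u)
   else \max_(u in ~: K | (arm u == arm v) && ((u == v) || e v u)) A u.
have hiK v u : v \in K -> u \notin K -> arm u = home v -> e v u -> A u <= hi v.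
  move=> hv hu au hvu; rewrite /hi hv leq_max; apply/orP; right.
  by apply: (@leq_bigmax_cond _ _ A); rewrite inE hu au eqxx hvu.
have hiU v u : v \notin K -> u \notin K -> arm u = arm v -> (u == v) || e v u -> A u <= hi v.
  move=> hv hu au hvu; rewrite /hi (negPf hv).
  by apply: (@leq_bigmax_cond _ _ A); rewrite inE hu au eqxx hvu.
have core x u : x \in K -> u \notin K ->
    e x u = if home x == arm u then A u <= hi x else A u <= H x.
  move=> hx hu; case: (boolP (e x u)) => hxu; case: eqVneq => hxa.
  - by rewrite hiK.
  - rewrite AH leqNgt; apply/esym/negP => hl; case/eqP: hxa.
    by rewrite (homeP x u).
  - apply/esym/negbTE; rewrite -ltnNge /hi hx gtn_max ltnNge AH -ltnNge levelP //=.
    rewrite ltnNge; apply/negP => hle.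
    suff : \max_(u0 in ~: K | (arm u0 == home x) && e x u0) A u0 < A u by rewrite ltnNge hle.
    have A0 : 0 < A u by rewrite /A addnS.
    rewrite -(prednK A0) ltnS; apply/bigmax_leqP => v /and3P[hv /eqP av hxv].
    rewrite -ltnS prednK // ltnNge; apply: contra hxu; rewrite inE in hv.
    have auv : arm u = arm v by rewrite av.
    rewrite AF // => huv; have [_ m] := hF (arm v).
    apply: (m x u v) => //; try by rewrite !inE ?hu ?hv ?auv eqxx.
    + by apply: contraNneq hu => <-.
    + by rewrite !inE hx.
    + by move: huv; rewrite /f auv.
  - by apply/esym/negbTE; rewrite AH -ltnNge levelP.
apply: (@nat_polar K arm' lo hi).
- move=> v; rewrite /lo; case: ifPn => hv; first by rewrite /hi hv leq_maxl.
  by apply: hiU; rewrite ?eqxx.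
- move=> u v uv; rewrite /arm' /lo.
  case: (boolP (u \in K)) => hu; case: (boolP (v \in K)) => hv //=.
  + by rewrite if_same; apply: cl => //; apply/eqP.
  + by rewrite core.
  + by rewrite eS core // andbT eq_sym.
  have [auv|auv] := eqVneq (arm u) (arm v); last first.
    apply/negbTE; apply: contra auv => huv; apply/eqP; apply: s1.
    by rewrite /same_comp hu hv; apply: conn_edge; rewrite ?inE.
  apply/idP/andP => [huv|].
    by rewrite !hiU // ?huv ?orbT // eS huv orbT.
  wlog huv : u v hu hv uv auv / A u <= A v => [wl|[h1 h2]].
    have [hl|/ltnW hl] := leqP (A u) (A v); first exact: wl.
    by case=> h1 h2; rewrite eS; apply: wl => //; apply/eqP; rewrite eq_sym; apply/eqP.
  have [w] : exists w, [/\ w \notin K, arm w = arm u, (w == u) || e u w & A v <= A w].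
    move: h2; rewrite /hi (negPf hu).
    have [|w /and3P[hw /eqP aw huw] ->] := @eq_bigmax_cond _ [pred w | [&& w \in ~: K, arm w == arm u & (w == u) || e u w]] A.
      by apply/card_gt0P; exists u; rewrite !inE hu !eqxx.
    by move=> h2; exists w; rewrite inE in hw.
  case=> hw aw huw hvw; have [t m] := hF (arm u).
  have uS : u \in S (arm u) by rewrite !inE hu eqxx.
  have vS : v \in S (arm u) by rewrite !inE hv auv eqxx.
  have wS : w \in S (arm u) by rewrite !inE hw aw eqxx.
  have fuv : F (arm u) u <= F (arm u) v by move: huv; rewrite AF // /f -auv.
  have fvw : F (arm u) v <= F (arm u) w by move: hvw; rewrite AF ?aw // /f aw -auv.
  case/orP: huw => [/eqP wu|huw].
    apply: t => //; first exact/eqP.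
    by apply/eqP; rewrite eqn_leq fuv; rewrite wu in fvw.
  by apply: (m u v w) => //; apply/eqP.
by move=> v hv; rewrite /lo (negPf hv) /A addnS.
Qed.

End Bwd.

(** * Turing machines that sweep *)

Section Flow.
Variables (C Q : finType) (q0 : Q).

Fixpoint sweep (d : Q -> C -> Q * C) (q : Q) (s : seq C) : Q * seq C :=
  if s is c :: s' then
    let: (q1, c1) := d q c in let: (q2, s2) := sweep d q1 s' in (q2, c1 :: s2)
  else (q, [::]).

Lemma size_sweep d q s : size (sweep d q s).2 = size s.
Proof.
elim: s q => //= c s IH q; case: (d q c) => q1 c1.
by have := IH q1; case: (sweep d q1 s) => q2 s2 /= ->.
Qed.

(** A control graph in which every node is one left-to-right pass of a transducer; the final state
    of the pass selects the next node or the verdict. *)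
Record flow := Flow {
  fnode : finType;
  fentry : fnode;
  fact : fnode -> Q -> C -> Q * C;
  fnext : fnode -> Q -> fnode + bool }.

Definition flow_step (F : flow) (cf : (fnode F + bool) * seq C) : (fnode F + bool) * seq C :=
  if cf.1 is inl v then
    let: (q, s) := sweep (@fact F v) q0 cf.2 in (fnext v q, s)
  else cf.

Variables (F : flow) (ini : bool -> C).
Hypothesis ini_inj : injective ini.

(** On the left a pass in progress; on the right a rewind before the given node, or a verdict. *)
Definition fstate : finType := ((fnode F * Q) + (fnode F + bool))%type.

Definition fdelta (st : fstate) (x : option C) : fstate * option C * tm_dir :=
  match st, x with
  | inl (v, q), Some c => let: (q', c') := fact v q c in (inl (v, q'), Some c', TRight)
  | inl (v, q), None =>
      match fnext v q with
      | inr b => (inr (inr b), None, TStay)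
      | inl v' => (inr (inl v'), None, TLeft)
      end
  | inr (inl v), Some c => (inr (inl v), Some c, TLeft)
  | inr (inl v), None => (inl (v, q0), None, TRight)
  | inr (inr b), x => (inr (inr b), x, TStay)
  end.

Lemma fin_inj : injective (fun b => Some (ini b)).
Proof. by move=> a b [] /ini_inj. Qed.

Definition flow_tm : TM := @Build_TM fstate (option C) None (fun b => Some (ini b))
  fin_inj (fun b (h : Some (ini b) = None) => match h with end)
  (inl (fentry F, q0)) (inr (inr true)) (inr (inr false))
  (fun h => match h with end) fdelta.

Local Notation step := (@tm_step flow_tm).
Local Notation config := (tm_config flow_tm).

Definition blanks (s : seq (option C)) := all (pred1 None) s.

(* The head reads the first cell of [s], or the blank after [pre] when [s] is empty. *)
Definition at_cell (st : fstate) (pre s : seq C) (cf : config) :=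
  exists bl br h r, [/\ blanks bl, blanks br, h :: r = map Some s ++ br
    & cf = (st, map Some (rev pre) ++ bl, h, r)].

(** The head is on the cell just left of [s]. Here [pre] is listed backwards, starting with that
    cell. *)
Definition before_cell (st : fstate) (pre s : seq C) (cf : config) :=
  if pre is c :: pre' then at_cell st (rev pre') (c :: s) cf
  else exists bl br, [/\ blanks bl, blanks br & cf = (st, bl, None, map Some s ++ br)].

Definition move_left (st : fstate) l (rs : seq (option C)) : config :=
  if l is a :: l' then (st, l', a, rs) else (st, [::], None, rs).

Lemma move_leftP st pre s bl br : blanks bl -> blanks br ->
  before_cell st (rev pre) s (move_left st (map Some (rev pre) ++ bl) (map Some s ++ br)).
Proof.
case: (rev pre) => [|c pre'] hl hr /=.
  case: bl hl => [|[a|] bl] //= hl; first by exists [::], br.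
  by exists bl, br.
by exists bl, br, (Some c), (map Some s ++ br); split; rewrite // revK.
Qed.

Lemma sweep_right v q pre s cf : at_cell (inl (v, q)) pre s cf ->
  let: (q', s') := sweep (@fact F v) q s in
  at_cell (inl (v, q')) (pre ++ s') [::] (iter (size s) step cf).
Proof.
elim: s q pre cf => [|c s IH] q pre cf /=; first by rewrite cats0.
case=> bl [br [h [r [hl hr [-> ->] ->]]]].
rewrite -iterS iterSr.
case E: (fact v q c) => [q1 c1].
have : at_cell (inl (v, q1)) (rcons pre c1) s
   (step (inl (v, q), [seq Some i | i <- rev pre] ++ bl, Some c, [seq Some i | i <- s] ++ br)).
  rewrite /= E; case E2: (map Some s ++ br) => [|a r'].
    exists bl, [:: None], None, [::]; case: s {IH} E2 => // E2.
    by split=> //; rewrite rev_rcons.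
  by exists bl, br, a, r'; split; rewrite ?rev_rcons ?E2.
move/(IH q1); case: (sweep _ q1 s) => q2 s2; by rewrite cat_rcons.
Qed.

Lemma rewind v pre s cf : before_cell (inr (inl v)) (rev pre) s cf ->
  at_cell (inl (v, q0)) [::] (pre ++ s) (iter (size pre).+1 step cf).
Proof.
elim/last_ind: pre s cf => [|pre c IH] s cf /=.
  case=> bl [br [hl hr ->]] /=; case E: (map Some s ++ br) => [|a r].
    case: s E => //= _; exists (None :: bl), [:: None], None, [::]; split=> //.
  by exists (None :: bl), br, a, r; split.
rewrite rev_rcons /= => -[bl [br [h [r [hl hr [-> ->] ->]]]]].
rewrite size_rcons cat_rcons -iterS iterSr; apply: IH.
rewrite revK; exact: (@move_leftP (inr (inl v)) pre (c :: s) bl br).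
Qed.

(** The count is [size s] steps to the right, one turn at the blank, and [(size s).+1] steps for the
    way back. *)
Lemma flow_stepP v s cf : at_cell (inl (v, q0)) [::] s cf ->
  match flow_step (inl v, s) with
  | (inl v', s') => exists2 t, t = 2 * size s + 2 & at_cell (inl (v', q0)) [::] s' (iter t step cf)
  | (inr b, s') => exists2 t, t <= 2 * size s + 2 & (iter t step cf).1.1.1 = inr (inr b)
  end.
Proof.
move/sweep_right; rewrite /flow_step /=.
have := size_sweep (@fact F v) q0 s.
case E: (sweep _ q0 s) => [q s'] /= hsz [bl [br [h [r [hl hr hbr ecf]]]]].
have ebr : h = None by case: br hr hbr => // [[a|]] //= br _ [].
have hr' : blanks r by case: br hr hbr => //= a br /andP[_ hr] [_ ->].
case En: (fnext v q) => [v'|b].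
  exists (2 * size s + 2) => //.
  have -> : 2 * size s + 2 = (size s').+1 + 1 + size s.
    by rewrite hsz mul2n -addnn addn2 addn1 !addSn.
  rewrite !iterD ecf.
  rewrite -[s' in at_cell _ _ s' _]cats0.
  have := @rewind v' s' [::]; apply.
  have := @move_leftP (inr (inl v')) s' [::] bl (None :: r) hl hr'.
  by rewrite /= ebr En /=; case: (map Some _ ++ bl).
exists (size s).+1; first by rewrite mul2n -addnn addn2 ltnS -addSn leq_addl.
by rewrite iterS ecf /= ebr En.
Qed.

Lemma flow_tm_run t w b s : iter t (@flow_step F) (inl (fentry F), map ini w) = (inr b, s) ->
  exists2 u, u <= t * (2 * size w + 2) & cfg_state (tm_run flow_tm u w) = inr (inr b).
Proof.
have H v s0 cf : size s0 = size w -> at_cell (inl (v, q0)) [::] s0 cf ->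
    iter t (@flow_step F) (inl v, s0) = (inr b, s) ->
    exists2 u, u <= t * (2 * size w + 2) & cfg_state (iter u step cf) = inr (inr b).
  elim: t v s0 cf => [//|t IH] v s0 cf hs hc; rewrite iterSr.
  have := flow_stepP hc; have := size_sweep (@fact F v) q0 s0.
  rewrite {1 2 3}/flow_step /=; case: (sweep _ q0 s0) => q s1 /= h1.
  case: (fnext v q) => [v'|b'].
    case=> u -> hu ht; rewrite hs in hu h1.
    have [u' hu' hb] := IH v' s1 _ h1 hu ht.
    exists (u' + (2 * size w + 2)); first by rewrite mulSn addnC leq_add2l.
    by rewrite iterD.
  case=> u hu hb ht.
  have <- : b' = b.
    have stay m : iter m (@flow_step F) (inr b', s1) = (inr b', s1) by elim: m => //= m ->.
    by move: ht; rewrite stay => -[].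
  exists u; first by apply: leq_trans hu _; rewrite hs mulSn leq_addr.
  by move: hb; case: (iter u step cf) => [[[st l] h] r].
apply: H; first by rewrite size_map.
rewrite /tm_run; case: w => [|c w].
  by exists [::], [:: None], None, [::].
exists [::], [::], (Some (ini c)), (map Some (map ini w)); split=> //; first by rewrite cats0.
by rewrite -map_comp.
Qed.

End Flow.

Lemma tm_run_halted (M : TM) u t w : tm_halted (cfg_state (tm_run M u w)) -> u <= t ->
  tm_run M t w = tm_run M u w.
Proof.
move=> hs /subnK <-; rewrite /tm_run iterD; rewrite /tm_run in hs.
elim: (t - u) => // m IH; rewrite iterS IH.
by case: (iter u _ _) hs => [[[st l] h] r] /= ->.
Qed.

(** * Structured programs of sweeps *)

Section ArrayPrograms.
Variables (C Q : finType) (q0 : Q).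

Inductive aprog :=
  | ASweep (d : Q -> C -> Q * C)
  | AIf (d : Q -> C -> Q * C) (p : pred Q) (a b : aprog)
  | ASeq (a b : aprog)
  | AWhile (d : Q -> C -> Q * C) (p : pred Q) (a : aprog).

(** Time is counted in sweeps, those of the tests included. *)
Inductive aexec : aprog -> seq C -> nat -> seq C -> Prop :=
  | XSweep d s : aexec (ASweep d) s 1 (sweep d q0 s).2
  | XIf d (p : pred Q) a b s t s' :
      aexec (if p (sweep d q0 s).1 then a else b) (sweep d q0 s).2 t s' ->
      aexec (AIf d p a b) s t.+1 s'
  | XSeq a b s t s1 u s2 : aexec a s t s1 -> aexec b s1 u s2 -> aexec (ASeq a b) s (t + u) s2
  | XStop d (p : pred Q) a s : ~~ p (sweep d q0 s).1 -> aexec (AWhile d p a) s 1 (sweep d q0 s).2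
  | XLoop d (p : pred Q) a s t s1 u s2 : p (sweep d q0 s).1 -> aexec a (sweep d q0 s).2 t s1 ->
      aexec (AWhile d p a) s1 u s2 -> aexec (AWhile d p a) s (t + u).+1 s2.

(** One node per sweep; [None] is the test of a branch or loop. *)
Fixpoint anode (a : aprog) : finType :=
  match a with
  | ASweep _ => unit
  | AIf _ _ a b => option (anode a + anode b)
  | ASeq a b => (anode a + anode b)%type
  | AWhile _ _ a => option (anode a)
  end.

Fixpoint aentry (a : aprog) : anode a :=
  match a with
  | ASweep _ => tt
  | AIf _ _ _ _ => None
  | ASeq a b => inl (aentry a)
  | AWhile _ _ _ => None
  end.

Fixpoint aact (a : aprog) : anode a -> Q -> C -> Q * C :=
  match a with
  | ASweep d => fun _ => d
  | AIf d _ a b => fun v =>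
      match v with None => d | Some (inl v) => aact v | Some (inr v) => aact v end
  | ASeq a b => fun v => match v with inl v => aact v | inr v => aact v end
  | AWhile d _ a => fun v => if v is Some v then aact v else d
  end.

Fixpoint anext (a : aprog) : anode a -> Q -> option (anode a) :=
  match a return anode a -> Q -> option (anode a) with
  | ASweep _ => fun _ _ => None
  | AIf _ p a b => fun (v : option (anode a + anode b)) q =>
      match v with
      | None => Some (Some (if p q then inl (aentry a) else inr (aentry b)))
      | Some (inl v) => omap (fun v => Some (inl v)) (anext v q)
      | Some (inr v) => omap (fun v => Some (inr v)) (anext v q)
      end
  | ASeq a b => fun (v : anode a + anode b) q =>
      match v with
      | inl v => Some (if anext v q is Some v' then inl v' else inr (aentry b))
      | inr v => omap inr (anext v q)
      end
  | AWhile _ p a => fun (v : option (anode a)) q =>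
      match v with
      | None => if p q then Some (Some (aentry a)) else None
      | Some v => Some (anext v q)
      end
  end.

Inductive aruns (a : aprog) : anode a -> seq C -> nat -> seq C -> Prop :=
  | RExit v s : anext v (sweep (@aact a v) q0 s).1 = None ->
      aruns v s 1 (sweep (@aact a v) q0 s).2
  | RStep v s v' t s' : anext v (sweep (@aact a v) q0 s).1 = Some v' ->
      aruns v' (sweep (@aact a v) q0 s).2 t s' -> aruns v s t.+1 s'.

Lemma aexec_runs a s t s' : aexec a s t s' -> aruns (aentry a) s t s'.
Proof.
elim=> {a s t s'}.
- by move=> d s; exact: (@RExit (ASweep d) tt).
- move=> d p a b s t s' _.
  have la v s0 t0 s1 : @aruns a v s0 t0 s1 -> @aruns (AIf d p a b) (Some (inl v)) s0 t0 s1.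
    elim=> {v s0 t0 s1} [v s0 h|v s0 v' t0 s1 h _ IH].
      by apply: (@RExit (AIf d p a b) (Some (inl v))); rewrite /= h.
    by apply: (@RStep (AIf d p a b) (Some (inl v))) IH; rewrite /= h.
  have lb v s0 t0 s1 : @aruns b v s0 t0 s1 -> @aruns (AIf d p a b) (Some (inr v)) s0 t0 s1.
    elim=> {v s0 t0 s1} [v s0 h|v s0 v' t0 s1 h _ IH].
      by apply: (@RExit (AIf d p a b) (Some (inr v))); rewrite /= h.
    by apply: (@RStep (AIf d p a b) (Some (inr v))) IH; rewrite /= h.
  case: ifP => hp h; apply: (@RStep (AIf d p a b) None); rewrite /= ?hp //.
    exact: la.
  exact: lb.
- move=> a b s t s1 u s2 _ h1 _ h2 /=.
  have lb v s0 t0 s3 : @aruns b v s0 t0 s3 -> @aruns (ASeq a b) (inr v) s0 t0 s3.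
    elim=> {v s0 t0 s3} [v s0 h|v s0 v' t0 s3 h _ IH].
      by apply: (@RExit (ASeq a b) (inr v)); rewrite /= h.
    by apply: (@RStep (ASeq a b) (inr v)) IH; rewrite /= h.
  elim: h1 h2 => {s t s1} [v s h|v s v' t s1 h _ IH] h2.
    by rewrite add1n; apply: (@RStep (ASeq a b) (inl v)); [rewrite /= h|apply: lb].
  by rewrite addSn; apply: (@RStep (ASeq a b) (inl v)) (IH h2); rewrite /= h.
- by move=> d p a s hp; apply: (@RExit (AWhile d p a) None); rewrite /= (negPf hp).
- move=> d p a s t s1 u s2 hp _ h1 _ h2 /=.
  apply: (@RStep (AWhile d p a) None) => /=; first by rewrite hp.
  elim: h1 h2 => {hp t s1} [v s0 h|v s0 v' t s1 h _ IH] h2.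
    by rewrite add1n; apply: (@RStep (AWhile d p a) (Some v)) h2; rewrite /= h.
  by rewrite addSn; apply: (@RStep (AWhile d p a) (Some v)) (IH h2); rewrite /= h.
Qed.

Variables (fin : Q -> C -> Q * C) (acc : pred Q).

(** The extra node [None] is a last sweep that reads off the verdict. *)
Definition aflow (a : aprog) : flow C Q := @Flow C Q (option (anode a)) (Some (aentry a))
  (fun v => if v is Some v then aact v else fin)
  (fun v q => if v is Some v then inl (anext v q) else inr (acc q)).

Lemma aexec_flow a s t s' : aexec a s t s' ->
  exists s'', iter t.+1 (@flow_step _ _ q0 (aflow a)) (inl (fentry (aflow a)), s) =
    (inr (acc (sweep fin q0 s').1), s'').
Proof.
move/aexec_runs; rewrite [fentry _]/=; elim=> {s t s'} [v s h|v s v' t s' h _ [s'' IH]].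
  exists (sweep fin q0 (sweep (@aact a v) q0 s).2).2.
  rewrite /= /flow_step /=; move: h; case: (sweep (aact v) q0 s) => q s1 /= ->.
  by case: (sweep fin q0 s1).
exists s''; rewrite iterSr -IH; congr iter.
by rewrite /flow_step /=; move: h; case: (sweep (aact v) q0 s) => q s1 /= ->.
Qed.

End ArrayPrograms.

(** With a base of at least 2, constants and sums are absorbed by the exponent, so no coefficients
    have to be tracked. *)
Definition poly_bounded (f : nat -> nat) := exists k, forall m, f m <= m.+2 ^ k.

Lemma poly_const c : poly_bounded (fun=> c).
Proof.
exists c => m; case: c => // c; apply: leq_trans (ltnW (ltn_expl c.+1 (ltnSn 1))) _.
by rewrite leq_exp2r.
Qed.

Lemma poly_id : poly_bounded id.
Proof. by exists 1 => m; rewrite expn1 -addn2 leq_addr. Qed.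

Lemma poly_mul f g : poly_bounded f -> poly_bounded g -> poly_bounded (fun m => f m * g m).
Proof. by move=> [k hk] [l hl]; exists (k + l) => m; rewrite expnD leq_mul. Qed.

Lemma poly_add f g : poly_bounded f -> poly_bounded g -> poly_bounded (fun m => f m + g m).
Proof.
move=> [k hk] [l hl]; exists (k + l).+1 => m; rewrite expnS.
apply: leq_trans (_ : 2 * m.+2 ^ (k + l) <= _); last by rewrite leq_mul2r !ltnS leq0n orbT.
rewrite mul2n -addnn; apply: leq_add.
  by apply: leq_trans (hk m) _; rewrite leq_exp2l // leq_addr.
by apply: leq_trans (hl m) _; rewrite leq_exp2l // leq_addl.
Qed.

Lemma poly_le f g : (forall m, f m <= g m) -> poly_bounded g -> poly_bounded f.
Proof. by move=> h [k hk]; exists k => m; apply: leq_trans (h m) (hk m). Qed.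

Lemma poly_bound f : poly_bounded f -> exists k, forall m, f m <= k * m ^ k + k.
Proof.
move=> [k hk]; exists (3 ^ k + 2 ^ k + k) => m; apply: leq_trans (hk m) _.
case: m => [|m].
  by apply: leq_trans (leq_addl _ _); rewrite -addnA addnCA leq_addr.
apply: leq_trans (leq_addr _ _).
apply: leq_trans (_ : (3 * m.+1) ^ k <= _).
  case: k {hk} => // k; rewrite leq_exp2r // mulSn mul2n -addnn.
  by rewrite !(addSn, addnS) !ltnS leq_addr.
rewrite expnMn; apply: leq_mul; first by rewrite -addnA leq_addr.
by rewrite leq_pexp2l ?leq_addl.
Qed.

(** * Counter programs *)

Record store := Store { vr : nat -> nat; ar : nat -> nat -> bool }.

Definition upd A (f : nat -> A) x y := fun z => if z == x then y else f z.
Definition setv s x i := Store (upd (vr s) x i) (ar s).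

(* A variable holds a position [0 <= i <= m] of the array of length [m], with
   [m] meaning "off the array". *)
Inductive prim := PZero of nat | PInc of nat | POff of nat | PSet of nat & nat & bool.
Inductive test := TLt of nat & nat | TBit of nat & nat | TOn of nat.
Inductive cl :=
  | CSkip
  | CPrim of prim
  | CSeq of cl & cl
  | CIf of test & cl & cl
  | CFor of nat & cl.

Definition psem m (p : prim) s :=
  match p with
  | PZero x => setv s x 0
  | PInc x => setv s x (minn m (vr s x).+1)
  | POff x => setv s x m
  | PSet a x b => Store (vr s) (upd (ar s) a (upd (ar s a) (vr s x) b))
  end.

Definition tsem m (t : test) s :=
  match t with
  | TLt x y => vr s x < vr s y
  | TBit a x => (vr s x < m) && ar s a (vr s x)
  | TOn x => vr s x < m
  end.

Fixpoint csem m (c : cl) s :=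
  match c with
  | CSkip => s
  | CPrim p => psem m p s
  | CSeq c d => csem m d (csem m c s)
  | CIf t c d => if tsem m t s then csem m c s else csem m d s
  | CFor x c => iter m (fun s => psem m (PInc x) (csem m c s)) (setv s x 0)
  end.

Definition pmods p := match p with PZero x | PInc x | POff x => [:: x] | PSet _ _ _ => [::] end.
Fixpoint mods c :=
  match c with
  | CSkip => [::]
  | CPrim p => pmods p
  | CSeq c d | CIf _ c d => mods c ++ mods d
  | CFor x c => x :: mods c
  end.

Lemma csem_mods m c s x : x \notin mods c -> vr (csem m c s) x = vr s x.
Proof.
elim: c s => //= [p|c IHc d IHd|t c IHc d IHd|y c IH] s.
- by case: p => //= [y|y|y] ; rewrite inE /upd => /negPf->.
- by rewrite mem_cat negb_or => /andP[h1 h2]; rewrite IHd // IHc.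
- by rewrite mem_cat negb_or => /andP[h1 h2]; case: ifP => _; [apply: IHc|apply: IHd].
rewrite inE negb_or => /andP[/negPf xy h].
have -> : vr s x = vr (setv s y 0) x by rewrite /= /upd xy.
have H k s0 : vr (iter k (fun s => psem m (PInc y) (csem m c s)) s0) x = vr s0 x.
  by elim: k => //= k <-; rewrite /upd xy IH.
exact: H.
Qed.

Definition bounded m s := forall x, vr s x <= m.

Lemma bounded_psem m p s : bounded m s -> bounded m (psem m p s).
Proof.
by move=> h x; case: p => /= [y|y|y|a y b] //; rewrite /upd; case: ifP => // _; rewrite geq_minl.
Qed.

Lemma bounded_csem m c s : bounded m s -> bounded m (csem m c s).
Proof.
elim: c s => //= [p|c IHc d IHd|t c IHc d IHd|y c IH] s hb.
- exact: bounded_psem.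
- exact/IHd/IHc.
- by case: ifP => _; [apply: IHc|apply: IHd].
have : bounded m (setv s y 0) by exact: (bounded_psem (PZero y)).
move: (setv s y 0) => s0 h.
have H k : bounded m (iter k (fun s => psem m (PInc y) (csem m c s)) s0).
  by elim: k => //= k IHk; apply: (bounded_psem (PInc y)); apply: IH.
exact: H.
Qed.

(** * Compiling counter programs to sweeps *)

Section Compile.
Variables nv na : nat.

Definition pwf p :=
  match p with PZero x | PInc x | POff x => x < nv | PSet a x _ => (a < na) && (x < nv) end.
Definition twf t :=
  match t with TLt x y => (x < nv) && (y < nv) | TBit a x => (a < na) && (x < nv) | TOn x => x < nv end.
Fixpoint cwf c :=
  match c with
  | CSkip => true
  | CPrim p => pwf p
  | CSeq c d => cwf c && cwf d
  | CIf t c d => [&& twf t, cwf c & cwf d]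
  | CFor x c => [&& x < nv, cwf c & x \notin mods c]
  end.

Definition cell : finType := ({ffun 'I_nv -> bool} * {ffun 'I_na -> bool})%type.
Definition ctrl : finType := option bool.

Definition get k (f : {ffun 'I_k -> bool}) x := if insub x is Some v then f v else false.
Definition put k (f : {ffun 'I_k -> bool}) x b : {ffun 'I_k -> bool} :=
  [ffun v => if val v == x then b else f v].

(** A variable with value [m] leaves no mark anywhere. *)
Definition enc_cell s i : cell := ([ffun v : 'I_nv => vr s v == i], [ffun a : 'I_na => ar s a i]).
Lemma get_mark s i x : x < nv -> get (enc_cell s i).1 x = (vr s x == i).
Proof. by move=> h; rewrite /get insubT ffunE. Qed.

Lemma get_bit s i a : a < na -> get (enc_cell s i).2 a = ar s a i.
Proof. by move=> h; rewrite /get insubT ffunE. Qed.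

Definition enc m s : seq cell := [seq enc_cell s i | i <- iota 0 m].

(** For [PZero], the initial state [None] singles out the first cell. [PInc] carries the mark one
    cell on and loses it at the end, which is the saturation at [m]. *)
Definition ptrans p (q : ctrl) (c : cell) : ctrl * cell :=
  match p with
  | PZero x => (Some true, (put c.1 x (q == None), c.2))
  | PInc x => (if get c.1 x then Some true else None, (put c.1 x (q == Some true), c.2))
  | POff x => (q, (put c.1 x false, c.2))
  | PSet a x b => (q, (c.1, if get c.1 x then put c.2 a b else c.2))
  end.

(** In [TLt] the first mark met decides, and that of [y] is examined first, so equality fails. *)
Definition ttrans t (q : ctrl) (c : cell) : ctrl * cell :=
  (match t with
  | TLt x y => if q is None then
       if get c.1 y then Some false else if get c.1 x then Some true else None
     else q
  | TBit a x => if get c.1 x then Some (get c.2 a) else q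
  | TOn x => if get c.1 x then Some true else q
  end, c).
Definition taccept : pred ctrl := fun q => q == Some true.

Lemma sweep_iota (d : ctrl -> cell -> ctrl * cell) (st : nat -> ctrl) F G m :
  (forall i, i < m -> d (st i) (F i) = (st i.+1, G i)) ->
  sweep d (st 0) [seq F i | i <- iota 0 m] = (st m, [seq G i | i <- iota 0 m]).
Proof.
move=> h; have : forall k, k <= m -> sweep d (st (m - k)) [seq F i | i <- iota (m - k) k] =
    (st m, [seq G i | i <- iota (m - k) k]).
  elim=> [|k IH] hk; first by rewrite /= subn0.
  rewrite /= h; last by rewrite ltn_subrL /= (leq_trans _ hk).
  by rewrite -subSn // subSS IH // ltnW.
by move/(_ m (leqnn m)); rewrite subnn.
Qed.

(** The control state in which the sweep enters cell [i], in the closed form that [sweep_iota] asks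
    for; likewise [tstate]. *)
Definition pstate s p i : ctrl :=
  match p with
  | PZero _ => if i == 0 then None else Some true
  | PInc x => if (vr s x).+1 == i then Some true else None
  | _ => None
  end.

Definition tstate s t i : ctrl :=
  match t with
  | TLt x y => if minn (vr s x) (vr s y) < i then Some (vr s x < vr s y) else None
  | TBit a x => if vr s x < i then Some (ar s a (vr s x)) else None
  | TOn x => if vr s x < i then Some true else None
  end.

Lemma psweep m p s : pwf p -> bounded m s ->
  (sweep (ptrans p) None (enc m s)).2 = enc m (psem m p s).
Proof.
move=> wf hb; have -> : None = pstate s p 0 by case: p wf.
rewrite (@sweep_iota _ (pstate s p) _ (enc_cell (psem m p s))) // => i him.
rewrite [LHS]surjective_pairing; congr (_, _).
  by case: p wf => [x|x|x|a x b] //= wf; rewrite get_mark // eqSS.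
case: p wf => [x|x|x|a x b] /= wf; congr (_, _); apply/ffunP => v; rewrite !ffunE /= /upd.
- case: (val v == x) => //.
  by rewrite [0 == i]eq_sym; case: (i == 0).
- case: (val v == x) => //; rewrite /minn; case: (ltnP m) => h; last by case: ((vr s x).+1 == i).
  by rewrite (gtn_eqF him) (gtn_eqF (leq_trans him (ltnW h))).
- by case: (val v == x) => //; rewrite (gtn_eqF him).
case/andP: wf => ha hx; rewrite get_mark //.
case: (eqVneq (vr s x) i) => [<-|hi]; rewrite !ffunE /=; case: (eqVneq (nat_of_ord v) a) => [hv|_] //; by rewrite ?hv ?eqxx // eq_sym (negPf hi).
Qed.

Lemma tsweep m t s : twf t -> bounded m s ->
  sweep (ttrans t) None (enc m s) =
  ((sweep (ttrans t) None (enc m s)).1, enc m s) /\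
  taccept (sweep (ttrans t) None (enc m s)).1 = tsem m t s.
Proof.
move=> wf hb; have -> : None = tstate s t 0 by case: t wf => [x y|a x|x] /= _.
rewrite (@sweep_iota _ (tstate s t) _ (enc_cell s)) => [|i him].
  split=> //=; rewrite /taccept; case: t {wf} => [x y|a x|x] /=.
  - have hx := hb x; have hy := hb y; rewrite /minn; case: (ltnP (vr s x)) => h.
      by rewrite (leq_trans h hy).
    by case: ifP.
  - by case: ifP.
  - by case: ifP.
case: t wf => [x y|a x|x] /=; rewrite /ttrans.
- case/andP => hx hy; rewrite ?get_mark ?get_bit //; congr (_, _).
  rewrite ltnS [in RHS]leq_eqVlt; case: (ltnP _ i) => h; first by rewrite orbT.
  rewrite orbF; move: h; rewrite /minn; case: (ltnP (vr s x)) => hxy h.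
    rewrite (gtn_eqF (leq_ltn_trans h hxy)); by case: eqP.
  case: (eqVneq (vr s y) i) => [//|yi].
  case: eqP => // xi; case/eqP: yi; apply/eqP; rewrite eqn_leq h andbT.
  by rewrite -xi.
- case/andP => ha hx; rewrite ?get_mark ?get_bit //; congr (_, _).
  by rewrite ltnS [in RHS]leq_eqVlt; case: eqP => [->|_].
- move=> hx; rewrite ?get_mark ?get_bit //; congr (_, _).
  by rewrite ltnS [in RHS]leq_eqVlt; case: eqP.
Qed.

Fixpoint compile c : aprog cell ctrl :=
  match c with
  | CSkip => ASweep (fun q c => (q, c))
  | CPrim p => ASweep (ptrans p)
  | CSeq c d => ASeq (compile c) (compile d)
  | CIf t c d => AIf (ttrans t) taccept (compile c) (compile d)
  | CFor x c => ASeq (ASweep (ptrans (PZero x)))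
      (AWhile (ttrans (TOn x)) taccept (ASeq (compile c) (ASweep (ptrans (PInc x)))))
  end.

Fixpoint cost c m :=
  match c with
  | CSkip | CPrim _ => 1
  | CSeq c d => cost c m + cost d m
  | CIf _ c d => (cost c m + cost d m).+1
  | CFor x c => m * (cost c m).+2 + 2
  end.

Lemma cost_poly c : poly_bounded (cost c).
Proof.
elim: c => /= [|p|c IHc d IHd|t c IHc d IHd|x c IH]; try exact: poly_const.
- exact: poly_add.
- by apply: poly_le (poly_add (poly_add IHc IHd) (poly_const 1)) => m; rewrite addn1.
apply: poly_add (poly_const 2); apply: poly_mul poly_id _.
by apply: poly_le (poly_add IH (poly_const 2)) => m; rewrite addn2.
Qed.

Lemma compile_exec m c s : cwf c -> bounded m s ->
  exists2 t, t <= cost c m & aexec None (compile c) (enc m s) t (enc m (csem m c s)).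
Proof.
elim: c s => [|p|c IHc d IHd|t c IHc d IHd|x c IH] s /=.
- move=> _ _; exists 1 => //.
  have idE (q : ctrl) (l : seq cell) : sweep (fun q c => (q, c)) q l = (q, l).
    by elim: l q => //= a l IHl q; rewrite IHl.
  by have := XSweep None (fun (q : ctrl) (c : cell) => (q, c)) (enc m s); rewrite idE.
- by move=> wf hb; exists 1 => //; rewrite -psweep //; apply: XSweep.
- case/andP => wc wd hb; have [t1 h1 e1] := IHc s wc hb.
  have [t2 h2 e2] := IHd _ wd (bounded_csem c hb).
  by exists (t1 + t2); [apply: leq_add|apply: XSeq e1 e2].
- case/and3P => wt wc wd hb; have [hs ht] := tsweep wt hb.
  have X b t0 s' : aexec None (if tsem m t s then compile c else compile d) (enc m s) t0 s' ->
      t0 <= b -> exists2 t1, t1 <= b.+1 &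
      aexec None (AIf (ttrans t) taccept (compile c) (compile d)) (enc m s) t1 s'.
    by move=> h hb0; exists t0.+1 => //; apply: XIf; rewrite ht hs.
  case: ifP X => _ X.
    by have [t1 h1 e1] := IHc s wc hb; apply: X e1 (leq_trans h1 (leq_addr _ _)).
  by have [t1 h1 e1] := IHd s wd hb; apply: X e1 (leq_trans h1 (leq_addl _ _)).
case/and3P => wx wc xc hb.
pose body s := psem m (PInc x) (csem m c s).
have hb0 : bounded m (setv s x 0) by exact: (bounded_psem (PZero x)).
(* Induction on the distance [k] of the loop variable from the end of the array. *)
have L k s0 : bounded m s0 -> vr s0 x + k = m ->
    exists2 t, t <= k * (cost c m).+2 + 1 &
    aexec None (AWhile (ttrans (TOn x)) taccept (ASeq (compile c) (ASweep (ptrans (PInc x)))))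
      (enc m s0) t (enc m (iter k body s0)).
  elim: k s0 => [|k IHk] s0 hs0 hx.
    have [hs ht] := @tsweep m (TOn x) s0 wx hs0.
    exists 1 => //; rewrite [X in aexec _ _ _ _ X](_ : _ = (sweep (ttrans (TOn x)) None (enc m s0)).2); last by rewrite hs.
    by apply: XStop; rewrite ht /= -hx addn0 ltnn.
  have [hs ht] := @tsweep m (TOn x) s0 wx hs0.
  have [t1 h1 e1] := IH s0 wc hs0.
  have hs1 := bounded_csem c hs0.
  have [|| t2 h2 e2] := IHk (body s0); first exact: bounded_psem.
    rewrite /body /= /upd eqxx csem_mods // -hx.
    by rewrite (minn_idPr _) ?addSnnS // -addSnnS leq_addr.
  exists (t1 + 1 + t2).+1.
    by rewrite mulSn -[X in _ <= X]addnA [t1 + 1]addn1 -addSn; apply: leq_add.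
  rewrite iterSr; apply: XLoop e2; first by rewrite ht /= -hx addnS ltnS leq_addr.
  rewrite hs /=; apply: XSeq e1 _; rewrite -psweep //; exact: XSweep.
have [|t ht e] := L m (setv s x 0) hb0; first by rewrite /= /upd eqxx.
exists (1 + t); first by rewrite add1n addn2 ltnS -addn1.
apply: XSeq e.
have -> : enc m (setv s x 0) = (sweep (ptrans (PZero x)) None (enc m s)).2 by rewrite psweep.
exact: XSweep.
Qed.

End Compile.

(** All variables start off the array, so the input tape carries no marks. *)
Definition cl_start (w : seq bool) : store :=
  Store (fun=> size w) (fun a i => (a == 0) && nth false w i).

(** The time bound in [decides_in_poly_time] is written with [Nat.pow]. *)
Lemma powE a k : PeanoNat.Nat.pow a k = a ^ k.
Proof. by elim: k => //= k ->; rewrite expnS. Qed.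

Section Decide.
Variables nv na acc : nat.
Hypothesis na0 : 0 < na.
Hypothesis accna : acc < na.

Definition cell_init (b : bool) : cell nv na := ([ffun=> false], [ffun a => (val a == 0) && b]).

Lemma cell_init_inj : injective cell_init.
Proof. by move=> a b [] /ffunP/(_ (Ordinal na0)); rewrite !ffunE. Qed.

(** Only the first cell counts. On the empty tape the state stays [None], which the test
    [q != Some false] accepts: the empty word encodes the graph without vertices. *)
Definition read_out (q : ctrl) (c : cell nv na) : ctrl * cell nv na :=
  (if q is None then Some (get c.2 acc) else q, c).

Lemma enc_start w : enc nv na (size w) (cl_start w) = map cell_init w.
Proof.
apply: (@eq_from_nth _ (cell_init false)); first by rewrite !size_map size_iota.
move=> i; rewrite size_map size_iota => hi; rewrite (nth_map 0) ?size_iota //.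
rewrite (nth_map false) // nth_iota // add0n; congr (_, _); apply/ffunP => v; rewrite !ffunE //=.
by rewrite (gtn_eqF hi).
Qed.

Lemma cl_decides c : cwf nv na c -> exists M : TM, forall L : seq bool -> Prop,
  (forall w, L w <-> w = [::] \/ ar (csem (size w) c (cl_start w)) acc 0) ->
  decides_in_poly_time M L.
Proof.
move=> wf; pose F := aflow read_out (fun q => q != Some false) (compile nv na c).
exists (flow_tm (None : ctrl) F cell_init_inj) => L HL.
have [|k hk] := @poly_bound (fun m => (cost c m).+1 * (2 * m + 2)).
  apply: poly_mul; first by apply: poly_le (poly_add (cost_poly c) (poly_const 1)) => m; rewrite addn1.
  by apply: poly_add (poly_const 2); apply: poly_mul (poly_const 2) poly_id.
exists k => w; rewrite powE => q.
have hb : bounded (size w) (cl_start w) by move=> x.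
have [t ht /(aexec_flow read_out (fun q => q != Some false))[s'']] := compile_exec wf hb.
rewrite enc_start => /(flow_tm_run (F := F) cell_init_inj)[u hu hst].
set b := (_ != _) in hst.
have qE : tm_run (flow_tm (None : ctrl) F cell_init_inj) (k * size w ^ k + k) w =
          tm_run (flow_tm (None : ctrl) F cell_init_inj) u w.
  apply: tm_run_halted.
    by rewrite hst /tm_halted; case: (b); rewrite eqxx ?orbT.
  apply: leq_trans hu _; apply: leq_trans (hk _); by rewrite leq_mul2r ltnS ht orbT.
have {qE} -> : q = inr (inr b) := etrans (congr1 (@cfg_state _) qE) hst.
clear q; split; first by rewrite /tm_halted; case: (b); rewrite eqxx ?orbT.
have -> : (inr (inr b) = inr (inr true) :> fstate F) <-> b by split=> [[]|->].
rewrite HL {hst hk hu}/b; case: w {hb ht} => [|x w]; first by split=> //; left.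
rewrite /enc /= get_bit //=; set r := ar _ _ _.
have S l : (sweep read_out (Some r) l).1 = Some r.
  by elim: l => //= y l; case: (sweep _ _ l).
case E: (sweep _ _ _) (S [seq enc_cell nv na (csem (size w).+1 c (cl_start (x :: w))) i | i <- iota 1 (size w)]) => [q s].
move=> /= -> {E S}.
by case: r; split=> //; [right|case].
Qed.

End Decide.

(** * Relational programs *)

Inductive form :=
  | FConst of bool
  | FRel of nat & nat & nat
  | FEq of nat & nat
  | FBin of (bool -> bool -> bool) & form & form
  | FEx of form.

Inductive fl :=
  | FSkip
  | FDef of nat & form
  | FSeq of fl & fl
  | FIf of form & fl & fl
  | FFor of fl.

Section Semantics.
Variable n : nat.
Implicit Types (R : nat -> rel 'I_n) (env : nat -> 'I_n).

(* Variables are de Bruijn levels: a binder at level [l] binds the variable [l]. *)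
Fixpoint feval R l env f : bool :=
  match f with
  | FConst b => b
  | FRel r x y => R r (env x) (env y)
  | FEq x y => env x == env y
  | FBin g f1 f2 => g (feval R l env f1) (feval R l env f2)
  | FEx f => [exists i, feval R l.+1 (upd env l i) f]
  end.

Fixpoint flsem l env c R : nat -> rel 'I_n :=
  match c with
  | FSkip => R
  | FDef r f => upd R r (fun i j => feval R l.+2 (upd (upd env l i) l.+1 j) f)
  | FSeq c d => flsem l env d (flsem l env c R)
  | FIf f c d => if feval R l env f then flsem l env c R else flsem l env d R
  | FFor c => foldl (fun R i => flsem l.+1 (upd env l i) c R) R (enum 'I_n)
  end.
End Semantics.

Fixpoint fscoped l f :=
  match f with
  | FConst _ => true
  | FRel _ x y | FEq x y => (x < l) && (y < l)
  | FBin _ f g => fscoped l f && fscoped l g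
  | FEx f => fscoped l.+1 f
  end.
Fixpoint frels f :=
  match f with
  | FRel r _ _ => [:: r]
  | FConst _ | FEq _ _ => [::]
  | FBin _ f g => frels f ++ frels g
  | FEx f => frels f
  end.
(** A relation may not occur in its own definition, because its array is overwritten cell by cell
    while the formula is being evaluated. *)
Fixpoint flscoped l c :=
  match c with
  | FSkip => true
  | FDef r f => fscoped l.+2 f && (r \notin frels f)
  | FSeq c d => flscoped l c && flscoped l d
  | FIf f c d => [&& fscoped l f, flscoped l c & flscoped l d]
  | FFor c => flscoped l.+1 c
  end.

(** [vN] holds the number of vertices, [vz] a computed array position, [vi] and [vj] count for it,
    and [vK] guesses the number of vertices minus one. Odd numbers from 5 on are formula variables,
    even ones from 6 on truth flags. *)
Local Notation vN := 0.
Local Notation vz := 1.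
Local Notation vi := 2.
Local Notation vj := 3.
Local Notation vK := 4.
Definition lvar v := 5 + v.*2.
Definition flag d := 6 + d.*2.

Lemma csem_seq m c d s : csem m (CSeq c d) s = csem m d (csem m c s). Proof. by []. Qed.
Lemma csem_if m t c d s :
  csem m (CIf t c d) s = if tsem m t s then csem m c s else csem m d s.
Proof. by []. Qed.

Definition when t c := CIf t c CSkip.
(** The row-major position [x * n + y] of a pair, obtained by counting up. *)
Definition zof x y :=
  CSeq (CPrim (PZero vz))
 (CSeq (CFor vi (when (TLt vi x) (CFor vj (when (TLt vj vN) (CPrim (PInc vz))))))
       (CFor vj (when (TLt vj y) (CPrim (PInc vz))))).
(** Truth is being on the array, which [TOn] can test. *)
Definition setb d (b : bool) := CPrim (if b then PZero (flag d) else POff (flag d)).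

Arguments setb : simpl never.

Fixpoint fcomp f l d :=
  match f with
  | FConst b => setb d b
  | FRel r x y => CSeq (zof (lvar x) (lvar y)) (CIf (TBit r vz) (setb d true) (setb d false))
  | FEq x y => CIf (TLt (lvar x) (lvar y)) (setb d false)
                 (CIf (TLt (lvar y) (lvar x)) (setb d false) (setb d true))
  | FBin g f1 f2 => CSeq (fcomp f1 l d) (CSeq (fcomp f2 l d.+1)
      (CIf (TOn (flag d))
         (CIf (TOn (flag d.+1)) (setb d (g true true)) (setb d (g true false)))
         (CIf (TOn (flag d.+1)) (setb d (g false true)) (setb d (g false false)))))
  | FEx f => CSeq (setb d false) (CFor (lvar l) (when (TLt (lvar l) vN)
      (CSeq (fcomp f l.+1 d.+1) (when (TOn (flag d.+1)) (setb d true)))))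
  end.

(** [CFor] runs through all [n ^ 2] positions; the guard confines the body to the first [n], the
    vertices. *)
Definition loop l c := CFor (lvar l) (when (TLt (lvar l) vN) c).

Fixpoint flcomp c l :=
  match c with
  | FSkip => CSkip
  | FDef r f => loop l (loop l.+1 (CSeq (fcomp f l.+2 0) (CSeq (zof (lvar l) (lvar l.+1))
       (CIf (TOn (flag 0)) (CPrim (PSet r vz true)) (CPrim (PSet r vz false))))))
  | FSeq c d => CSeq (flcomp c l) (flcomp d l)
  | FIf f c d => CSeq (fcomp f l 0) (CIf (TOn (flag 0)) (flcomp c l) (flcomp d l))
  | FFor c => loop l (flcomp c l.+1)
  end.

Fixpoint writes c :=
  match c with
  | CPrim p => if p is PSet a _ _ then [:: a] else [::]
  | CSkip => [::]
  | CSeq c d | CIf _ c d => writes c ++ writes d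
  | CFor _ c => writes c
  end.

Lemma csem_writes m c s a : a \notin writes c -> ar (csem m c s) a = ar s a.
Proof.
elim: c s => //= [p|c IHc d IHd|t c IHc d IHd|y c IH] s.
- by case: p => //= b x v; rewrite inE /upd => /negPf->.
- by rewrite mem_cat negb_or => /andP[h1 h2]; rewrite IHd // IHc.
- by rewrite mem_cat negb_or => /andP[h1 h2]; case: ifP => _; [apply: IHc|apply: IHd].
move=> h; have H k s0 : ar (iter k (fun s => psem m (PInc y) (csem m c s)) s0) a = ar s0 a.
  by elim: k => //= k <-; rewrite IH.
exact: H.
Qed.

(* The variables that code compiled at levels [l] and [d] may change. *)
Definition scratch l d x :=
  [|| x \in [:: vz; vi; vj], odd x && (lvar l <= x) | ~~ odd x && (flag d <= x)].

Lemma V_inj v w : lvar v = lvar w -> v = w.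
Proof. by move/addnI/double_inj. Qed.
Lemma odd_V v : odd (lvar v). Proof. by rewrite /lvar oddD odd_double. Qed.
Lemma odd_B v : odd (flag v) = false. Proof. by rewrite /flag oddD odd_double. Qed.
Lemma leq_V v w : (lvar v <= lvar w) = (v <= w). Proof. by rewrite leq_add2l leq_double. Qed.
Lemma leq_B v w : (flag v <= flag w) = (v <= w). Proof. by rewrite leq_add2l leq_double. Qed.

Lemma scratchW l d l' d' x : l <= l' -> d <= d' -> scratch l' d' x -> scratch l d x.
Proof.
move=> hl hd /or3P[h|/andP[h1 h2]|/andP[h1 h2]]; apply/or3P; first by apply: Or31.
  by apply: Or32; rewrite h1 (leq_trans _ h2) // leq_V.
by apply: Or33; rewrite h1 (leq_trans _ h2) // leq_B.
Qed.

Lemma scratch_V l d v : scratch l d (lvar v) = (l <= v).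
Proof. by rewrite /scratch odd_V leq_V !inE /lvar /= orbF. Qed.
Lemma scratch_B l d v : scratch l d (flag v) = (d <= v).
Proof. by rewrite /scratch odd_B leq_B !inE /flag /=. Qed.

Lemma mods_fcomp f l d : all (scratch l d) (mods (fcomp f l d)).
Proof.
have pE b x : pmods (if b then PZero x else POff x) = [:: x] by case: b.
elim: f l d => [b|r x y|x y|g f1 IH1 f2 IH2|f IH] l d /=; rewrite ?pE.
- by rewrite /= !scratch_B leqnn.
- by rewrite !scratch_B leqnn.
- by rewrite !scratch_B leqnn.
- rewrite !all_cat IH1 /= !scratch_B leqnn !andbT.
  by apply: sub_all (IH2 l d.+1) => x; apply: scratchW.
rewrite scratch_B leqnn scratch_V leqnn /= !all_cat /= scratch_B leqnn /= !andbT.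
by apply: sub_all (IH l.+1 d.+1) => x; apply: scratchW.
Qed.

Lemma mods_flcomp c l : all (scratch l 0) (mods (flcomp c l)).
Proof.
elim: c l => //= [r f|c IHc d IHd|f c IHc d IHd|c IH] l.
- rewrite !scratch_V leqnn leqnSn !all_cat /= !andbT.
  by apply: sub_all (mods_fcomp f l.+2 0) => x; apply: scratchW => //; do 2 apply: ltnW.
- by rewrite all_cat IHc IHd.
- by rewrite !all_cat IHc IHd mods_fcomp.
rewrite scratch_V leqnn all_cat /= andbT.
by apply: sub_all (IH l.+1) => x; apply: scratchW.
Qed.

Lemma writes_fcomp f l d : writes (fcomp f l d) = [::].
Proof.
pose pw p := if p is PSet a _ _ then [:: a] else [::].
have pE b x : pw (if b then PZero x else POff x) = [::] by case: b.
by elim: f l d => [b|r x y|x y|g f1 IH1 f2 IH2|f IH] l d; rewrite /= -?/(pw _) ?IH1 ?IH2 ?IH ?pE.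
Qed.

(** * Correctness of compiled relational programs *)

Section Run.
Variables n m : nat.

Lemma cfor_ind x c s (Inv : nat -> store -> Prop) : x \notin mods c ->
  Inv 0 (setv s x 0) ->
  (forall k s, k < m -> vr s x = k -> Inv k s -> Inv k.+1 (setv (csem m c s) x k.+1)) ->
  Inv m (csem m (CFor x c) s).
Proof.
move=> hx h0 hS /=.
have H k : k <= m -> Inv k (iter k (fun s => psem m (PInc x) (csem m c s)) (setv s x 0)) /\
    vr (iter k (fun s => psem m (PInc x) (csem m c s)) (setv s x 0)) x = k.
  elim: k => [|k IH] hk; first by rewrite /= /upd eqxx.
  have [h1 h2] := IH (ltnW hk); rewrite iterS; move: (iter k _ _) h1 h2 => s1 h1 h2.
  have e : minn m (vr (csem m c s1) x).+1 = k.+1 by rewrite csem_mods // h2; apply/minn_idPr.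
  split; last by rewrite /= /upd eqxx e.
  by rewrite /psem e; apply: hS.
by have [] := H m (leqnn m).
Qed.

Lemma minn_sat x : minn m (minn m x).+1 = minn m x.+1.
Proof.
case: (leqP m x) => // h.
by rewrite (minn_idPl (leqnSn m)) (minn_idPl (leqW h)).
Qed.

Lemma csem_setb d b s : vr (csem m (setb d b) s) (flag d) = if b then 0 else m.
Proof. by rewrite /setb; case: b; rewrite /= /upd eqxx. Qed.

Lemma frame l d c s x : all (scratch l d) (mods c) -> ~~ scratch l d x ->
  vr (csem m c s) x = vr s x.
Proof. by move=> /allP h hx; apply: csem_mods; apply: contra hx; apply: h. Qed.

Lemma count_loop z x y s : x \notin [:: z; y] -> y != z -> vr s z <= m -> vr s y <= m ->
  vr (csem m (CFor x (when (TLt x y) (CPrim (PInc z)))) s) z = minn m (vr s z + vr s y).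
Proof.
rewrite !inE negb_or => /andP[xz xy] yz hz hy.
have : let s' := csem m (CFor x (when (TLt x y) (CPrim (PInc z)))) s in
  vr s' y = vr s y /\ vr s' z = minn m (vr s z + minn m (vr s y)).
  apply: (cfor_ind (Inv := fun k s' => vr s' y = vr s y /\ vr s' z = minn m (vr s z + minn k (vr s y)))).
  - by rewrite /= inE.
  - rewrite /= /upd eq_sym (negPf xy) eq_sym (negPf xz) min0n addn0; split=> //.
    by rewrite (minn_idPr hz).
  move=> k s' km hk [h1 h2] /=.
  rewrite hk h1; case: ltnP => hky /=; rewrite /upd /= ![_ == x]eq_sym (negPf xy) (negPf xz) ?eqxx.
    rewrite (negPf yz) h1 h2; split=> //.
    by rewrite (minn_idPl (ltnW hky)) (minn_idPl hky) addnS minn_sat.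
  by rewrite h1 h2 (minn_idPr hky) (minn_idPr (leqW hky)).
by case=> _ ->; rewrite (minn_idPr hy).
Qed.

Lemma minn_addl a b : minn m (minn m a + b) = minn m (a + b).
Proof.
case: (leqP m a) => // h.
by rewrite !(minn_idPl _) // ?leq_addr // (leq_trans h) // leq_addr.
Qed.

Lemma zof_spec x y s : bounded m s -> x \notin [:: vz; vi; vj] -> y \notin [:: vz; vi; vj] ->
  vr (csem m (zof x y) s) vz = minn m (vr s x * vr s vN + vr s y).
Proof.
move=> hb hx hy; set T := [:: vz; vi; vj] in hx hy *.
have nT v w : v \notin T -> w \in T -> (v == w) = false by move=> h1 h2; apply: contraNF h1 => /eqP->.
pose Inv k s' := [/\ bounded m s', forall v, v \notin T -> vr s' v = vr s v
   & vr s' vz = minn m (minn k (vr s x) * vr s vN)].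
have : Inv m (csem m (CFor vi (when (TLt vi x) (CFor vj (when (TLt vj vN) (CPrim (PInc vz)))))) (setv s vz 0)).
  apply: cfor_ind => //.
    split=> [v|v hv|].
    - by rewrite /= /upd; do ?case: ifP.
    - by rewrite /= /upd !nT.
    - by rewrite /= /upd /= min0n minn0.
  move=> k s' km hk [h1 h2 h3].
  have st c : all (mem T) (mods c) -> forall v, v \notin T -> vr (setv (csem m c s') vi k.+1) v = vr s v.
    move=> /allP hc v hv; rewrite /= /upd nT // csem_mods ?h2 //.
    by apply: contra hv; apply: hc.
  have bd c : bounded m (setv (csem m c s') vi k.+1).
    by move=> v; rewrite /= /upd; case: ifP => // _; apply: bounded_csem.
  split; [exact: bd|exact: st|].
  rewrite [vr (setv _ _ _) vz]/= /upd /=; rewrite hk h2 //; case: ltnP => hkx.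
    rewrite count_loop // h3 (minn_idPl (ltnW hkx)) (minn_idPl hkx) h2 // minn_addl.
    by rewrite mulSn addnC.
  by rewrite /= h3 (minn_idPr hkx) (minn_idPr (leqW hkx)).
rewrite /zof !csem_seq [csem m (CPrim (PZero vz)) s]/=.
move: (csem m (CFor vi _) _) => s1 [h1 h2 h3].
have yz : y != vz by rewrite nT.
have jy : vj \notin [:: vz; y] by rewrite !inE negb_or /= eq_sym nT.
rewrite (count_loop jy yz (h1 _) (h1 _)) h3 (h2 y hy) (minn_idPr (hb x)).
by rewrite minn_addl.
Qed.

Hypothesis n0 : 0 < n.
Hypothesis hm : m = n * n.
Implicit Types (R : nat -> rel 'I_n) (env : nat -> 'I_n).

Let nm : n <= m. Proof. by rewrite hm leq_pmulr. Qed.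
Let m0 : 0 < m. Proof. exact: leq_trans nm. Qed.

Lemma flagE (b : bool) : ((if b then 0 else m) < m) = b.
Proof. by case: b; rewrite ?ltnn. Qed.

Lemma cell_lt (i j : 'I_n) : i * n + j < m.
Proof.
rewrite hm; apply: leq_trans (_ : i * n + n <= _); first by rewrite ltn_add2l.
by rewrite addnC -mulSn leq_mul2r ltn_ord orbT.
Qed.

Lemma cell_inj (i j i' j' : 'I_n) : (i * n + j == i' * n + j') = (i == i') && (j == j').
Proof.
apply/eqP/andP => [h|[/eqP-> /eqP->] //].
have hi := congr1 (divn^~ n) h; have hj := congr1 (modn^~ n) h.
rewrite /= !divnMDl // !divn_small // !addn0 in hi; rewrite /= !modnMDl !modn_small // in hj.
by split; apply/eqP/val_inj.
Qed.

Definition rep l env R s := [/\ bounded m s, vr s vN = n,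
  forall v, v < l -> vr s (lvar v) = env v
  & forall r (i j : 'I_n), ar s r (i * n + j) = R r i j].

Lemma rep_frame l d c env R s : all (scratch l d) (mods c) -> writes c = [::] ->
  rep l env R s -> rep l env R (csem m c s).
Proof.
move=> hc hw [h1 h2 h3 h4]; split.
- exact: bounded_csem.
- by rewrite (frame _ hc).
- by move=> v hv; rewrite (frame _ hc) ?h3 // scratch_V -ltnNge.
- by move=> r i j; rewrite csem_writes ?hw.
Qed.

Lemma rep_setv l env R s k : k <= m -> rep l env R s -> rep l env R (setv s (lvar l) k).
Proof.
move=> hk [h1 h2 h3 h4]; split=> // v; rewrite /= /upd; first by case: (v == _).
by move=> hv; case: eqP => [/V_inj h|_]; [rewrite h ltnn in hv|apply: h3].
Qed.

Lemma rep_bind l env R s (i : 'I_n) : vr s (lvar l) = i -> rep l env R s ->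
  rep l.+1 (upd env l i) R s.
Proof.
move=> hi [h1 h2 h3 h4]; split=> // v; rewrite ltnS leq_eqVlt /upd.
by case: eqP => [->|_] //= hv; apply: h3.
Qed.

Lemma rep_unbind l env R s i : rep l.+1 (upd env l i) R s -> rep l env R s.
Proof.
move=> [h1 h2 h3 h4]; split=> // v hv; rewrite h3 ?ltnS 1?ltnW // /upd.
by rewrite (ltn_eqF hv).
Qed.

Lemma V_notin v : lvar v \notin [:: vz; vi; vj]. Proof. by rewrite !inE. Qed.

Lemma loop_ind l c s (Inv : nat -> store -> Prop) : lvar l \notin mods c -> vr s vN = n ->
  vN \notin mods c ->
  Inv 0 (setv s (lvar l) 0) ->
  (forall (i : 'I_n) s, vr s (lvar l) = i -> Inv i s -> Inv i.+1 (setv (csem m c s) (lvar l) i.+1)) ->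
  (forall k s, n <= k -> k < m -> Inv k s -> Inv k.+1 (setv s (lvar l) k.+1)) ->
  Inv m (csem m (loop l c) s).
Proof.
move=> hl hN hNc h0 hS hW.
suff [] : Inv m (csem m (loop l c) s) /\ vr (csem m (loop l c) s) vN = n by [].
apply: (cfor_ind (Inv := fun k s => Inv k s /\ vr s vN = n)); rewrite /= ?cats0 //.
move=> k s1 km hk [h1 h2] /=.
have h2' c' : vN \notin mods c' -> upd (vr (csem m c' s1)) (lvar l) k.+1 vN = n.
  by move=> hc; rewrite /upd /= csem_mods.
rewrite hk h2; case: ltnP => hkn.
  by split; [apply: (hS (Ordinal hkn))|apply: h2'].
by split; [apply: hW|apply: (h2' CSkip)].
Qed.

Lemma fcomp_spec f l d env R s : fscoped l f -> rep l env R s ->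
  (vr (csem m (fcomp f l d) s) (flag d) < m) = feval R l env f.
Proof.
elim: f l d env s => [b|r x y|x y|g f1 IH1 f2 IH2|f IH] l d env s.
- by move=> _ _; rewrite [fcomp _ _ _]/= csem_setb flagE.
- case/andP => hx hy [h1 h2 h3 h4]; rewrite [fcomp _ _ _]/= csem_seq csem_if.
  set s1 := csem m (zof _ _) s.
  have hz : vr s1 vz = env x * n + env y.
    by rewrite zof_spec ?V_notin // h2 !h3 //; apply/minn_idPr/ltnW/cell_lt.
  rewrite [feval _ _ _ _]/= /tsem hz cell_lt csem_writes // h4.
  by case: (R r _ _); rewrite csem_setb ?m0 ?ltnn.
- case/andP => hx hy [h1 h2 h3 h4].
  rewrite [fcomp _ _ _]/= !csem_if /tsem !h3 // [feval _ _ _ _]/= -val_eqE [val]/=.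
  by case: (ltngtP (env x : nat) (env y)) => _; rewrite csem_setb ?m0 ?ltnn.
- case/andP => w1 w2 hr; rewrite [fcomp _ _ _]/= !csem_seq.
  set s1 := csem m (fcomp f1 l d) s; set s2 := csem m (fcomp f2 l d.+1) s1.
  have hr1 : rep l env R s1 by apply: rep_frame (mods_fcomp _ _ _) (writes_fcomp _ _ _) hr.
  have e1 := IH1 l d env s w1 hr; have e2 := IH2 l d.+1 env s1 w2 hr1.
  have e3 : vr s2 (flag d) = vr s1 (flag d).
    by rewrite (frame _ (mods_fcomp _ _ _)) // scratch_B ltnn.
  rewrite !csem_if /tsem e3 e1 e2 [feval _ _ _ (FBin _ _ _)]/=.
  by case: (feval R l env f1); case: (feval R l env f2); rewrite csem_setb flagE.
move=> w hr; rewrite [fcomp _ _ _]/= csem_seq -/(loop _ _).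
set s0 := csem m (setb d false) s; set body := CSeq _ _.
pose Inv k s' := rep l env R s' /\
  (vr s' (flag d) < m) = [exists i : 'I_n, (i < k) && feval R l.+1 (upd env l i) f].
have dl v w0 : (flag v == lvar w0) = false by apply/eqP => h; move: (odd_B v); rewrite h odd_V.
have bmods : all (scratch l.+1 d) (mods body).
  rewrite /body /= !all_cat /= scratch_B leqnn /= andbT.
  by apply: sub_all (mods_fcomp f l.+1 d.+1) => x; apply: scratchW.
have bwrites : writes body = [::] by rewrite /body /= writes_fcomp.
have : Inv m (csem m (loop l body) s0).
  have hr0 : rep l env R s0 by apply: (@rep_frame l d) hr => //=; rewrite scratch_B leqnn.
  apply: loop_ind; first by apply: contraL bmods => h; apply/allPn; exists (lvar l); rewrite // scratch_V ltnn.
  - by case: hr0.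
  - by apply: contraL bmods => h; apply/allPn; exists vN.
  - split; first exact: rep_setv.
    rewrite /= /upd dl /= /upd eqxx ltnn; apply/esym/negbTE/existsP; by case.
  - move=> i s1 hi [r1 e1].
    have r1' := rep_bind hi r1.
    split; first by apply: rep_setv; [exact: leq_trans (ltn_ord i) nm|apply: rep_unbind (rep_frame bmods bwrites r1')].
    have -> s2 : vr (setv s2 (lvar l) i.+1) (flag d) = vr s2 (flag d) by rewrite /= /upd dl.
    rewrite /body csem_seq csem_if.
    set s2 := csem m (fcomp f l.+1 d.+1) s1.
    have e2 := IH l.+1 d.+1 _ s1 w r1'.
    have e3 : vr s2 (flag d) = vr s1 (flag d).
      by rewrite (frame _ (mods_fcomp _ _ _)) // scratch_B ltnn.
    rewrite /tsem e2.
    have -> : [exists i0 : 'I_n, (i0 < i.+1) && feval R l.+1 (upd env l i0) f] =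
        feval R l.+1 (upd env l i) f || (vr s1 (flag d) < m).
      rewrite e1; apply/existsP/orP => [[i0 /andP[]]|].
        rewrite ltnS leq_eqVlt => /orP[/eqP/val_inj->|h1 h2]; [by left|right].
        by apply/existsP; exists i0; rewrite h1.
      case=> [h|/existsP[i0 /andP[h1 h2]]]; first by exists i; rewrite ltnSn.
      by exists i0; rewrite h2 ltnS ltnW.
    by case: (feval R l.+1 (upd env l i) f); [rewrite csem_setb m0|rewrite -e3].
  - move=> k s1 hk km [r1 e1]; split; first exact: rep_setv.
    rewrite /= /upd dl e1; apply: eq_existsb => i.
    by rewrite !(leq_trans (ltn_ord i)) // leqW.
case=> _ ->; apply: eq_existsb => i; by rewrite (leq_trans (ltn_ord i) nm).
Qed.

Lemma feval_ext R R' l env f : (forall r, r \in frels f -> R r =2 R' r) ->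
  feval R l env f = feval R' l env f.
Proof.
elim: f l env => //= [r x y|g f1 IH1 f2 IH2|f IH] l env h.
- by apply: h; rewrite inE.
- by rewrite IH1 ?IH2 // => r hr; apply: h; rewrite mem_cat hr ?orbT.
- by apply: eq_existsb => i; apply: IH.
Qed.

Lemma rep_eq l env R R' s : (forall r i j, R r i j = R' r i j) -> rep l env R s -> rep l env R' s.
Proof. by move=> h [h1 h2 h3 h4]; split=> // r i j; rewrite h4. Qed.

Lemma vN_mods l d c : all (scratch l d) (mods c) -> vN \notin mods c.
Proof. by apply: contraL => h; apply/allPn; exists vN. Qed.

Lemma V_mods l d c : all (scratch l.+1 d) (mods c) -> lvar l \notin mods c.
Proof. by apply: contraL => h; apply/allPn; exists (lvar l); rewrite // scratch_V ltnn. Qed.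

Section Define.
Variables (r l : nat) (f : form) (R : nat -> rel 'I_n) (env : nat -> 'I_n).
Hypothesis fw : fscoped l.+2 f.
Hypothesis rf : r \notin frels f.
Let new i j := feval R l.+2 (upd (upd env l i) l.+1 j) f.
(** While [r] is being rewritten, its value is whatever its array currently holds; all other
    relations are fixed. *)
Let cur s : nat -> rel 'I_n := upd R r (fun i j => ar s r (i * n + j)).
Let body := CSeq (fcomp f l.+2 0) (CSeq (zof (lvar l) (lvar l.+1))
       (CIf (TOn (flag 0)) (CPrim (PSet r vz true)) (CPrim (PSet r vz false)))).

Lemma define_step (i j : 'I_n) s : rep l.+2 (upd (upd env l i) l.+1 j) (cur s) s ->
  let s' := csem m body s in
  rep l.+2 (upd (upd env l i) l.+1 j) (cur s') s' /\
  forall i' j' : 'I_n, ar s' r (i' * n + j') =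
    if (i' == i) && (j' == j) then new i j else ar s r (i' * n + j').
Proof.
move=> hr; rewrite /body 2!csem_seq csem_if.
set s1 := csem m (fcomp f l.+2 0) s; set s2 := csem m (zof _ _) s1.
have r1 : rep l.+2 (upd (upd env l i) l.+1 j) (cur s) s1.
  exact: rep_frame (mods_fcomp _ _ _) (writes_fcomp _ _ _) hr.
have r2 : rep l.+2 (upd (upd env l i) l.+1 j) (cur s) s2.
  exact: (@rep_frame l.+2 0) r1.
have z2 : vr s2 vz = i * n + j.
  have [b1 N1 V1 _] := r1.
  rewrite zof_spec ?V_notin // N1 !V1 // /upd !eqxx [l == _]ltn_eqF //.
  by apply/minn_idPr/ltnW/cell_lt.
have f1 : (vr s2 (flag 0) < m) = new i j.
  rewrite (@frame l.+2 1) ?scratch_B // (fcomp_spec 0 fw hr); apply: feval_ext => r' hr' a b.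
  by rewrite /cur /upd; case: eqP => // h; case/negP: rf; rewrite -h.
have -> : (if tsem m (TOn (flag 0)) s2 then csem m (CPrim (PSet r vz true)) s2
    else csem m (CPrim (PSet r vz false)) s2) = psem m (PSet r vz (new i j)) s2.
  by rewrite /tsem f1; case: (new i j).
have [b2 N2 V2 A2] := r2; split.
  split=> // r' a b; rewrite /= /cur /upd; case: eqP => [_|hrr] /=; first by rewrite eqxx.
  by rewrite A2 /cur /upd; case: eqP.
move=> i' j'; rewrite /= z2 /upd eqxx cell_inj; case: ifP => // _.
by rewrite A2 /cur /upd eqxx.
Qed.

Lemma define_spec s : rep l env R s ->
  rep l env (upd R r new) (csem m (loop l (loop l.+1 body)) s).
Proof.
move=> hr.
have bm2 : all (scratch l.+2 0) (mods body) by rewrite /body /= all_cat mods_fcomp.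
have bm1 : all (scratch l.+1 0) (mods (loop l.+1 body)).
  rewrite /loop /when /= scratch_V leqnn !cats0 /=.
  by apply: sub_all bm2 => x; apply: scratchW.
have cur0 s0 : (forall r' (i j : 'I_n), ar s0 r' (i * n + j) = ar s r' (i * n + j)) ->
    rep l env R s0 -> rep l env (cur s0) s0.
  move=> _ [h1 h2 h3 h4]; split=> // r' i j; rewrite /cur /upd.
  by case: eqP => [->|].
pose Inv k s' := rep l env (cur s') s' /\
  forall i j : 'I_n, i < k -> ar s' r (i * n + j) = new i j.
have [] : Inv m (csem m (loop l (loop l.+1 body)) s).
  apply: loop_ind.
  - exact: V_mods bm1.
  - by case: hr.
  - exact: vN_mods bm1.
  - by split=> //; apply: rep_setv => //; apply: cur0.
  - move=> i s1 hi [r1 e1].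
    have r1' := rep_bind hi r1.
    pose Inv' k s' := rep l.+1 (upd env l i) (cur s') s' /\
       forall i' j : 'I_n, (i' < i) || (i' == i) && (j < k) -> ar s' r (i' * n + j) = new i' j.
    have [r2 e2] : Inv' m (csem m (loop l.+1 body) s1).
      apply: loop_ind.
      - exact: V_mods bm2.
      - by case: r1.
      - exact: vN_mods bm2.
      - split; first exact: rep_setv.
        by move=> i' j; rewrite andbF orbF; apply: e1.
      - move=> j s2 hj [r2 e2]; have r2' := rep_bind hj r2.
        have [r3 e3] := define_step r2'.
        split.
          apply: (@rep_setv l.+1 (upd env l i) (cur (csem m body s2)) (csem m body s2)).
            exact: leq_trans (ltn_ord j) nm.
          exact: rep_unbind r3.
        move=> i' j' h; rewrite [ar _ _]/= e3.
        case: eqVneq h => [->|ni] /=; last by rewrite orbF => h; apply: e2; rewrite h.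
        rewrite ltnn /= ltnS leq_eqVlt val_eqE; case: eqVneq => [->//|nj] /= h.
        by apply: e2; rewrite eqxx h orbT.
      - move=> k s2 hk km [r2 e2]; split; first exact: rep_setv.
        move=> i' j h; apply: e2; case/orP: h => [->//|/andP[-> _]].
        by rewrite (leq_trans (ltn_ord j) hk) orbT.
    split.
      apply: (@rep_setv l env (cur (csem m (loop l.+1 body) s1))).
        exact: leq_trans (ltn_ord i) nm.
      exact: rep_unbind r2.
    move=> i' j; rewrite ltnS leq_eqVlt val_eqE => /orP[/eqP->|h].
      by rewrite [ar _ _]/= e2 // eqxx (leq_trans (ltn_ord j) nm) orbT.
    by rewrite [ar _ _]/= e2 // h.
  - move=> k s1 hk km [r1 e1]; split; first exact: rep_setv.
    by move=> i j _; apply: e1; exact: leq_trans (ltn_ord i) hk.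
move=> r1 e1; apply: rep_eq r1 => r' i j; rewrite /cur /upd; case: eqP => // _.
by apply: e1; exact: leq_trans (ltn_ord i) nm.
Qed.

End Define.

Lemma flcomp_spec c l env R s : flscoped l c -> rep l env R s ->
  rep l env (flsem l env c R) (csem m (flcomp c l) s).
Proof.
elim: c l env R s => [|r f|c IHc d IHd|f c IHc d IHd|c IH] l env R s.
- by [].
- by case/andP => hf hr h; apply: define_spec.
- by case/andP => hc hd h; apply: IHd => //; apply: IHc.
- case/and3P => hf hc hd h; rewrite [flcomp _ _]/= csem_seq csem_if.
  have h1 := rep_frame (mods_fcomp f l 0) (writes_fcomp _ _ _) h.
  rewrite /tsem (fcomp_spec 0 hf h) [flsem _ _ _ _]/=.
  by case: (feval R l env f); [apply: IHc|apply: IHd].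
move=> hc hr; rewrite [flcomp _ _]/= [flsem _ _ _ _]/=.
set step := fun R i => flsem l.+1 (upd env l i) c R.
pose Inv k s' := rep l env (foldl step R (take k (enum 'I_n))) s'.
have bm := mods_flcomp c l.+1.
have : Inv m (csem m (loop l (flcomp c l.+1)) s); last first.
  by rewrite /Inv take_oversize // size_enum_ord.
apply: loop_ind.
- exact: V_mods bm.
- by case: hr.
- exact: vN_mods bm.
- by rewrite /Inv take0; apply: rep_setv.
- move=> i s1 hi r1; have r2 := IH _ _ _ _ hc (rep_bind hi r1).
  rewrite /Inv (take_nth i) ?size_enum_ord // nth_ord_enum foldl_rcons.
  apply: rep_setv; first exact: leq_trans (ltn_ord i) nm.
  exact: rep_unbind r2.
move=> k s1 hk km r1; apply: rep_setv => //; move: r1.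
by rewrite /Inv !take_oversize // size_enum_ord // leqW.
Qed.

End Run.

Definition set_side := CSeq (CPrim (PZero vN))
  (CSeq (CFor vi (when (TLt vi vK) (CPrim (PInc vN)))) (CPrim (PInc vN))).

(* With [n = k + 1], the position [k * n + k] is the last one iff [n ^ 2 = m]. *)
Definition top_body prog := CSeq set_side (CSeq (zof vK vK)
  (when (TOn vz) (CSeq (CPrim (PInc vz)) (CIf (TOn vz) CSkip (flcomp prog 0))))).
Definition top prog := CFor vK (top_body prog).

Lemma top_step m k prog s : bounded m s -> vr s vK = k -> k < m ->
  if k.+1 * k.+1 == m then
    exists s', [/\ bounded m s', vr s' vN = k.+1, ar s' =2 ar s
      & csem m (top_body prog) s = csem m (flcomp prog 0) s']
  else ar (csem m (top_body prog) s) =2 ar s.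
Proof.
move=> hb hk km; rewrite /top_body csem_seq.
set s1 := csem m set_side s.
have N1 : vr s1 vN = k.+1.
  rewrite /s1 /set_side 2!csem_seq.
  set s2 := csem m (CFor _ _) _.
  have b0 : bounded m (setv s vN 0) by exact: (bounded_psem (PZero vN)).
  have e2 : vr s2 vN = k.
    have hk0 : vr (setv s vN 0) vK = k by [].
    rewrite /s2 (@count_loop m vN vi vK) //; try exact: b0.
    by rewrite hk0 /= /upd eqxx add0n; apply/minn_idPr/ltnW.
  by rewrite /= /upd eqxx e2; apply/minn_idPr.
have b1 : bounded m s1 by apply: bounded_csem.
have K1 : vr s1 vK = k by rewrite csem_mods.
have A1 : ar s1 =2 ar s by move=> a i; rewrite csem_writes.
rewrite csem_seq; set s2 := csem m (zof vK vK) s1.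
have z2 : vr s2 vz = minn m (k * k.+1 + k) by rewrite zof_spec // N1 K1.
have sq : k.+1 * k.+1 = (k * k.+1 + k).+1 by rewrite mulSn addnC addnS.
have b2 : bounded m s2 by apply: bounded_csem.
have A2 : ar s2 =2 ar s by move=> a i; rewrite csem_writes ?A1.
rewrite /when csem_if /tsem z2 gtn_min ltnn orFb sq.
case: ltnP => h; last by rewrite gtn_eqF.
rewrite csem_seq; set s3 := csem m (CPrim (PInc vz)) s2.
have z3 : vr s3 vz = (k * k.+1 + k).+1.
  by rewrite /s3 /= /upd eqxx z2 (minn_idPr (ltnW h)); apply/minn_idPr.
have b3 : bounded m s3 by exact: (bounded_psem (PInc vz)).
rewrite csem_if /tsem z3; move: h; rewrite leq_eqVlt; case: eqP => [e _|_ /= ->] //.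
exists s3; split=> //; last by rewrite e ltnn.
by rewrite /s3 /= /upd /= /s2 csem_mods.
Qed.

Definition input_rels n (w : seq bool) : nat -> rel 'I_n :=
  fun r i j => (r == 0) && nth false w (i * n + j).

(** Squares being injective, at most one guess runs the program, and it finds the input untouched.
    If no guess fits, the array [acc] still holds only [false]. *)
Lemma top_spec prog acc w : flscoped 0 prog -> vK \notin mods (top_body prog) ->
  acc != 0 ->
  ar (csem (size w) (top prog) (cl_start w)) acc 0 <-> exists n, size w = n.+1 * n.+1 /\
     flsem 0 (fun=> ord0) prog (input_rels (n := n.+1) w) acc ord0 ord0.
Proof.
move=> hp hK acc0; set m := size w.
pose res n := flsem 0 (fun=> ord0) prog (input_rels (n := n.+1) w) acc ord0 ord0.
pose Inv k s := bounded m s /\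
  ((forall n, n < k -> n.+1 * n.+1 != m) /\ ar s =2 ar (cl_start w) \/
   exists n, [/\ n < k, n.+1 * n.+1 = m & ar s acc 0 = res n]).
have sqr_inj a b : a.+1 * a.+1 = b.+1 * b.+1 -> a = b.
  by rewrite !mulnn => /eqP; rewrite eqn_exp2r // => /eqP[].
have arS s v i : ar (setv s v i) = ar s by [].
have : Inv m (csem m (top prog) (cl_start w)).
  apply: (cfor_ind (Inv := Inv)) => //.
    by split; [apply: (bounded_psem (PZero vK)) => x|left].
  move=> k s km hk [hb H].
  split; first by move=> x; rewrite /= /upd; case: ifP => // _; exact: (bounded_csem (top_body prog) hb).
  have := top_step prog hb hk km; case: eqP => [sq [s' [b' N' A' e']]|nsq A'].
    case: H => [[_ A]|[n [nk nm _]]]; last first.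
      by move: nk; rewrite -(sqr_inj _ _ (etrans sq (esym nm))) ltnn.
    right; exists k; split=> //; rewrite arS e'.
    have r0 : rep m 0 (fun=> ord0) (input_rels (n := k.+1) w) s'.
      by split=> // r i j; rewrite A' A.
    have [_ _ _ r1] := flcomp_spec (ltn0Sn k) (esym sq) hp r0.
    exact: (r1 acc ord0 ord0).
  case: H => [[h A]|[n [nk nm A]]].
    left; split=> [n|a i]; last by rewrite arS A' A.
    by rewrite ltnS leq_eqVlt => /orP[/eqP->|/h //]; apply/eqP.
  by right; exists n; split; rewrite ?arS ?A' // ltnW.
case=> _ [[h A]|[n [nk nm A]]].
  rewrite A /= (negPf acc0); split=> // -[n [nm _]].
  have nk : n < m by rewrite nm mulSn addSn ltnS leq_addr.
  by case/eqP: (h n nk).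
rewrite A; split=> [hr|[n' [nm' hr]]]; first by exists n.
by rewrite (sqr_inj n n') // nm.
Qed.

Lemma fl_decides nv na acc prog : flscoped 0 prog -> cwf nv na (top prog) ->
  0 < acc < na -> exists M : TM, forall L : seq bool -> Prop,
  (forall w, L w <-> w = [::] \/ exists n, size w = n.+1 * n.+1 /\
     flsem 0 (fun=> ord0) prog (input_rels (n := n.+1) w) acc ord0 ord0) ->
  decides_in_poly_time M L.
Proof.
move=> hp hw /andP[acc0 hacc].
have [M HM] := cl_decides (leq_ltn_trans (leq0n acc) hacc) hacc hw.
exists M => L HL; apply: HM => w; rewrite HL.
have hK : vK \notin mods (top_body prog) by case/and3P: hw.
by rewrite (top_spec _ hp hK) // -lt0n.
Qed.

(** * The recognition program *)

Section Greedy.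
Variables (S I : Type) (P : S -> I -> bool) (G : S -> I -> S) (meas : S -> nat).
Hypothesis decr : forall s i, P s i -> meas (G s i) < meas s.

Definition greedy_step s i := if P s i then G s i else s.

Inductive steps : S -> S -> Prop :=
  | Steps0 s : steps s s
  | StepsS s i s' : P s i -> steps (G s i) s' -> steps s s'.

Lemma steps_trans s s' s'' : steps s s' -> steps s' s'' -> steps s s''.
Proof. by elim=> // {}s i {}s' h _ IH /IH; apply: StepsS. Qed.

Lemma sweep_steps xs s : steps s (foldl greedy_step s xs).
Proof.
elim: xs s => [|x xs IH] s /=; first exact: Steps0.
by rewrite [greedy_step s x]/greedy_step; case: ifP => h; [apply: StepsS h _|]; apply: IH.
Qed.

Lemma steps_meas s s' : steps s s' -> meas s' <= meas s.
Proof. by elim=> // {}s i {}s' /decr h _ IH; apply: leq_trans (ltnW h). Qed.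

Lemma sweep_progress xs s : meas (foldl greedy_step s xs) < meas s \/
  foldl greedy_step s xs = s /\ all (fun i => ~~ P s i) xs.
Proof.
elim: xs s => [|x xs IH] s /=; first by right.
rewrite [greedy_step s x]/greedy_step; case: ifP => h /=.
  left; apply: leq_ltn_trans (decr h); exact: steps_meas (sweep_steps _ _).
by have [h'|[-> ->]] := IH s; [left|right].
Qed.

(** A round without any change proves that no move applies; every other round lowers [meas]. *)
Lemma greedy_end J (ts : seq J) xs s : meas s <= size ts ->
  let s' := foldl (fun s _ => foldl greedy_step s xs) s ts in
  steps s s' /\ all (fun i => ~~ P s' i) xs.
Proof.
elim: ts s => [|t ts IH] s /= hs.
  split; first exact: Steps0.
  have PF i : P s i = false.
    by apply/negP => /decr; rewrite leqn0 in hs; rewrite (eqP hs).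
  by elim: xs => //= x xs ->; rewrite PF.
have [h|[e h]] := sweep_progress xs s.
  have [h1 h2] := IH _ (leq_trans h hs); split=> //.
  exact: steps_trans (sweep_steps _ _) h1.
rewrite e; have -> : foldl (fun s _ => foldl greedy_step s xs) s ts = s.
  by elim: ts {IH hs} => //= _ ts; rewrite e.
by split; first exact: Steps0.
Qed.

Lemma steps_inv (Q : S -> Prop) s s' : (forall s i, Q s -> P s i -> Q (G s i)) ->
  steps s s' -> Q s -> Q s'.
Proof. by move=> h; elim=> // {}s i {}s' hp _ IH hs; apply/IH/h. Qed.

End Greedy.

(** A simulation principle: the loop on all relations projects to the abstract greedy loop on the
    few that carry its state. *)
Lemma foldl_proj A A' I (f : A -> I -> A) (g : A' -> I -> A') (p : A -> A') (ok : A -> Prop) xs s :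
  (forall s i, ok s -> ok (f s i) /\ p (f s i) = g (p s) i) -> ok s ->
  ok (foldl f s xs) /\ p (foldl f s xs) = foldl g (p s) xs.
Proof.
by move=> h; elim: xs s => //= x xs IH s hs; have [h1 <-] := h s x hs; apply: IH.
Qed.

Definition fnot f := FBin (fun a _ => ~~ a) f (FConst false).
Definition fand := FBin andb.
Definition for_ := FBin orb.
Definition fimp := FBin implb.
Definition fall f := fnot (FEx (fnot f)).

Fixpoint fwrites c :=
  match c with
  | FSkip => [::]
  | FDef r _ => [:: r]
  | FSeq c d | FIf _ c d => fwrites c ++ fwrites d
  | FFor c => fwrites c
  end.

Lemma level_neq l : [/\ (l == l.+1) = false, (l == l.+2) = false & (l == l.+3) = false].
Proof. by split; apply: ltn_eqF; rewrite ltnS // leqW // leqW. Qed.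

(** * The recognition program and the sets it computes *)

Section Program.
Variable n : nat.
Implicit Types (R : nat -> rel 'I_n) (env : nat -> 'I_n).

Lemma feval_not R l env f : feval R l env (fnot f) = ~~ feval R l env f.
Proof. by []. Qed.
Lemma feval_and R l env f g : feval R l env (fand f g) = feval R l env f && feval R l env g.
Proof. by []. Qed.
Lemma feval_or R l env f g : feval R l env (for_ f g) = feval R l env f || feval R l env g.
Proof. by []. Qed.
Lemma feval_imp R l env f g : feval R l env (fimp f g) = (feval R l env f ==> feval R l env g).
Proof. by []. Qed.
Lemma feval_all R l env f : feval R l env (fall f) =
  [forall i, feval R l.+1 (upd env l i) f].
Proof.
rewrite /fall feval_not /= negb_exists; apply: eq_forallb => i.
by rewrite -[X in ~~ X]/(feval R l.+1 (upd env l i) (fnot f)) feval_not negbK.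
Qed.
Lemma feval_ex R l env f : feval R l env (FEx f) = [exists i, feval R l.+1 (upd env l i) f].
Proof. by []. Qed.

Lemma flsem_frame c l env R q : q \notin fwrites c -> flsem l env c R q = R q.
Proof.
elim: c l env R => //= [r f|c IHc d IHd|f c IHc d IHd|c IH] l env R.
- by rewrite inE /upd => /negPf->.
- by rewrite mem_cat negb_or => /andP[h1 h2]; rewrite IHd // IHc.
- by rewrite mem_cat negb_or => /andP[h1 h2]; case: ifP => _; [apply: IHc|apply: IHd].
by move=> h; elim: (enum _) R => //= i s IHs R; rewrite IHs IH.
Qed.

(** Reflexive transitive closure, one more edge per round. Relation 1 is a scratch copy, because a
    definition may not mention the relation it defines. *)
Definition clos l r s := FSeq (FDef r (FEq l l.+1))
  (FFor (FSeq (FDef 1 (for_ (FRel r l.+1 l.+2) (FEx (fand (FRel r l.+1 l.+3) (FRel s l.+3 l.+2)))))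
              (FDef r (FRel 1 l.+1 l.+2)))).

Lemma clos_sem l env R r s x y : r != 1 -> s != 1 -> r != s ->
  flsem l env (clos l r s) R r x y = connect (R s) x y.
Proof.
move=> r1 s1 rs; set e := R s.
have [l1 l2 l3] := level_neq l; rewrite [flsem _ _ _ _]/=.
set step := (fun R0 i => _); set R0 := upd R r _.
have [h0s h0r] : R0 s = e /\ forall x y, R0 r x y = (x == y).
  split; first by rewrite /R0 /upd eq_sym (negPf rs).
  by move=> a b; rewrite /R0 /upd eqxx /= /upd !eqxx l1.
have stepP k R1 i : R1 s = e ->
    (forall x y, R1 r x y <-> exists p, [/\ path e x p, last x p = y & size p <= k]) ->
    step R1 i s = e /\
    (forall x y, step R1 i r x y <-> exists p, [/\ path e x p, last x p = y & size p <= k.+1]).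
  move=> hs hr; split.
    by rewrite /step /upd eq_sym (negPf rs) /= (negPf s1).
  move=> a b.
  have -> : step R1 i r a b = R1 r a b || [exists c, R1 r a c && e c b].
    by rewrite /step /upd !eqxx /= !eqSS ?eqxx ?l1 ?l2 ?l3 hs.
  split.
    case/orP => [/hr[p [h1 h2 h3]]|/existsP[c /andP[/hr[p [h1 h2 h3]] hc]]].
      by exists p; split=> //; apply: leqW.
    by exists (rcons p b); rewrite rcons_path last_rcons size_rcons h1 h2 hc.
  case=> p; case/lastP: p => [|p c] [h1 h2 h3].
    by apply/orP; left; apply/hr; exists [::].
  rewrite rcons_path in h1; rewrite last_rcons in h2; rewrite size_rcons ltnS in h3; subst c.
  case/andP: h1 => h1 hc; apply/orP; right; apply/existsP; exists (last a p); rewrite hc andbT.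
  by apply/hr; exists p.
have H k (js : seq 'I_n) R1 : R1 s = e ->
    (forall x y, R1 r x y <-> exists p, [/\ path e x p, last x p = y & size p <= k]) ->
    forall x y, foldl step R1 js r x y <->
      exists p, [/\ path e x p, last x p = y & size p <= k + size js].
  elim: js k R1 => [|j js IH] k R1 hs hr; first by rewrite addn0.
  have [hs' hr'] := stepP k R1 j hs hr.
  by rewrite [size _]/= addnS -addSn; apply: IH.
have hr0 a b : R0 r a b <-> exists p, [/\ path e a p, last a p = b & size p <= 0].
  rewrite h0r; split=> [/eqP->|[[|c p] [_ h _]] //]; first by exists [::].
  exact/eqP.
have {}H := H 0 (enum 'I_n) R0 h0s hr0.
apply/idP/connectP => [|[p hp hy]]; first by case/H => p [h1 h2 _]; exists p.
apply/H.
(* A path without repetition has fewer than [n] edges, so [n] rounds find it. *)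
case/shortenP: hp hy => p' hp' hu _ hy; exists p'; split=> //.
have h1 := max_card (mem (x :: p')); rewrite (card_uniqP hu) card_ord /= in h1.
by rewrite size_enum_ord add0n ltnW.
Qed.

Local Arguments upd : simpl never.
Definition diag R r : {set 'I_n} := [set x | R r x x].

Definition conn_of l s q :=
  FSeq (FDef 5 (fand (FRel s l l) (fand (FRel s l.+1 l.+1) (FRel 0 l l.+1)))) (clos l q 5).

Lemma flsem_seq l env c d R : flsem l env (FSeq c d) R = flsem l env d (flsem l env c R).
Proof. by []. Qed.
Lemma flsem_if l env f c d R : flsem l env (FIf f c d) R =
  if feval R l env f then flsem l env c R else flsem l env d R.
Proof. by []. Qed.
Lemma flsem_def l env r f R x y : flsem l env (FDef r f) R r x y =
  feval R l.+2 (upd (upd env l x) l.+1 y) f.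
Proof. by rewrite /= /upd eqxx. Qed.

Lemma upd_eq A (f : nat -> A) x y : upd f x y x = y.
Proof. by rewrite /upd eqxx. Qed.
Lemma upd_lt A (f : nat -> A) x y z : z < x -> upd f x y z = f z.
Proof. by move=> h; rewrite /upd ltn_eqF. Qed.

Lemma conn_ofE l env R s q x y : q != 1 -> q != 5 ->
  flsem l env (conn_of l s q) R q x y = conn (R 0) (diag R s) x y.
Proof.
move=> q1 q5; rewrite /conn_of flsem_seq clos_sem //.
apply: eq_connect => a b; rewrite flsem_def !feval_and /= !upd_eq !(@upd_lt _ _ l.+1) // !upd_eq.
by rewrite /induced !inE.
Qed.

Definition prec_form l s q a b :=
  fall (fimp (fnot (FRel s l l))
    (fimp (FEx (fand (FRel q b l.+1) (FRel 0 l l.+1)))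
          (fall (fimp (FRel q a l.+1) (FRel 0 l l.+1))))).

Lemma prec_formE l env R s q a b : a < l -> b < l ->
  R q =2 conn (R 0) (diag R s) ->
  feval R l env (prec_form l s q a b) = prec (R 0) (diag R s) (env a) (env b).
Proof.
move=> al bl hq; rewrite /prec_form feval_all; apply: eq_forallb => x.
rewrite !feval_imp feval_not feval_all feval_ex /= upd_eq inE; congr (_ ==> (_ ==> _)).
  apply: eq_existsb => c; rewrite !upd_eq !(@upd_lt _ _ l.+1) ?ltnS ?(ltnW bl) //.
  by rewrite upd_eq upd_lt // hq.
apply: eq_forallb => c; rewrite /= !upd_eq !(@upd_lt _ _ l.+1) ?ltnS ?(ltnW al) //.
by rewrite upd_eq upd_lt // hq.
Qed.

Definition cmp_form q a b := for_ (FRel q a b) (for_ (FRel 11 a b) (FRel 11 b a)).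

Lemma cmp_formE l env R q S a b : R q =2 conn (R 0) S -> R 11 =2 prec (R 0) S ->
  feval R l env (cmp_form q a b) = comparable (R 0) S (env a) (env b).
Proof. by move=> h1 h2; rewrite !feval_or /= !h1 !h2. Qed.

(* Sets are diagonals of relations.  Relation 0 is the graph, 2 is [K], 3 the
   vertices not yet peeled and 15 the verdict.  While peeling, 4 is [conn] of 3,
   8 the clique [X], 9 is 3 without [X], and 10 is [conn] of 9.  While merging,
   7 holds the vertices not yet eliminated, 6 the relation "on one arm", 10 is
   [conn] outside [K], 11 is [prec], 12 the contested vertices, and 14 is 6
   after merging them. *)
Definition in_clique l x := for_ (FRel 8 x x)
  (fand (fnot (FRel 4 4 x)) (FEx (fand (FRel 4 4 l) (FRel 0 x l)))).

Definition elig_form :=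
  fand (FEx (FRel 8 5 5))
 (fand (fall (fall (fimp (in_clique 7 5) (fimp (in_clique 7 6)
          (fimp (fnot (FEq 5 6)) (FRel 0 5 6))))))
       (fall (fall (fimp (fand (FRel 4 4 5) (fnot (FRel 8 5 5)))
          (fimp (fand (FRel 4 4 6) (fnot (FRel 8 6 6))) (cmp_form 10 5 6)))))).

(** One attempted peel. Variables 3 and 4 are [u] and [d]; variable 2 counts the rounds. *)
Definition body1 :=
  FSeq (conn_of 5 3 4)
 (FSeq (FDef 8 (fand (FRel 3 4 4) (fand (FRel 4 4 5) (for_ (FEq 5 3) (FRel 0 3 5)))))
 (FSeq (FDef 9 (fand (FRel 3 5 5) (fnot (FRel 8 5 5))))
 (FSeq (conn_of 5 9 10)
 (FSeq (FDef 11 (prec_form 7 9 10 5 6))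
       (FIf elig_form (FDef 3 (FRel 9 5 5)) FSkip))))).

Lemma diagP R r x : R r x x = (x \in diag R r). Proof. by rewrite inE. Qed.

Lemma body1E env R : let A := diag R 3 in let u := env 3 in let d := env 4 in
  diag (flsem 5 env body1 R) 3 =
  if eligible (R 0) A u d then A :\: closed_nbhd (R 0) (component (R 0) A d) u else A.
Proof.
move=> A u d; set e := R 0; rewrite /body1 5!(flsem_seq 5 env).
set R1 := flsem 5 env (conn_of 5 3 4) R.
have R10 : R1 0 = e by rewrite /R1 flsem_frame.
have R13 : diag R1 3 = A by rewrite /diag /R1 flsem_frame.
have R14 : R1 4 =2 conn e A by move=> x y; rewrite /R1 conn_ofE.
set R2 := flsem 5 env (FDef 8 _) R1.
have R20 : R2 0 = e by rewrite /R2 flsem_frame.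
have R23 : diag R2 3 = A by rewrite /diag /R2 flsem_frame.
have R24 : R2 4 =2 conn e A by move=> x y; rewrite /R2 flsem_frame.
(* The program leaves [X] empty when [d] is already peeled, so its test for nonemptiness also covers
   [d \in A]. *)
pose X := if d \in A then closed_nbhd e (component e A d) u else set0.
have R28 x y : R2 8 x y = (x \in X).
  rewrite /R2 flsem_def !feval_and feval_or /= R14 R10 diagP R13.
  rewrite /upd /= -/d -/u /X; case: (d \in A); last by rewrite inE.
  by rewrite !inE.
have XE : diag R2 8 = X by apply/setP => x; rewrite inE R28.
set R3 := flsem 5 env (FDef 9 _) R2.
have R30 : R3 0 = e by rewrite /R3 flsem_frame.
have R33 : diag R3 3 = A by rewrite /diag /R3 flsem_frame.
have R34 : R3 4 =2 conn e A by move=> x y; rewrite /R3 flsem_frame.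
have R38 : diag R3 8 = X by rewrite /diag /R3 flsem_frame.
have R39 : diag R3 9 = A :\: X.
  apply/setP => x; rewrite inE /R3 flsem_def feval_and feval_not /= R28 diagP R23.
  by rewrite /upd /= in_setD andbC.
set R4 := flsem 5 env (conn_of 5 9 10) R3.
have R40 : R4 0 = e by rewrite /R4 flsem_frame.
have R43 : diag R4 3 = A by rewrite /diag /R4 flsem_frame.
have R44 : R4 4 =2 conn e A by move=> x y; rewrite /R4 flsem_frame.
have R48 : diag R4 8 = X by rewrite /diag /R4 flsem_frame.
have R49 : diag R4 9 = A :\: X by rewrite /diag /R4 flsem_frame.
have R410 : R4 10 =2 conn e (A :\: X) by move=> x y; rewrite /R4 conn_ofE // R30 R39.
set R5 := flsem 5 env (FDef 11 _) R4.
have R50 : R5 0 = e by rewrite /R5 flsem_frame.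
have R53 : diag R5 3 = A by rewrite /diag /R5 flsem_frame.
have R54 : R5 4 =2 conn e A by move=> x y; rewrite /R5 flsem_frame.
have R58 : diag R5 8 = X by rewrite /diag /R5 flsem_frame.
have R59 : diag R5 9 = A :\: X by rewrite /diag /R5 flsem_frame.
have R510 : R5 10 =2 conn e (A :\: X) by move=> x y; rewrite /R5 flsem_frame.
have R511 : R5 11 =2 prec e (A :\: X).
  by move=> x y; rewrite /R5 flsem_def prec_formE // R40 R49.
have cliqueE env' x : env' 4 = d -> x < 7 -> feval R5 7 env' (in_clique 7 x) =
    (env' x \in X :|: boundary e (component e A d)).
  move=> h4 hx; rewrite /in_clique feval_or feval_and feval_not feval_ex in_setU /=.
  have bE v : (v \in boundary e (component e A d)) =
      ~~ conn e A d v && [exists c in component e A d, e v c] by rewrite [LHS]inE inE.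
  rewrite diagP R58 R54 h4 bE; congr (_ || (_ && _)).
  by apply: eq_existsb => c; rewrite upd_eq !upd_lt // h4 R54 R50 inE.
rewrite flsem_if; have -> : feval R5 5 env elig_form =
    [&& X != set0, clique e (X :|: boundary e (component e A d))
     & [forall a in component e A d :\: X, forall b in component e A d :\: X, comparable e (A :\: X) a b]].
  rewrite /elig_form !feval_and feval_ex !feval_all; congr [&& _, _ & _].
  - apply/existsP/set0Pn => -[x]; first by rewrite /= upd_eq diagP R58; exists x.
    by move=> hx; exists x; rewrite /= upd_eq diagP R58.
  - apply: eq_forallb => a; rewrite feval_all.
    case ha: (a \in _); last first.
      by apply/forallP => b; rewrite feval_imp cliqueE // /upd /= ha.
    apply: eq_forallb => b.
    rewrite !feval_imp feval_not !cliqueE // /= /upd /= ha R50 /=.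
    by rewrite -/u.
  have DXE x : (x \in component e A d :\: X) = conn e A d x && (x \notin X).
    by rewrite in_setD andbC inE.
  apply: eq_forallb => a; rewrite feval_all DXE.
  case ha: (_ && _); last first.
    apply/forallP => b; rewrite feval_imp feval_and feval_not /= R54 diagP R58 /upd /= -/d.
    by rewrite ha.
  apply: eq_forallb => b; rewrite !feval_imp !feval_and !feval_not.
  rewrite (@cmp_formE _ _ _ _ (A :\: X)) ?R50 //.
  by rewrite /= !R54 !diagP R58 /upd /= -/d ha /= DXE.
rewrite /eligible -/X.
have [dA|dA] := boolP (d \in A); last first.
  have -> : X = set0 by rewrite /X (negPf dA).
  by rewrite eqxx /= R53.
have XE' : X = closed_nbhd e (component e A d) u by rewrite /X dA.
rewrite -XE' /=; case: ifP => //.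
Qed.

Definition arms_init :=
  FSeq (FDef 9 (fnot (FRel 2 2 2)))
 (FSeq (conn_of 2 9 10)
 (FSeq (FDef 11 (prec_form 4 9 10 2 3))
 (FSeq (FDef 6 (fand (fnot (FRel 2 2 2)) (fand (fnot (FRel 2 3 3)) (FRel 10 2 3))))
       (FDef 7 (FRel 2 2 2))))).

(** One attempted elimination, of variable 3. Relation 13 marks the vertices whose class meets the
    contested set. *)
Definition body2 :=
  FSeq (FDef 12 (fand (fnot (FRel 2 4 4)) (FEx (fand (FRel 7 6 6)
         (FEx (fand (FRel 10 4 7) (fand (FRel 0 3 7) (fnot (FRel 0 6 7)))))))))
 (FSeq (FDef 13 (FEx (fand (FRel 12 6 6) (FRel 6 4 6))))
 (FSeq (FDef 14 (for_ (FRel 6 4 5) (fand (FRel 13 4 4) (FRel 13 5 5))))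
       (FIf (fand (FRel 7 3 3) (fall (fall (fimp (FRel 14 4 5) (cmp_form 10 4 5)))))
          (FSeq (FDef 6 (FRel 14 4 5))
          (FSeq (FDef 1 (fand (FRel 7 4 4) (fnot (FEq 4 3))))
                (FDef 7 (FRel 1 4 4))))
          FSkip))).

Record arms_ready e (K : {set 'I_n}) R : Prop := ArmsReady {
  ar_e : R 0 = e;
  ar_K : diag R 2 = K;
  ar_conn : R 10 =2 conn e (~: K);
  ar_prec : R 11 =2 prec e (~: K) }.

Lemma arms_initE env R : arms_ready (R 0) (diag R 2) (flsem 2 env arms_init R) /\
  (diag (flsem 2 env arms_init R) 7, flsem 2 env arms_init R 6) =
  (diag R 2, same_comp (R 0) (diag R 2)).
Proof.
set e := R 0; set K := diag R 2; rewrite /arms_init 4!(flsem_seq 2 env).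
set R1 := flsem 2 env (FDef 9 _) R.
have R19 : diag R1 9 = ~: K.
  by apply/setP => x; rewrite inE /R1 flsem_def feval_not /= /upd /= inE inE.
have R10 : R1 0 = e by rewrite /R1 flsem_frame.
have R12 : diag R1 2 = K by rewrite /diag /R1 flsem_frame.
set R2 := flsem 2 env (conn_of _ _ _) R1.
have R20 : R2 0 = e by rewrite /R2 flsem_frame.
have R22 : diag R2 2 = K by rewrite /diag /R2 flsem_frame.
have R29 : diag R2 9 = ~: K by rewrite /diag /R2 flsem_frame.
have R210 : R2 10 =2 conn e (~: K) by move=> x y; rewrite /R2 conn_ofE // R10 R19.
set R3 := flsem 2 env (FDef 11 _) R2.
have R30 : R3 0 = e by rewrite /R3 flsem_frame.
have R32 : diag R3 2 = K by rewrite /diag /R3 flsem_frame.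
have R310 : R3 10 =2 conn e (~: K) by move=> x y; rewrite /R3 flsem_frame.
have R311 : R3 11 =2 prec e (~: K).
  by move=> x y; rewrite /R3 flsem_def prec_formE // R20 R29.
set R4 := flsem 2 env (FDef 6 _) R3.
have R42 : diag R4 2 = K by rewrite /diag /R4 flsem_frame.
have R46 : R4 6 = same_comp e K.
  apply: funext => x; apply: funext => y.
  by rewrite /R4 flsem_def !feval_and !feval_not /= !diagP R32 R310 /upd.
set R5 := flsem 2 env (FDef 7 _) R4.
split; last first.
  congr (_, _); last by rewrite /R5 flsem_frame // R46.
  by rewrite -R42; apply/setP => x; rewrite inE /R5 flsem_def /= diagP /upd.
split; try move=> x y; rewrite /diag /R5 flsem_frame //; rewrite /R4 flsem_frame //.
Qed.

Definition mergeable e (K : {set 'I_n}) (s : {set 'I_n} * rel 'I_n) (x : 'I_n) :=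
  (x \in s.1) && [forall a, forall b,
     merge s.2 (contest e K s.1 x) a b ==> comparable e (~: K) a b].
Definition merge_step e (K : {set 'I_n}) (s : {set 'I_n} * rel 'I_n) (x : 'I_n) :=
  (s.1 :\ x, merge s.2 (contest e K s.1 x)).

Lemma body2E e K env R : arms_ready e K R -> let R' := flsem 4 env body2 R in
  arms_ready e K R' /\
  (diag R' 7, R' 6) = greedy_step (mergeable e K) (merge_step e K) (diag R 7, R 6) (env 3).
Proof.
move=> [Re RK Rc Rp] R'.
split; first by split; try move=> x y; rewrite /diag /R' flsem_frame.
rewrite /R' /body2 3!(flsem_seq 4 env).
set X := diag R 7; set x := env 3; set B := R 6.
set R1 := flsem 4 env (FDef 12 _) R.
have R112 : diag R1 12 = contest e K X x.
  apply/setP => u; rewrite inE /R1 flsem_def feval_and feval_not feval_ex /= diagP RK.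
  rewrite /contest /contested [RHS]inE in_setC /upd /=; congr (_ && _).
  apply: eq_existsb => y; rewrite diagP; congr (_ && _).
  by apply: eq_existsb => c; rewrite Rc Re.
have R16 : R1 6 = B by rewrite /R1 flsem_frame.
have R17 : diag R1 7 = X by rewrite /diag /R1 flsem_frame.
have R10 : R1 0 = e by rewrite /R1 flsem_frame.
have R110 : R1 10 =2 conn e (~: K) by move=> a b; rewrite /R1 flsem_frame.
have R111 : R1 11 =2 prec e (~: K) by move=> a b; rewrite /R1 flsem_frame.
set R2 := flsem 4 env (FDef 13 _) R1.
have R213 a b : R2 13 a b = meets B (contest e K X x) a.
  rewrite /R2 flsem_def feval_ex; apply: eq_existsb => u.
  by rewrite /= diagP R112 R16 /upd.
have R26 : R2 6 = B by rewrite /R2 flsem_frame.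
have R27 : diag R2 7 = X by rewrite /diag /R2 flsem_frame.
have R20 : R2 0 = e by rewrite /R2 flsem_frame.
have R210 : R2 10 =2 conn e (~: K) by move=> a b; rewrite /R2 flsem_frame.
have R211 : R2 11 =2 prec e (~: K) by move=> a b; rewrite /R2 flsem_frame.
set R3 := flsem 4 env (FDef 14 _) R2.
have R314 : R3 14 =2 merge B (contest e K X x).
  by move=> a b; rewrite /R3 flsem_def feval_or feval_and /= !R213 R26 /upd.
have R36 : R3 6 = B by rewrite /R3 flsem_frame.
have R37 : diag R3 7 = X by rewrite /diag /R3 flsem_frame.
have R30 : R3 0 = e by rewrite /R3 flsem_frame.
have R310 : R3 10 =2 conn e (~: K) by move=> a b; rewrite /R3 flsem_frame.
have R311 : R3 11 =2 prec e (~: K) by move=> a b; rewrite /R3 flsem_frame.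
have H : feval R3 4 env (fand (FRel 7 3 3) (fall (fall (fimp (FRel 14 4 5) (cmp_form 10 4 5))))) =
    mergeable e K (X, B) x.
  rewrite feval_and feval_all /mergeable [(X, B).1]/= [(X, B).2]/=.
  congr (_ && _); first by rewrite /= diagP R37.
  apply: eq_forallb => a; rewrite feval_all; apply: eq_forallb => b.
  by rewrite feval_imp (@cmp_formE _ _ _ _ (~: K)) ?R30 //= R314 /upd.
rewrite flsem_if H /greedy_step; case: ifP => _; last by rewrite [flsem _ _ _ _]/= R37 R36.
rewrite !(flsem_seq 4 env) /merge_step.
set R4 := flsem 4 env (FDef 6 _) R3; set R5 := flsem 4 env (FDef 1 _) R4.
set R6 := flsem 4 env (FDef 7 _) R5.
have R46 : R4 6 = merge B (contest e K X x).
  by apply: funext => a; apply: funext => b; rewrite /R4 flsem_def /= R314 /upd.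
have R47 : diag R4 7 = X by rewrite /diag /R4 flsem_frame.
congr (_, _); last by rewrite /R6 flsem_frame // /R5 flsem_frame.
apply/setP => a; rewrite inE /R6 flsem_def /= /R5 flsem_def feval_and feval_not /= diagP R47.
by rewrite /upd /= in_setD1 andbC.
Qed.

Definition clique_form := fall (fall (fimp (FRel 2 2 2) (fimp (FRel 2 3 3)
  (fimp (fnot (FEq 2 3)) (FRel 0 2 3))))).

(** Variables 0 and 1 are the two guessed vertices. Success means that relations 3 and 7 have been
    emptied: all is peeled and all of [K] is eliminated. *)
Definition center_body :=
  FSeq (FDef 2 (fand (for_ (FEq 2 0) (FRel 0 0 2)) (for_ (FEq 2 1) (FRel 0 1 2))))
 (FSeq (FDef 3 (fnot (FRel 2 2 2)))
 (FSeq (FFor (FFor (FFor body1)))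
 (FSeq arms_init
 (FSeq (FFor (FFor body2))
       (FIf (fand clique_form (fand (fnot (FEx (FRel 3 2 2))) (fnot (FEx (FRel 7 2 2)))))
          (FDef 15 (FConst true)) FSkip))))).

(** A word of square length need not encode a graph, so symmetry and irreflexivity are tested
    first. *)
Definition star_prog :=
  FIf (fand (fall (fall (fimp (FRel 0 0 1) (FRel 0 1 0)))) (fall (fnot (FRel 0 0 0))))
    (FFor (FFor center_body)) FSkip.

End Program.

Lemma foldl_pairs S I J (f : S -> I * J -> S) (xs : seq I) (ys : seq J) s :
  foldl (fun s x => foldl (fun s y => f s (x, y)) s ys) s xs =
  foldl f s [seq (x, y) | x <- xs, y <- ys].
Proof.
elim: xs s => //= x xs IH s; rewrite foldl_cat -IH; congr foldl.
by elim: ys s {IH} => //= y ys IH s; rewrite IH.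
Qed.

(** * The greedy loops decide whether a clique is central *)

Section Center.
Variables (n : nat) (e : rel 'I_n).
Hypothesis eS : symmetric e.
Hypothesis eI : irreflexive e.
Implicit Types (R : nat -> rel 'I_n) (env : nat -> 'I_n) (K A : {set 'I_n}).
Local Notation vs := (enum 'I_n).

Definition peel_ok A (ud : 'I_n * 'I_n) := eligible e A ud.1 ud.2.
Definition peel A (ud : 'I_n * 'I_n) := A :\: closed_nbhd e (component e A ud.2) ud.1.
Definition peel_all A := foldl (fun A (_ : 'I_n) =>
  foldl (greedy_step peel_ok peel) A [seq (u, d) | u <- vs, d <- vs]) A vs.
Definition merge_all K s := foldl (fun s (_ : 'I_n) =>
  foldl (greedy_step (mergeable e K) (merge_step e K)) s vs) s vs.

(** Soundness pulls goodness back along the peels and completeness pushes it forward, where a stuck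
    nonempty rest would contradict [eligible_exists]. *)
Lemma peel_allE K : clique e K -> (peel_all (~: K) == set0) <-> allgood e (~: K).
Proof.
have decr A ud : peel_ok A ud -> #|peel A ud| < #|A| by apply: eligible_card.
have szA : #|~: K| <= size vs by rewrite size_enum_ord -[X in _ <= X]card_ord max_card.
move=> cK; have := @greedy_end _ _ peel_ok peel (fun A => #|A|) decr _ vs
  [seq (u, d) | u <- vs, d <- vs] (~: K) szA.
rewrite -/(peel_all _); move: (peel_all _) => A /= [st term].
have cb : clique_bounded e (~: K).
  move=> d hd; apply: clique_sub cK; apply/subsetP => v /(boundary_out eS hd).
  by rewrite inE negbK.
split=> [/eqP A0|ag].
  have : (fun A => allgood e A -> allgood e (~: K)) A.
    apply: (steps_inv (Q := fun A => allgood e A -> allgood e (~: K)) _ st) => //.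
    move=> {term st A0 A szA} A ud IH ok h; apply: IH.
    exact: (eligible_sound eS ok).
  by apply; rewrite A0 => d; rewrite inE.
have [agA cbA] : allgood e A /\ clique_bounded e A.
  apply: (steps_inv (Q := fun A => allgood e A /\ clique_bounded e A) _ st) => //.
  by move=> {term st szA} A ud [h1 h2] ok; exact: (eligible_complete eS ok).
apply/negPn/negP => /set0Pn[d hd]; have [u hu] := eligible_exists eS hd (agA d hd) (cbA d hd).
move/allP/(_ (u, d)): term => /(_ _)/negP; apply => //.
by apply/allpairsP; exists (u, d); rewrite !mem_enum.
Qed.

(** Every merge preserves solvability in both directions, so the final state decides: an empty one
    is solvable, and a stuck nonempty one is not, by [arms_feasible]. *)
Lemma merge_allE K : (merge_all K (K, same_comp e K)).1 == set0 <->
  arms_solvable e K K (same_comp e K).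
Proof.
have decr s x : mergeable e K s x -> #|(merge_step e K s x).1| < #|s.1|.
  by case/andP => hx _; rewrite /= (cardsD1 x s.1) hx.
have szK : #|K| <= size vs by rewrite size_enum_ord -[X in _ <= X]card_ord max_card.
have := @greedy_end _ _ (mergeable e K) (merge_step e K) (fun s => #|s.1|) decr _ vs vs
  (K, same_comp e K) szK.
rewrite -/(merge_all _ _); move: (merge_all _ _) => s /= [st term].
have [I HS] : arms_inv e K s.1 s.2 /\
    (arms_solvable e K K (same_comp e K) <-> arms_solvable e K s.1 s.2).
  apply: (steps_inv (Q := fun s => arms_inv e K s.1 s.2 /\
    (arms_solvable e K K (same_comp e K) <-> arms_solvable e K s.1 s.2)) _ st).
    move=> {term st} s1 x [I1 H1] /andP[hx /forallP hm].
    have hm' a b : merge s1.2 (contest e K s1.1 x) a b -> comparable e (~: K) a b.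
      by move/forallP: (hm a) => /(_ b)/implyP.
    split; first exact: arms_inv_merge.
    apply: iff_trans H1 _; exact: arms_solvable_merge.
  by split=> //; apply: arms_inv_init.
rewrite HS; split=> [/eqP s0|hs].
  by rewrite s0 in I *; apply: arms_solvable0.
apply/negPn/negP => s0; have [x hx hm] := arms_feasible I s0 hs.
move/allP/(_ x (mem_enum _ _)): term => /negP; apply; apply/andP; split=> //.
by apply/forallP => a; apply/forallP => b; apply/implyP; apply: hm.
Qed.

Lemma peel_loopE env R : R 0 = e ->
  diag (flsem 2 env (FFor (FFor (FFor body1))) R) 3 = peel_all (diag R 3).
Proof.
move=> R0.
have inner t u env3 R1 : env3 = upd (upd env 2 t) 3 u -> R1 0 = e ->
    (flsem 4 env3 (FFor body1) R1) 0 = e /\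
    diag (flsem 4 env3 (FFor body1) R1) 3 =
    foldl (fun A d => greedy_step peel_ok peel A (u, d)) (diag R1 3) vs.
  move=> env3E R10; apply: (@foldl_proj _ _ _ (fun R d => flsem 5 (upd env3 4 d) body1 R)
    (fun A d => greedy_step peel_ok peel A (u, d)) (fun R => diag R 3) (fun R => R 0 = e)) => //.
  move=> R2 d R20; split; first by rewrite flsem_frame.
  by rewrite body1E R20 env3E.
have middle t R1 : R1 0 = e ->
    (flsem 3 (upd env 2 t) (FFor (FFor body1)) R1) 0 = e /\
    diag (flsem 3 (upd env 2 t) (FFor (FFor body1)) R1) 3 =
    foldl (greedy_step peel_ok peel) (diag R1 3) [seq (u, d) | u <- vs, d <- vs].
  move=> R10; rewrite -foldl_pairs.
  apply: (@foldl_proj _ _ _ (fun R u => flsem 4 (upd (upd env 2 t) 3 u) (FFor body1) R)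
    (fun A u => foldl (fun A d => greedy_step peel_ok peel A (u, d)) A vs)
    (fun R => diag R 3) (fun R => R 0 = e)) => //.
  by move=> R2 u R20; apply: inner.
have [] // := @foldl_proj _ _ _ (fun R t => flsem 3 (upd env 2 t) (FFor (FFor body1)) R)
  (fun A (_ : 'I_n) => foldl (greedy_step peel_ok peel) A [seq (u, d) | u <- vs, d <- vs])
  (fun R => diag R 3) (fun R => R 0 = e) vs R.
by move=> R2 t R20; apply: middle.
Qed.

Lemma merge_loopE K env R : arms_ready e K R ->
  (diag (flsem 2 env (FFor (FFor body2)) R) 7, flsem 2 env (FFor (FFor body2)) R 6) =
  merge_all K (diag R 7, R 6).
Proof.
move=> rd.
have middle t R1 : arms_ready e K R1 ->
    let R' := flsem 3 (upd env 2 t) (FFor body2) R1 in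
    arms_ready e K R' /\ (diag R' 7, R' 6) =
    foldl (greedy_step (mergeable e K) (merge_step e K)) (diag R1 7, R1 6) vs.
  move=> rd1; apply: (@foldl_proj _ _ _ (fun R x => flsem 4 (upd (upd env 2 t) 3 x) body2 R)
    (greedy_step (mergeable e K) (merge_step e K)) (fun R => (diag R 7, R 6)) (arms_ready e K)) => //.
  by move=> R2 x rd2; have [h1 h2] := body2E (upd (upd env 2 t) 3 x) rd2.
have [] // := @foldl_proj _ _ _ (fun R t => flsem 3 (upd env 2 t) (FFor body2) R)
  (fun s (_ : 'I_n) => foldl (greedy_step (mergeable e K) (merge_step e K)) s vs)
  (fun R => (diag R 7, R 6)) (arms_ready e K) vs R.
by move=> R2 t R20; apply: middle.
Qed.

Definition center v1 v2 := closed_nbhd e setT v1 :&: closed_nbhd e setT v2.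

Lemma center_bodyE env R : R 0 = e -> let R' := flsem 2 env center_body R in
  R' 0 = e /\ forall x y, R' 15 x y = R 15 x y || `[< star_center e (center (env 0) (env 1)) >].
Proof.
move=> R0 R'; split; first by rewrite /R' flsem_frame.
move=> x y; rewrite /R' /center_body 5!(flsem_seq 2 env); set K := center _ _.
set R1 := flsem 2 env (FDef 2 _) R.
have R10 : R1 0 = e by rewrite /R1 flsem_frame.
have R12 : diag R1 2 = K.
  apply/setP => z; rewrite inE /R1 flsem_def feval_and !feval_or /= R0 /upd /=.
  by rewrite /K /center in_setI !inE.
have R1a : R1 15 = R 15 by rewrite /R1 flsem_frame.
set R2 := flsem 2 env (FDef 3 _) R1.
have R20 : R2 0 = e by rewrite /R2 flsem_frame.
have R22 : diag R2 2 = K by rewrite /diag /R2 flsem_frame.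
have R23 : diag R2 3 = ~: K.
  by apply/setP => z; rewrite inE /R2 flsem_def feval_not /= diagP R12 /upd /= in_setC.
have R2a : R2 15 = R 15 by rewrite /R2 flsem_frame.
have R33 := peel_loopE env R20.
set R3 := flsem 2 env (FFor (FFor (FFor body1))) R2 in R33 *.
rewrite R23 in R33.
have R30 : R3 0 = e by rewrite /R3 flsem_frame.
have R32 : diag R3 2 = K by rewrite /diag /R3 flsem_frame.
have R3a : R3 15 = R 15 by rewrite /R3 flsem_frame.
have [] := arms_initE env R3; set R4 := flsem 2 env arms_init R3.
rewrite R30 R32 => rd4 e4.
have R43 : diag R4 3 = peel_all (~: K) by rewrite /diag /R4 flsem_frame.
have R4a : R4 15 = R 15 by rewrite /R4 flsem_frame.
have := merge_loopE env rd4; set R5 := flsem 2 env (FFor (FFor body2)) R4 => e5.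
rewrite e4 in e5.
have R50 : R5 0 = e by rewrite /R5 flsem_frame // (ar_e rd4).
have R52 : diag R5 2 = K by rewrite /diag /R5 flsem_frame // -[LHS]/(diag R4 2) (ar_K rd4).
have R53 : diag R5 3 = peel_all (~: K) by rewrite /diag /R5 flsem_frame.
have R5a : R5 15 = R 15 by rewrite /R5 flsem_frame.
have R57 : diag R5 7 = (merge_all K (K, same_comp e K)).1 by rewrite -e5.
have emptyE r : feval R5 2 env (fnot (FEx (FRel r 2 2))) = (diag R5 r == set0).
  rewrite feval_not feval_ex; apply/negP/eqP => [h|h [/existsP[z]]].
    apply/setP => z; rewrite in_set0; apply/negP => hz; apply: h; apply/existsP; exists z.
    by rewrite /= upd_eq diagP.
  by rewrite /= upd_eq diagP h in_set0.
have cliqueE : feval R5 2 env clique_form = clique e K.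
  rewrite /clique_form feval_all; apply: eq_forallb => a; rewrite feval_all.
  case ha: (a \in K); last first.
    by apply/forallP => b; rewrite feval_imp /= diagP R52 /upd /= ha.
  apply: eq_forallb => b; rewrite !feval_imp feval_not /= !diagP R52 R50 /upd /=.
  by rewrite ha.
rewrite flsem_if !feval_and cliqueE !emptyE R53 R57.
have -> : [&& clique e K, peel_all (~: K) == set0
    & (merge_all K (K, same_comp e K)).1 == set0] = `[< star_center e K >].
  apply/and3P/asboolP => [[h1 h2 h3]|[h1 h2 h3]].
    by split=> //; [apply/(peel_allE h1)|apply/merge_allE].
  by split=> //; [apply/(peel_allE h1)|apply/merge_allE].
by case: asbool; rewrite ?orbT ?orbF /= /upd /= ?R5a.
Qed.

End Center.

Lemma star_progE n (R : nat -> rel 'I_n.+1) : (forall x y, R 15 x y = false) ->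
  flsem 0 (fun=> ord0) star_prog R 15 ord0 ord0 <->
  [/\ symmetric (R 0), irreflexive (R 0)
    & exists v1 v2, star_center (R 0) (center (R 0) v1 v2)].
Proof.
move=> R15; set e := R 0; rewrite /star_prog flsem_if feval_and.
have -> : feval R 0 (fun=> ord0) (fall (fall (fimp (FRel 0 0 1) (FRel 0 1 0)))) = `[< symmetric e >].
  rewrite feval_all; apply/forallP/asboolP => h x.
    move=> y; have hh a b : e a b -> e b a.
      by move: (h a); rewrite feval_all => /forallP/(_ b); rewrite feval_imp => /implyP.
    by apply/idP/idP; apply: hh.
  by rewrite feval_all; apply/forallP => y; rewrite feval_imp /= /upd /= -/e h implybb.
have -> : feval R 0 (fun=> ord0) (fall (fnot (FRel 0 0 0))) = `[< irreflexive e >].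
  rewrite feval_all; apply/forallP/asboolP => h x.
    by apply/negbTE; move: (h x); rewrite feval_not /= /upd /=.
  by rewrite feval_not /= /upd /= -/e h.
case: asboolP => [eS|nS]; last by rewrite /= R15; split=> // -[].
case: asboolP => [eI|nI]; last by rewrite /= R15; split=> // -[].
change (flsem 0 (fun=> ord0) (FFor (FFor center_body)) R 15 ord0 ord0 <->
  [/\ symmetric e, irreflexive e & exists v1 v2, star_center e (center e v1 v2)]).
pose good v1 v2 := `[< star_center e (center e v1 v2) >].
have inner v1 R1 : R1 0 = e -> let R' := flsem 1 (upd (fun=> ord0) 0 v1) (FFor center_body) R1 in
    R' 0 = e /\ R' 15 ord0 ord0 = foldl (fun b v2 => b || good v1 v2) (R1 15 ord0 ord0) (enum 'I_n.+1).
  move=> R10; apply: (@foldl_proj _ _ _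
    (fun R v2 => flsem 2 (upd (upd (fun=> ord0) 0 v1) 1 v2) center_body R)
    (fun b v2 => b || good v1 v2) (fun R => R 15 ord0 ord0) (fun R => R 0 = e)) => //.
  by move=> R2 v2 R20; have [h1 h2] := center_bodyE eS (upd (upd (fun=> ord0) 0 v1) 1 v2) R20.
have orE (I : eqType) (P : pred I) b (xs : seq I) : foldl (fun b x => b || P x) b xs = b || has P xs.
  by elim: xs b => [|z xs IH] b /=; rewrite ?orbF // IH orbA.
have -> : flsem 0 (fun=> ord0) (FFor (FFor center_body)) R 15 ord0 ord0 =
    foldl (fun b v1 => foldl (fun b v2 => b || good v1 v2) b (enum 'I_n.+1))
      (R 15 ord0 ord0) (enum 'I_n.+1).
  exact: (proj2 (@foldl_proj _ _ _ (fun R v1 => flsem 1 (upd (fun=> ord0) 0 v1) (FFor center_body) R)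
    (fun b v1 => foldl (fun b v2 => b || good v1 v2) b (enum 'I_n.+1))
    (fun R => R 15 ord0 ord0) (fun R => R 0 = e) (enum 'I_n.+1) R
    (fun R1 v1 h => inner v1 R1 h) erefl)).
have -> : foldl (fun b v1 => foldl (fun b v2 => b || good v1 v2) b (enum 'I_n.+1)) (R 15 ord0 ord0) (enum 'I_n.+1) =
    has (fun v1 => has (good v1) (enum 'I_n.+1)) (enum 'I_n.+1).
  rewrite R15 -[RHS]orFb; move: false => b; elim: {2 4}(enum 'I_n.+1) b => [|v1 vs IH] b /=.
    by rewrite orbF.
  by rewrite IH orE orbA.
split=> [/hasP[v1 _ /hasP[v2 _ /asboolP h]]|[_ _ [v1 [v2 h]]]]; first by split=> //; exists v1, v2.
by apply/hasP; exists v1; rewrite ?mem_enum //; apply/hasP; exists v2; rewrite ?mem_enum //; apply/asboolP.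
Qed.

(** * The theorem *)

Lemma nth_pairs (S T A : Type) (f : S -> T -> A) x0 s0 t0 (s : seq S) (t : seq T) i j :
  i < size s -> j < size t ->
  nth x0 [seq f x y | x <- s, y <- t] (i * size t + j) = f (nth s0 s i) (nth t0 t j).
Proof.
elim: s i => // x s IH [|i] hi hj; rewrite /= nth_cat size_map.
  by rewrite mul0n add0n hj (nth_map t0).
by rewrite mulSn -addnA ltnNge leq_addr /= addKn IH.
Qed.

Lemma graph_enc_nth n (e : rel 'I_n) (i j : 'I_n) : nth false (graph_enc e) (i * n + j) = e i j.
Proof.
have := @nth_pairs _ _ _ (fun i j => e i j) false i j (enum 'I_n) (enum 'I_n) i j.
by rewrite size_enum_ord !nth_ord_enum; apply.
Qed.

Lemma size_graph_enc n (e : rel 'I_n) : size (graph_enc e) = n * n.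
Proof. by rewrite size_allpairs size_enum_ord. Qed.

Lemma star_model_center n (e : rel 'I_n.+1) : symmetric e -> irreflexive e ->
  has_star_NeS_model Rdefinitions.R e <-> exists v1 v2, star_center e (center e v1 v2).
Proof.
move=> eS eI; split=> [|[v1 [v2 h]]]; last by apply: star_center_model h.
move=> /star_polar[arm [r [w /(polar_maximal eS)[r' [w' [pm hmax]]]]]].
have [v1 [v2 hc]] := polar_center (ltn0Sn n) pm hmax.
by exists v1, v2; rewrite /center -hc; apply: polar_star_center pm; assumption.
Qed.

Lemma star_nesE w : STAR_NES w <-> w = [::] \/ exists n, size w = n.+1 * n.+1 /\
  flsem 0 (fun=> ord0) star_prog (input_rels (n := n.+1) w) 15 ord0 ord0.
Proof.
split.
  move=> [[|n] [e [eS [eI [-> hm]]]]]; [left|right].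
    by apply/nilP; rewrite /nilp size_graph_enc.
  exists n; split; first exact: size_graph_enc.
  apply/star_progE => //.
  have -> : input_rels (graph_enc e) 0 = e.
    by apply: funext => i; apply: funext => j; rewrite /input_rels /= graph_enc_nth.
  by split=> //; apply/star_model_center.
move=> [->|[n [hs /star_progE [] // eS eI hc]]].
  (* The graph without vertices is modelled by a star without arms. *)
  exists 0, (fun _ _ => false); split=> //; split=> //; split.
    by apply/esym/nilP; rewrite /nilp size_graph_enc.
  exists 0, (0, 0)%R, (fun=> (0, 0)%R), (fun=> (0, 0)%R), (fun=> 0%R).
  by split; [split=> -[]|split; [case|split; [case|case]]].
exists n.+1, (input_rels w 0); do 2 split => //; split; last exact/star_model_center.
apply: (@eq_from_nth _ false); first by rewrite size_graph_enc.
move=> k; rewrite hs => hk.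
have hi : k %/ n.+1 < n.+1 by rewrite ltn_divLR.
have hj : k %% n.+1 < n.+1 by rewrite ltn_mod.
have := graph_enc_nth (input_rels w 0) (Ordinal hi) (Ordinal hj).
by rewrite /= -divn_eq => ->; rewrite /input_rels /= -divn_eq.
Qed.

Theorem theorem4 : exists M : TM, decides_in_poly_time M STAR_NES.
Proof.
(* Relations 0 to 15 take 16 arrays, with the verdict in 15; 60 is an ample bound on the variable
   numbers, verified by evaluating [cwf]. *)
have [||| M HM] := @fl_decides 60 16 15 star_prog; [by []|by vm_compute|by []|].
by exists M; apply: HM; apply: star_nesE.
Qed.
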